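(* Let $\lambda>0$ and $1<\alpha<2$, and choose $d\in(-\frac12,\frac12)\setminus\{0\}$ such that $d+\frac1\alpha\in(0,1)$. For such $d$, let $S^{*}_{d,\lambda}=\{S^{*}_{d,\lambda}(t)\}_{t\in\mathbb{R}}$ be either a tempered fractional Lévy process of the first kind $S^{I}_{d,\lambda}$ or of the second kind $S^{I\!I}_{d,\lambda}$, driven by a Lévy process $L$ whose Lévy measure is of the form $\nu(dx)=h(x)\,dx$ with $$h(x)\sim|x|^{-1-\alpha},\qquad x\to 0.$$ Then $S^{*}_{d,\lambda}$ is not a $(\mathcal{F}^{L,\infty}_t)_{t\ge 0}$-semimartingale.
   Context: Driving Lévy process. $L=\{L(t)\}_{t\in\mathbb{R}}$ is the two-sided Lévy process $L(t)=L_1(t)\mathbf 1_{[0,\infty)}(t)-L_2((-t)-)\mathbf 1_{(-\infty,0)}(t)$, where $L_1,L_2$ are independent copies of a Lévy process on $[0,\infty)$. It is centered ($\mathbb{E}[L(1)]=0$), has no Brownian component, and $\mathbb{E}[e^{i\theta L(t)}]=e^{t\psi(\theta)}$ for $t\ge 0$, with $\psi(\theta)=\int_{\mathbb{R}}(e^{i\theta x}-1-i\theta x)\,\nu(dx)$, where the Lévy measure $\nu$ satisfies $\nu(\{0\})=0$, $\int(|x|^2\wedge 1)\nu(dx)<\infty$ and $\int_{|x|>1}x^2\nu(dx)<\infty$; hence $\mathbb{E}[L(1)^2]<\infty$. For deterministic $f\in L^2(\mathbb{R})$, $\int_{\mathbb{R}} f\,dL$ is the usual Wiener-type integral in $L^2(\Omega)$.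 Filtration. $(\mathcal{F}^{L,\infty}_t)_{t\ge0}$ is the smallest filtration such that $\sigma(L(s):-\infty<s\le t)\subseteq\mathcal{F}^{L,\infty}_t$ for all $t\ge 0$. Notation. $(x)_+=x\mathbf 1_{\{x>0\}}$, and $(x)_+^p$ is $x^p$ for $x>0$ and $0$ for $x\le 0$ (for every real $p$). Integrals $\int_0^t$ with $t<0$ are oriented. Processes. For $d>-\frac12$, $\lambda>0$, $t\in\mathbb{R}$, $$S^{I}_{d,\lambda}(t)=\frac{1}{\Gamma(1+d)}\int_{\mathbb{R}}\Big[e^{-\lambda(t-x)_+}(t-x)_+^{d}-e^{-\lambda(-x)_+}(-x)_+^{d}\Big]dL(x),$$ $$S^{I\!I}_{d,\lambda}(t)=\frac{1}{\Gamma(d+1)}\int_{\mathbb{R}}\Big[(t-y)_+^{d}e^{-\lambda(t-y)_+}-(-y)_+^{d}e^{-\lambda(-y)_+}+\lambda\int_0^t(s-y)_+^{d}e^{-\lambda(s-y)_+}ds\Big]dL(y).$$ *)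

(* Defs.v *)
From HB Require Import structures.
From mathcomp Require Import all_boot all_order all_algebra.
From mathcomp Require Import all_classical all_reals all_analysis.
From mathcomp Require Import complex.

Set Implicit Arguments.
Unset Strict Implicit.
Unset Printing Implicit Defensive.

Import Order.TTheory GRing.Theory Num.Theory.
Import numFieldNormedType.Exports.

Local Open Scope classical_set_scope.
Local Open Scope ring_scope.

(* Processes are indexed by the whole real line; notions concerning processes
   on the half-line only look at times [0 <= t]. *)

Section Processes.
Context {disp : measure_display} {T : measurableType disp} {R : realType}.
Variable P : probability T R.
Implicit Types (X M : R -> T -> R) (F : R -> set (set T)).

Definition sigma_process X (I : set R) : set (set T) :=
  <<s \bigcup_(t in I) preimage_set_system setT (X t) measurable >>.

Definition independent_systems (G H : set (set T)) : Prop :=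
  forall A B, G A -> H B -> P (A `&` B) = (P A * P B)%E.

Definition cadlag (x : R -> R) : Prop :=
  (forall t, 0 <= t -> x s @[s --> t^'+] --> x t) /\
  (forall t, 0 < t -> cvg (x s @[s --> t^'-])).

(* A filtration is meant to satisfy the usual conditions: it is
   right-continuous and contains the null events. *)
Record filtration F : Prop := {
  filtration_sigma : forall t : R, 0 <= t -> sigma_algebra setT (F t) ;
  filtration_measurable : forall t : R, 0 <= t -> F t `<=` measurable ;
  filtration_mono : forall s t : R, 0 <= s -> s <= t -> F s `<=` F t ;
  filtration_right_cont : forall t : R, 0 <= t ->
    \bigcap_(u in [set u | t < u]) F u `<=` F t ;
  filtration_null : forall A, measurable A -> P A = 0%E -> F 0 A }.

(* The smallest filtration whose member at each [s >= 0] contains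
   sigma(L(u) : u <= s); an intersection of filtrations is a filtration. *)
Definition past_filtration (L : R -> T -> R) (t : R) : set (set T) :=
  [set A | forall F, filtration F ->
     (forall s, 0 <= s -> sigma_process L [set u | u <= s] `<=` F s) -> F t A].

Definition adapted F X : Prop :=
  forall t, 0 <= t -> forall B, measurable B -> F t (X t @^-1` B).

(* E[M_t | F_s] = M_s, in terms of integrals over the events of F_s. *)
Record martingale F M : Prop := {
  martingale_adapted : adapted F M ;
  martingale_integrable : forall t : R, 0 <= t ->
    P.-integrable setT (fun w => (M t w)%:E) ;
  martingale_cond : forall s t : R, 0 <= s -> s <= t -> forall A, F s A ->
    (\int[P]_(w in A) (M t w)%:E = \int[P]_(w in A) (M s w)%:E)%E }.

Definition stopping_time F (tau : T -> \bar R) : Prop :=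
  (forall w, (0 <= tau w)%E) /\
  (forall t, 0 <= t -> F t [set w | (tau w <= t%:E)%E]).

Definition stopped (tau : T -> \bar R) X : R -> T -> R :=
  fun t w => X (fine (Order.min (tau w) t%:E)) w.

(* Local martingale started at 0. *)
Definition local_martingale0 F M : Prop :=
  [/\ adapted F M,
      {ae P, forall w, cadlag (M^~ w) /\ M 0 w = 0} &
      exists tau : nat -> T -> \bar R,
        [/\ forall n, stopping_time F (tau n),
            {ae P, forall w, (forall n, (tau n w <= tau n.+1 w)%E) /\
                             tau n w @[n --> \oo] --> +oo%E} &
            forall n, martingale F (stopped (tau n) M)]].

Definition finite_variation0 F (A : R -> T -> R) : Prop :=
  adapted F A /\
  {ae P, forall w, [/\ cadlag (A^~ w), A 0 w = 0 &
                       forall t, 0 <= t -> bounded_variation 0 t (A^~ w)]}.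

Definition semimartingale F X : Prop :=
  exists M A,
    [/\ forall B, measurable B -> F 0 (X 0 @^-1` B),
        local_martingale0 F M,
        finite_variation0 F A &
        {ae P, forall w, forall t, 0 <= t -> X t w = X 0 w + M t w + A t w}].

Record levy_process X : Prop := {
  levy_start : {ae P, forall w, X 0 w = 0} ;
  levy_cadlag : {ae P, forall w, cadlag (X^~ w)} ;
  levy_indep : forall (n : nat) (t : nat -> R) (B : nat -> set R),
    0 <= t 0%N -> (forall i, t i <= t i.+1) -> (forall i, measurable (B i)) ->
    P (\bigcap_(i in `I_n) [set w | B i (X (t i.+1) w - X (t i) w)]) =
    (\prod_(i < n) P [set w | B i (X (t i.+1) w - X (t i) w)%R])%E ;
  levy_stationary : forall (s h : R) (B : set R),
    0 <= s -> 0 <= h -> measurable B ->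
    P [set w | B (X (s + h) w - X s w)] = P [set w | B (X h w)] }.

Definition same_law X Y : Prop :=
  forall (n : nat) (t : 'I_n -> R) (B : 'I_n -> set R),
    (forall i, 0 <= t i) -> (forall i, measurable (B i)) ->
    P (\bigcap_i (X (t i) @^-1` B i)) = P (\bigcap_i (Y (t i) @^-1` B i)).

Definition independent_copies X Y : Prop :=
  [/\ levy_process X, levy_process Y, same_law X Y &
      independent_systems (sigma_process X [set t | 0 <= t])
                          (sigma_process Y [set t | 0 <= t])].

Definition two_sided (L1 L2 : R -> T -> R) : R -> T -> R :=
  fun t w => if 0 <= t then L1 t w else - lim (L2 s w @[s --> (- t)^'-]).

Definition expC (z : R[i]) : R[i] :=
  Complex (expR (complex.Re z) * cos (complex.Im z))
          (expR (complex.Re z) * sin (complex.Im z)).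

(* E[exp (i theta X)] *)
Definition char_fun (X : T -> R) (theta : R) : R[i] :=
  Complex (\int[P]_w cos (theta * X w)) (\int[P]_w sin (theta * X w)).

(* psi(theta) = \int (exp (i theta x) - 1 - i theta x) nu(dx) *)
Definition levy_exponent (nu : {measure set R -> \bar R}) (theta : R) : R[i] :=
  Complex (\int[nu]_x (cos (theta * x) - 1))
          (\int[nu]_x (sin (theta * x) - theta * x)).

Record levy_measure2 (nu : {measure set R -> \bar R}) : Prop := {
  levy_measure_0 : nu [set 0] = 0%E ;
  levy_measure_small :
    (\int[nu]_x (Order.min (`|x| ^+ 2) 1)%:E < +oo)%E ;
  levy_measure_large :
    (\int[nu]_(x in [set x : R | (1 < `|x|)%R]) (x ^+ 2)%:E < +oo)%E }.

Record driving_levy (nu : {measure set R -> \bar R})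
    (L : R -> {RV P >-> R}) : Prop := {
  driving_two_sided : exists L1 L2 : R -> {RV P >-> R},
    independent_copies L1 L2 /\
    forall t w, L t w = two_sided L1 L2 t w ;
  driving_measure : levy_measure2 nu ;
  driving_centered : ('E_P[L 1%R] = 0)%E ;
  driving_exponent : forall t theta : R, 0 <= t ->
    char_fun (L t) theta = expC (t%:C%C * levy_exponent nu theta) }.

(* A step function \sum_k a_k 1_(s_k, t_k] is encoded by the list of the
   triples (a_k, (s_k, t_k)). *)
Definition wf_steps (p : seq (R * (R * R))) : bool :=
  all (fun q => q.2.1 <= q.2.2) p.

Definition step_fun (p : seq (R * (R * R))) (x : R) : R :=
  \sum_(q <- p) q.1 * \1_(`]q.2.1, q.2.2]%classic) x.

Definition step_int (L : R -> T -> R) (p : seq (R * (R * R))) (w : T) : R :=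
  \sum_(q <- p) q.1 * (L q.2.2 w - L q.2.1 w).

(* [Y] is (a version of) \int_R f dL, for f in L^2(R): the limit in L^2(P) of
   the integrals of step functions converging to f in L^2(R). *)
Definition wiener_integral (L : R -> T -> R) (f : R -> R) (Y : T -> R) : Prop :=
  [/\ measurable_fun setT f,
      lebesgue_measure.-integrable setT (fun x => (f x ^+ 2)%:E) &
      exists phi : nat -> seq (R * (R * R)),
        [/\ forall n, wf_steps (phi n),
            (\int[lebesgue_measure]_x ((step_fun (phi n) x - f x) ^+ 2)%:E
               @[n --> \oo] --> 0)%E &
            (\int[P]_w ((step_int L (phi n) w - Y w) ^+ 2)%:E
               @[n --> \oo] --> 0)%E]].

End Processes.

Section TemperedFractional.
Context {R : realType}.

Definition Gamma (a : R) : R :=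
  \int[lebesgue_measure]_(x in `]0, +oo[) (x `^ (a - 1) * expR (- x)).

Definition pos_part (x : R) : R := if 0 < x then x else 0.

(* [powR] is not 0 at nonpositive arguments, e.g. [0 `^ 0 = 1]. *)
Definition pos_pow (x p : R) : R := if 0 < x then x `^ p else 0.

Definition oriented_int (a b : R) (f : R -> R) : R :=
  if a <= b then \int[lebesgue_measure]_(s in `[a, b]) f s
  else - \int[lebesgue_measure]_(s in `[b, a]) f s.

Definition tempered_pow (d lambda x : R) : R :=
  expR (- (lambda * pos_part x)) * pos_pow x d.

Definition kernel1 (d lambda t x : R) : R :=
  tempered_pow d lambda (t - x) - tempered_pow d lambda (- x).

Definition kernel2 (d lambda t y : R) : R :=
  tempered_pow d lambda (t - y) - tempered_pow d lambda (- y)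
  + lambda * oriented_int 0 t (fun s => tempered_pow d lambda (s - y)).

(* [S] is a version of the process with S(t) = 1/Gamma(1+d) \int_R k_t dL. *)
Definition levy_moving_average {disp : measure_display}
    {T : measurableType disp} (P : probability T R) (L : R -> {RV P >-> R})
    (d : R) (k : R -> R -> R) (S : R -> {RV P >-> R}) : Prop :=
  forall t, exists Y : {RV P >-> R},
    wiener_integral P L (k t) Y /\
    {ae P, forall w, S t w = (Gamma (1 + d))^-1 * Y w}.

Definition TFLP1 {disp : measure_display} {T : measurableType disp}
    (P : probability T R) (L : R -> {RV P >-> R}) (d lambda : R)
    (S : R -> {RV P >-> R}) : Prop :=
  levy_moving_average L d (kernel1 d lambda) S.

Definition TFLP2 {disp : measure_display} {T : measurableType disp}
    (P : probability T R) (L : R -> {RV P >-> R}) (d lambda : R)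
    (S : R -> {RV P >-> R}) : Prop :=
  levy_moving_average L d (kernel2 d lambda) S.

End TemperedFractional.

(* Main.v *)
Require Import Defs.
From HB Require Import structures.
From mathcomp Require Import all_boot all_order all_algebra.
From mathcomp Require Import all_classical all_reals all_analysis.
From mathcomp Require complex.
From mathcomp Require Import measurable_realfun.
From mathcomp Require Import ring lra zify.

Set Implicit Arguments.
Unset Strict Implicit.
Unset Printing Implicit Defensive.

Import Order.TTheory GRing.Theory Num.Theory.
Import numFieldNormedType.Exports.

Local Open Scope classical_set_scope.
Local Open Scope ring_scope.

(** For a step [h], the increment of the kernel over [[t, t + h]] is at least of
order [h `^ d] on [[t - 2 h, t - h]].  So [S (t + h) - S t] is, up to a scalar, a
part [B] measurable with respect to the past of [L] at time [t], plus an
independent centred noise of variance [O (h `^ (2 d + 1))].  The Levy measure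
makes [Re psi] of order [v `^ alpha], so the characteristic function of [B] is
small at a frequency of order [h `^ - (d + 1 / alpha)], and [`|B|] exceeds a
multiple of [h `^ (d + 1 / alpha)] with probability bounded below.

Suppose [S = S 0 + M + A] is a semimartingale.  Stop when the martingale or the
variation of [A] gets large, and test the [n = 1 / h] increments on [[0, 1]]
against the sign of [B], which is known at the start of each step: the martingale
and [A] contribute [O (1)] and the noise [O (h `^ d)], while the sum of the
[`|B|] has expectation at least of order [n * h `^ (d + 1 / alpha)].  Multiplying
by [h], [h `^ (d + 1 / alpha) = O (h + h `^ (1 + d))], which fails as [h --> 0]
because [d + 1 / alpha < 1] and [1 / alpha < 1]. *)

(** * Kernel increments *)

(** The Wiener integral is given only as an [L^2] limit of step integrals, while independence,
    centring and characteristic functions are computed exactly for step integrals. Each kernel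
    increment is therefore replaced by a step function, with a tolerance chosen after [h]; the error
    costs [O(h)] per step in [L^1]. The exponent of [L] is prescribed at nonnegative times only. The
    strip that makes [B] fluctuate must lie in [[0, t]], so the first two steps are discarded. What
    happened earlier is an arbitrary past variable: independence makes it a factor of modulus at
    most 1. Since no moment of [B] is at hand, its sign is used only where [|B|] is at most some
    cap. The local martingale need not be square integrable, and both parts may jump. Stopping one
    step early removes the jump of [A] that breaks the bound, but the indicator then looks one step
    ahead. The resulting error lives on the event of exit at that step, and a path exits at most
    once, so first moments of the stopped martingale are enough. *)

Section PowerIntegrals.
Context {R : realType}.
Notation mu := (@lebesgue_measure R).

(** At the ends of the union the integrand may blow up and [F] may fail to be differentiable. The
    fundamental theorem is used on each compact interval, and the uniform bound passes to the limit
    by monotone convergence. *)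
Lemma integral_bigcup_le_FTC (f F : R -> R) (u v : nat -> R) (M : R) :
  (forall k, u k < v k) ->
  {homo u : m n / (m <= n)%N >-> n <= m} ->
  {homo v : m n / (m <= n)%N >-> m <= n} ->
  (forall k x, u k <= x <= v k ->
     [/\ 0 <= f x, {for x, continuous f} & is_derive x 1 F (f x)]) ->
  (forall k, F (v k) - F (u k) <= M) ->
  (\int[mu]_(x in \bigcup_k `[u k, v k]%classic) (f x)%:E <= M%:E)%E.
Proof.
move=> uv du dv fF FM.
have cf k : {within `[u k, v k]%classic, continuous f}.
  apply: continuous_in_subspaceT => x; rewrite inE/= in_itv/= => xk.
  by case: (fF k x xk).
have nd : nondecreasing_seq (fun k => `[u k, v k]%classic : set R).
  move=> m n mn; rewrite subsetEset => x /=; rewrite !in_itv/= => /andP[h1 h2].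
  by rewrite (le_trans (du _ _ mn) h1) (le_trans h2 (dv _ _ mn)).
have mf k : measurable_fun `[u k, v k]%classic (EFin \o f).
  apply/measurable_EFinP; apply: subspace_continuous_measurable_fun => //.
have h := @ge0_nondecreasing_set_cvg_integral _ _ _ _ _ mu nd
  (fun k => measurable_itv _) mf.
have f0 k x : `[u k, v k]%classic x -> (0 <= (f x)%:E)%E.
  by rewrite /= in_itv/= lee_fin => xk; case: (fF k x xk).
have {}h := h f0.
rewrite -(cvg_lim _ h)//; apply: lime_le; first exact: (cvgP _ h).
apply: nearW => k.
rewrite (@continuous_FTC2 _ _ F)//; first by rewrite -EFinB lee_fin.
- have dF x : u k <= x <= v k -> derivable F x 1.
    by move=> /fF[_ _ [? _]].
  have cF x : u k <= x <= v k -> {for x, continuous F}.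
    by move=> /dF /derivable1_diffP/differentiable_continuous.
  split.
  + move=> x; rewrite in_itv/= => /andP[h1 h2]; apply: dF.
    by rewrite !ltW.
  + by apply: cvg_at_right_filter; apply: cF; rewrite lexx ltW.
  + by apply: cvg_at_left_filter; apply: cF; rewrite lexx ltW.
- move=> x; rewrite in_itv/= => /andP[h1 h2]; rewrite derive1E.
  have [|_ _ [_ ->]] := fF k x => //.
  by rewrite !ltW.
Qed.

(** Denominators start at 3 so that already the first closed interval is nondegenerate. *)
Lemma bigcup_itvoo (a b : R) : a < b ->
  `]a, b[%classic = \bigcup_k `[a + (b - a) / k.+3%:R, b - (b - a) / k.+3%:R]%classic.
Proof.
move=> ab; apply/seteqP; split => x /=.
  rewrite in_itv/= => /andP[ax xb].
  pose e := Num.min (x - a) (b - x).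
  have e0 : 0 < e by rewrite lt_min !subr_gt0 ax xb.
  have ba : 0 < b - a by rewrite subr_gt0.
  pose k := Num.truncn ((b - a) / e).
  have hk : (b - a) / k.+3%:R <= e.
    rewrite ler_pdivrMr// mulrC -ler_pdivrMr//.
    apply: ltW; apply: (lt_trans (truncnS_gt _)).
    by rewrite ltr_nat.
  exists k => //=; rewrite in_itv/=.
  move: hk; rewrite le_min; set z := (b - a) / _ => /andP[h1 h2].
  by apply/andP; split; lra.
move=> [k _] /=; rewrite !in_itv/= => /andP[h1 h2].
have e0 : 0 < (b - a) / k.+3%:R by rewrite divr_gt0 ?subr_gt0.
move: e0 h1 h2; set z := (b - a) / _ => e0 h1 h2.
by apply/andP; split; lra.
Qed.

Lemma integral_itvoo_le_FTC (f F : R -> R) (a b M : R) : a < b ->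
  (forall x, a < x < b ->
     [/\ 0 <= f x, {for x, continuous f} & is_derive x 1 F (f x)]) ->
  (forall x y, a < x -> x < y -> y < b -> F y - F x <= M) ->
  (\int[mu]_(x in `]a, b[) (f x)%:E <= M%:E)%E.
Proof.
move=> ab fF FM.
have ba : 0 < b - a by rewrite subr_gt0.
have e0 k : 0 < (b - a) / k.+3%:R by rewrite divr_gt0.
have e1 k : (b - a) / k.+3%:R <= (b - a) / 3.
  by rewrite ler_pM2l// lef_pV2 ?posrE// ler_nat.
rewrite bigcup_itvoo//; apply: (@integral_bigcup_le_FTC _ F).
- by move=> k; have := e1 k; set z := (b - a) / k.+3%:R; lra.
- move=> m n mn; rewrite lerD2l ler_pM2l// lef_pV2 ?posrE// ler_nat.
  by rewrite !ltnS.
- move=> m n mn; rewrite lerD2l lerN2 ler_pM2l// lef_pV2 ?posrE// ler_nat.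
  by rewrite !ltnS.
- move=> k x /andP[]; have := e0 k; set z := (b - a) / _ => ? ? ?; apply: fF.
  by apply/andP; split; lra.
- move=> k; have := e0 k; have := e1 k; set z := (b - a) / k.+3%:R => ? ?; apply: FM; lra.
Qed.

Lemma continuous_powR (p x : R) : 0 < x -> {for x, continuous (@powR R ^~ p)}.
Proof.
move=> x0; apply/differentiable_continuous/derivable1_diffP.
by apply: derivable_powR; rewrite in_itv/= x0.
Qed.

Lemma integral_powR_left (a b p : R) : a < b -> -1 < p ->
  (\int[mu]_(x in `]a, b[) ((x - a) `^ p)%:E
    <= ((b - a) `^ (p + 1) / (p + 1))%:E)%E.
Proof.
move=> ab p1; have p0 : 0 < p + 1 by lra.
apply: (@integral_itvoo_le_FTC _ (fun x => (x - a) `^ (p + 1) / (p + 1))) => //.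
- move=> x /andP[ax xb]; have xa : 0 < x - a by rewrite subr_gt0.
  split; first exact: powR_ge0.
  + apply: (@continuous_comp _ _ _ (fun x => x - a) (@powR R ^~ p)).
      by apply: continuousB; [exact: id|exact: cst_continuous].
    exact: continuous_powR.
  + have h : is_derive x 1 ((@powR R ^~ (p + 1)) \o (fun y => y - a))
      ((p + 1) * (x - a) `^ (p + 1 - 1) * 1).
      apply: (@is_derive1_comp _ (@powR R ^~ (p + 1)) (fun y => y - a) x _ 1).
        exact: is_derive1_powR.
      by apply: is_derive_eq; rewrite subr0.
    have := is_deriveM h (is_derive_cst ((p+1)^-1) x 1).
    move=> h'; apply: (is_derive_eq h').
    rewrite scaler0 add0r /GRing.scale/= addrK mulr1 mulrA mulVf ?mul1r//.
    by rewrite gt_eqF.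
- move=> x y ax xy yb.
  have : 0 <= (x - a) `^ (p + 1) / (p + 1).
    by rewrite divr_ge0 ?powR_ge0 ?ltW.
  have : (y - a) `^ (p + 1) / (p + 1) <= (b - a) `^ (p + 1) / (p + 1).
    rewrite ler_pM2r ?invr_gt0//; apply: ge0_ler_powR; rewrite ?nnegrE; lra.
  lra.
Qed.

Lemma integral_powR_right (a b p : R) : a < b -> -1 < p ->
  (\int[mu]_(x in `]a, b[) ((b - x) `^ p)%:E
    <= ((b - a) `^ (p + 1) / (p + 1))%:E)%E.
Proof.
move=> ab p1; have p0 : 0 < p + 1 by lra.
apply: (@integral_itvoo_le_FTC _ (fun x => (b - x) `^ (p + 1) / - (p + 1))) => //.
- move=> x /andP[ax xb]; have xa : 0 < b - x by rewrite subr_gt0.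
  split; first exact: powR_ge0.
  + apply: (@continuous_comp _ _ _ (fun x => b - x) (@powR R ^~ p)).
      by apply: continuousB; [exact: cst_continuous|exact: id].
    exact: continuous_powR.
  + have h : is_derive x 1 ((@powR R ^~ (p + 1)) \o (fun y => b - y))
      ((p + 1) * (b - x) `^ (p + 1 - 1) * -1).
      apply: (@is_derive1_comp _ (@powR R ^~ (p + 1)) (fun y => b - y) x _ (-1)).
        exact: is_derive1_powR.
      by apply: is_derive_eq; rewrite add0r mul1r.
    have := is_deriveM h (is_derive_cst ((- (p+1))^-1) x 1).
    move=> h'; apply: (is_derive_eq h').
    rewrite scaler0 add0r /GRing.scale/= addrK.
    have pn : p + 1 != 0 by rewrite gt_eqF.
    by field.
- move=> x y ax xy yb.
  have : 0 <= (b - y) `^ (p + 1) / (p + 1).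
    by rewrite divr_ge0 ?powR_ge0 ?ltW.
  have : (b - x) `^ (p + 1) / (p + 1) <= (b - a) `^ (p + 1) / (p + 1).
    rewrite ler_pM2r ?invr_gt0//; apply: ge0_ler_powR; rewrite ?nnegrE; lra.
  rewrite invrN !mulrN; lra.
Qed.

End PowerIntegrals.

(** * Bounds for the tempered power function *)

Section KernelBounds.
Context {R : realType}.
Notation mu := (@lebesgue_measure R).
Variables (d lambda : R).
Hypotheses (l0 : 0 < lambda) (d1 : - 2^-1 < d :> R) (d2 : d < 2^-1 :> R) (d0 : d != 0).
Local Notation tp := (tempered_pow d lambda).

Lemma tempered_pow_le0 v : v <= 0 -> tp v = 0.
Proof. by move=> v0; rewrite /tempered_pow /pos_pow ltNge v0 mulr0. Qed.

Lemma tempered_pow_gt0 v : 0 < v -> tp v = expR (- (lambda * v)) * v `^ d.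
Proof. by move=> v0; rewrite /tempered_pow /pos_pow /pos_part v0. Qed.

Lemma tempered_pow_ge0 v : 0 <= tp v.
Proof.
by rewrite mulr_ge0 ?expR_ge0// /pos_pow; case: ifPn => // _; exact: powR_ge0.
Qed.

Lemma tempered_pow_le v : 0 < v -> tp v <= v `^ d.
Proof.
move=> v0; rewrite tempered_pow_gt0// ler_piMl ?powR_ge0//.
by rewrite -expR0 ler_expR oppr_le0 mulr_ge0 ?ltW.
Qed.

Lemma measurable_pos_pow p : measurable_fun setT (fun v : R => pos_pow v p).
Proof.
apply: measurable_fun_ifT.
- by apply: measurable_fun_ltr; [exact: measurable_cst|exact: measurable_id].
- exact: measurable_powR.
- exact: measurable_cst.
Qed.

Lemma measurable_tempered_pow : measurable_fun setT (tp : R -> R).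
Proof.
apply: measurable_funM; last exact: measurable_pos_pow.
apply: measurableT_comp => //; apply: measurableT_comp => //.
apply: measurable_funM => //.
apply: measurable_fun_ifT.
- by apply: measurable_fun_ltr; [exact: measurable_cst|exact: measurable_id].
- exact: measurable_id.
- exact: measurable_cst.
Qed.

Lemma measurable_tempered_pow_shift x :
  measurable_fun setT (fun s : R => tp (s - x)).
Proof.
apply: (measurableT_comp measurable_tempered_pow).
by apply: measurable_funB => //; exact: measurable_id.
Qed.

Lemma integral_tempered_pow_le (A : set R) (x b : R) : measurable A ->
  A `<=` [set s | s < b] -> x < b ->
  (\int[mu]_(s in A) (tp (s - x))%:E <= ((b - x) `^ (d + 1) / (d + 1))%:E)%E.
Proof.
move=> mA Ab xb.
have d1' : -1 < d by move: d1; lra.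
apply: le_trans (integral_powR_left xb d1').
have mtp : measurable_fun [set: R] (fun s : R => (tp (s - x))%:E).
  by apply/measurable_EFinP; exact: measurable_tempered_pow_shift.
rewrite integral_mkcond [leRHS]integral_mkcond.
apply: ge0_le_integral => //.
- by move=> s _; apply: erestrict_ge0 => ? _; rewrite lee_fin tempered_pow_ge0.
- by apply/(measurable_restrictT _ mA); exact: measurable_funTS.
- apply/(measurable_restrictT _ (measurable_itv _)); apply: measurable_funTS.
  apply/measurable_EFinP; apply: (measurableT_comp (measurable_powR _)).
  by apply: measurable_funB => //; exact: measurable_id.
- move=> s _; rewrite !patchE; case: ifP => sA; case: ifPn => sx //.
  + rewrite lee_fin tempered_pow_le//.
    by move: sx; rewrite inE/= in_itv/= subr_gt0 => /andP[].
  + rewrite lee_fin tempered_pow_le0// subr_le0 leNgt.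
    apply: contra sx => xs; rewrite inE/= in_itv/= xs/=.
    by apply: Ab; rewrite inE in sA.
  + by rewrite lee_fin powR_ge0.
Qed.

Lemma integrable_tempered_pow (A : set R) (x b : R) : measurable A ->
  A `<=` [set s | s < b] ->
  mu.-integrable A (fun s => (tp (s - x))%:E).
Proof.
move=> mA Ab; apply/integrableP; split.
  apply/measurable_EFinP; apply: measurable_funTS.
  exact: measurable_tempered_pow_shift.
under eq_integral do rewrite gee0_abs ?lee_fin ?tempered_pow_ge0//.
(* Raising [b] to at least [x + 1] covers the case [b <= x], which the estimate excludes. *)
apply: (@le_lt_trans _ _
  (((Num.max b (x + 1) - x) `^ (d + 1) / (d + 1))%:E)%E); last exact: ltry.
apply: integral_tempered_pow_le => //.
  by move=> s /Ab/= sb; rewrite lt_max sb.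
by rewrite lt_max ltrDl ltr01 orbT.
Qed.

Lemma oriented_int_tempered_pow (t h x : R) : 0 <= t -> 0 < h ->
  oriented_int 0 (t + h) (fun s => tp (s - x))
    - oriented_int 0 t (fun s => tp (s - x))
  = \int[mu]_(s in `]t, t + h]) tp (s - x).
Proof.
move=> t0 h0; rewrite /oriented_int t0 addr_ge0 ?(ltW h0)//.
rewrite Rintegral_itvB//.
- apply: (@integrable_tempered_pow _ _ (t + h + 1)) => // s/=.
  by rewrite in_itv/= => /andP[_ sh]; rewrite (le_lt_trans sh)// ltrDl.
- by rewrite bnd_simp lerDl ltW.
Qed.

Lemma oriented_int_tempered_pow_ge0 (t h x : R) : 0 <= t -> 0 < h ->
  0 <= oriented_int 0 (t + h) (fun s => tp (s - x))
    - oriented_int 0 t (fun s => tp (s - x)).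
Proof.
move=> t0 h0; rewrite oriented_int_tempered_pow//.
by apply: Rintegral_ge0 => s _; exact: tempered_pow_ge0.
Qed.

Lemma oriented_int_tempered_pow_le (t h x : R) : 0 <= t -> 0 < h -> x < t + h ->
  oriented_int 0 (t + h) (fun s => tp (s - x))
    - oriented_int 0 t (fun s => tp (s - x))
  <= (t + h - x) `^ (d + 1) / (d + 1).
Proof.
move=> t0 h0 xth; rewrite oriented_int_tempered_pow//.
rewrite -Rintegral_itv_bndo_bndc; last first.
  apply: (@integrable_tempered_pow _ _ (t + h + 1)) => // s/=.
  by rewrite in_itv/= => /andP[_ sh]; rewrite (lt_trans sh)// ltrDl.
rewrite /Rintegral.
have h1 : (\int[mu]_(s in `]t, (t + h)%R[) (tp (s - x))%:E <=
   ((t + h - x)%R `^ (d + 1) / (d + 1))%:E)%E.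
  apply: integral_tempered_pow_le => // s/=.
  by rewrite in_itv/= => /andP[].
rewrite -lee_fin fineK// ge0_fin_numE; first exact: le_lt_trans h1 (ltry _).
by apply: integral_ge0 => s _; rewrite lee_fin tempered_pow_ge0.
Qed.

(* Scaling [u = h r]: the increment of [u `^ d] over a step [h] is comparable to
   [h `^ d], since [(1 + 1/r) `^ d] stays away from 1 when [d != 0]. *)
Let kappa := `|(3 / 2 : R) `^ d - 1|.

Lemma kappa_gt0 : 0 < kappa.
Proof.
rewrite normr_gt0 subr_eq0 powR_eq1 !negb_or d0 andbT.
by apply/andP; split; [apply/eqP; lra|rewrite -leNgt; lra].
Qed.

Lemma powR_increment_ge (q : R) : 3 / 2 <= q -> kappa <= `|q `^ d - 1|.
Proof.
move=> q32; rewrite /kappa.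
have q0 : 0 <= q by lra.
have mono e : 0 <= e -> 1 <= (3 / 2 : R) `^ e <= q `^ e.
  move=> e0; apply/andP; split.
    by rewrite -[X in X <= _](powRr0 (3 / 2)) ler_powR//; lra.
  by apply: ge0_ler_powR => //; rewrite nnegrE; lra.
have [d0'|d0'] := leP 0 d.
  have /andP[h1 h2] := mono _ d0'.
  by rewrite !ger0_norm ?subr_ge0 ?lerB// (le_trans h1).
have /andP[h1 h2] : 1 <= (3 / 2 : R) `^ (- d) <= q `^ (- d).
  by apply: mono; rewrite oppr_ge0 ltW.
have e1 : (3 / 2 : R) `^ d = ((3 / 2 : R) `^ (- d))^-1 by rewrite powRN invrK.
have e2 : q `^ d = (q `^ (- d))^-1 by rewrite powRN invrK.
have i1 : ((3 / 2 : R) `^ (- d))^-1 <= 1 by rewrite invf_le1// (lt_le_trans ltr01).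
have i2 : (q `^ (- d))^-1 <= ((3 / 2 : R) `^ (- d))^-1.
  by rewrite lef_pV2// posrE ?(lt_le_trans ltr01 h1)// (lt_le_trans ltr01 (le_trans h1 h2)).
rewrite e1 e2 !ler0_norm ?subr_le0//; first by rewrite lerN2 lerB.
exact: (le_trans i2 i1).
Qed.

Lemma powR_ratio_bounds (r : R) : 1 <= r <= 3 -> 2^-1 <= r `^ d \/ 2 < r.
Proof.
move=> /andP[r1 r3]; have [r2|] := leP r 2; [left|by right].
have [d0'|d0'] := leP 0 d.
  apply: (@le_trans _ _ 1); first by rewrite invf_le1// ler1n.
  by rewrite -[X in X <= _](powRr0 r) ler_powR//.
have -> : r `^ d = (r `^ (- d))^-1 by rewrite powRN invrK.
rewrite lef_pV2 ?posrE ?powR_gt0//; last by rewrite (lt_le_trans ltr01).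
apply: (le_trans _ r2); rewrite -[leRHS]powRr1; last by lra.
by apply: ler_powR => //; move: d1; lra.
Qed.

Lemma powR_ratio_le (r : R) : 1 <= r -> r `^ d <= r.
Proof.
move=> r1; rewrite -[leRHS]powRr1; last by lra.
by apply: ler_powR => //; move: d2; lra.
Qed.

(** Write [u = h * r] with [1 <= r <= 2] and [u + h = h * r * q] with [q >= 3 / 2]. The power part
    moves by at least [kappa] times [r]^ d >= 1/2[times an exponential]>=
    1/2[, the latter because]lambda * (u + h) <= 1/2[. The change of the exponential, at most]lambda
    * h[, is multiplied by]r [^ d <= 2]. *)
Lemma tempered_pow_increment_ge (h u : R) : 0 < h -> 6 * lambda * h <= 1 ->
  h <= u <= 2 * h ->
  h `^ d * (kappa / 4 - 2 * lambda * h) <= `|tp (u + h) - tp u|.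
Proof.
move=> h0 lh /andP[hu uh].
have u0 : 0 < u by exact: lt_le_trans hu.
pose r := u / h.
have ur : u = h * r by rewrite /r; field; rewrite gt_eqF.
have r1 : 1 <= r by rewrite /r ler_pdivlMr ?mul1r.
have r2 : r <= 2 by rewrite /r ler_pdivrMr.
have r0 : 0 < r by lra.
pose q := (r + 1) / r.
have q32 : 3 / 2 <= q by rewrite /q ler_pdivlMr//; lra.
have uhq : u + h = h * r * q by rewrite /q ur; field; rewrite gt_eqF.
pose x := h `^ d; pose y := r `^ d; pose z := q `^ d.
have x0 : 0 <= x by exact: powR_ge0.
have y0 : 0 <= y by exact: powR_ge0.
have xy : u `^ d = x * y by rewrite ur powRM// ltW.
have xyz : (u + h) `^ d = x * y * z.
  have hr : 0 <= h * r by rewrite mulr_ge0 ?ltW.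
  have q0 : 0 <= q by lra.
  by rewrite uhq (powRM d hr q0) (powRM d (ltW h0) (ltW r0)).
have zk : kappa <= `|z - 1| by exact: powR_increment_ge.
have yge : 2^-1 <= y.
  by case: (@powR_ratio_bounds r) => //; [apply/andP; split; lra|lra].
have yle : y <= 2 by rewrite (le_trans (powR_ratio_le r1)).
rewrite !tempered_pow_gt0 ?addr_gt0//.
rewrite xy xyz.
pose e1 := expR (- (lambda * u)); pose e2 := expR (- (lambda * (u + h))).
rewrite -/e1 -/e2.
have e1le : e1 <= 1.
  by rewrite -expR0 ler_expR oppr_le0 mulr_ge0 ?ltW.
have e10 : 0 <= e1 by exact: expR_ge0.
have e2e1 : e2 = e1 * expR (- (lambda * h)).
  by rewrite /e1 /e2 -expRD; congr expR; ring.
have lh0 : 0 <= lambda * h by rewrite mulr_ge0 ?ltW.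
have eh := expR_ge1Dx (- (lambda * h)).
have e12 : e1 - e2 <= lambda * h.
  rewrite e2e1; nra.
have e2ge : 2^-1 <= e2.
  rewrite /e2; have := expR_ge1Dx (- (lambda * (u + h))).
  have : lambda * (u + h) <= 3 * (lambda * h).
    by rewrite mulrCA ler_pM2l//; lra.
  lra.
have e12' : 0 <= e1 - e2.
  rewrite subr_ge0 /e1 /e2 ler_expR lerN2 ler_pM2l//; lra.
have -> : e2 * (x * y * z) - e1 * (x * y) = x * (e2 * y * (z - 1) - (e1 - e2) * y).
  ring.
rewrite normrM ger0_norm// ler_wpM2l//.
have t1 : 4^-1 * kappa <= `|e2 * y * (z - 1)|.
  rewrite normrM ger0_norm ?mulr_ge0 ?expR_ge0//.
  apply: ler_pM => //; first exact: ltW kappa_gt0.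
  by nra.
have t2 : `|(e1 - e2) * y| <= 2 * (lambda * h).
  by rewrite ger0_norm ?mulr_ge0//; nra.
have := lerB_dist (e2 * y * (z - 1)) ((e1 - e2) * y).
lra.
Qed.

End KernelBounds.

(** All that the probabilistic argument uses of a kernel, so that both kinds are treated at once.
    The lower bound on the strip makes [B] fluctuate, the upper bound over the current step controls
    the noise, and the last clause says that the future does not enter. *)
Definition kernel_increment_bounds {R : realType} (d : R) (k : R -> R -> R) :=
  exists c C h0 : R, [/\ 0 < c, 0 < C, 0 < h0 &
    forall t h x : R, 0 <= t -> 0 < h -> h < h0 ->
    (t - 2 * h <= x <= t - h -> c * h `^ d <= `|k (t + h) x - k t x|) /\
    (t < x < t + h -> `|k (t + h) x - k t x| <= C * (t + h - x) `^ d) /\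
    (t + h <= x -> k (t + h) x = k t x)].

Section IncrementBounds.
Context {R : realType}.
Notation mu := (@lebesgue_measure R).
Variables (d lambda : R).
Hypotheses (l0 : 0 < lambda) (d1 : - 2^-1 < d :> R) (d2 : d < 2^-1 :> R).
Hypotheses (d0 : d != 0).
Local Notation tp := (tempered_pow d lambda).

(** [E] stands for the compensating integral: it is 0 for the first kind and equal to its bound for
    the second. Being an integral over a time step, it is smaller than the main increment by a
    factor of order [h]. *)
Lemma perturbed_kernel_bounds (k : R -> R -> R) :
  (forall t h x : R, 0 <= t -> 0 < h -> exists E : R,
    [/\ k (t + h) x - k t x = tp (t + h - x) - tp (t - x) + E,
        0 <= E &
        E <= lambda * (oriented_int 0 (t + h) (fun s => tp (s - x))
                       - oriented_int 0 t (fun s => tp (s - x)))]) ->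
  kernel_increment_bounds d k.
Proof.
move=> hk; have d1' : -1 < d by move: d1; lra.
have d3 : d < 1 by move: d2; lra.
pose kappa := `|(3 / 2 : R) `^ d - 1|.
have kappa0 : 0 < kappa by exact: kappa_gt0.
have l0' := l0.
(* The exponential loses [2 * lambda * h] and [E] loses [3 * lambda * h]; with
   [40 * lambda * h <= kappa] this leaves [kappa / 8] of [kappa / 4]. The bound [h < 1] lets the
   power [d + 1] be absorbed into the power [d] over the current step. *)
exists (kappa / 8), (1 + lambda / (d + 1)),
  (Num.min 1 (Num.min (6 * lambda)^-1 (kappa / (40 * lambda)))).
have dp0 : 0 < d + 1 by lra.
split; first by rewrite divr_gt0.
  by rewrite addr_gt0// divr_gt0.
  by rewrite !lt_min ltr01 invr_gt0 mulr_gt0//= divr_gt0// mulr_gt0.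
move=> t h x t0 h0; rewrite !lt_min => /andP[h1 /andP[h2 h3]].
have {}h2 : 6 * lambda * h <= 1.
  by rewrite -ler_pdivlMl ?mulr_gt0// mulr1 ltW.
have {}h3 : 40 * (lambda * h) <= kappa.
  by move: h3; rewrite ltr_pdivlMr ?mulr_gt0//; lra.
have [E [hE0 E0 EO]] := hk t h x t0 h0.
split; [move=> /andP[x1 x2]|split=> [/andP[x1 x2]|x1]].
  rewrite hE0.
  have ux : h <= t - x <= 2 * h by apply/andP; split; lra.
  have := tempered_pow_increment_ge l0 d1 d2 d0 h0 h2 ux.
  rewrite -/kappa; have -> : t - x + h = t + h - x by ring.
  set D := tp _ - _ => hD.
  have xth : x < t + h by lra.
  have hE : E <= h `^ d * (3 * (lambda * h)).
    apply: (le_trans EO); rewrite oriented_int_tempered_pow//.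
    have -> : h `^ d * (3 * (lambda * h)) = lambda * (3 * h `^ d * h) by ring.
    rewrite ler_wpM2l ?(ltW l0)//.
    have I1 : mu.-integrable `]t, t + h] (EFin \o (fun s : R => tp (s - x))).
      apply: (@integrable_tempered_pow _ _ _ l0 d1 _ x (t + h + 1)) => // s/=.
      by rewrite in_itv/= => /andP[_ sh]; lra.
    apply: (@le_trans _ _ (\int[mu]_(s in `]t, (t + h)%R]) (3 * h `^ d))).
      apply: le_Rintegral => //.
        apply: (@integrableS _ _ _ mu `[t, t + h]%classic) => //.
          by apply: subset_itvr; rewrite bnd_simp.
        apply: continuous_compact_integrable; first exact: segment_compact.
        by apply: continuous_subspaceT => ?; exact: cst_continuous.
      move=> s /=; rewrite in_itv/= => /andP[s1 s2].
      have sx0 : 0 < s - x by lra.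
      apply: (le_trans (tempered_pow_le _ l0 sx0)).
      pose r := (s - x) / h.
      have sr : s - x = h * r by rewrite /r; field; rewrite gt_eqF.
      have r1 : 1 <= r by rewrite /r ler_pdivlMr// mul1r; lra.
      have r3 : r <= 3 by rewrite /r ler_pdivrMr//; lra.
      rewrite sr powRM; [|lra..].
      rewrite mulrC ler_wpM2r ?powR_ge0//.
      exact: le_trans (powR_ratio_le d2 r1) r3.
    have ml : mu `]t, (t + h)%R]%classic = h%:E.
      by rewrite lebesgue_measure_itv/= lte_fin ltrDl h0 -EFinB addrAC subrr add0r.
    by rewrite Rintegral_cst// -[X in fine X]/(mu _) ml.
  have hd0 : 0 <= h `^ d by exact: powR_ge0.
  have := lerB_dist D (- E); rewrite opprK normrN (ger0_norm E0) => hDE.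
  nra.
- rewrite hE0.
have tx0 : 0 < t + h - x by lra.
rewrite (tempered_pow_le0 _ _ (_ : t - x <= 0)) ?subr0; last by lra.
have hO := oriented_int_tempered_pow_le l0 d1 t0 h0 x2.
have p0 : 0 <= (t + h - x) `^ d by exact: powR_ge0.
have hp : (t + h - x) `^ (d + 1) <= (t + h - x) `^ d.
  rewrite powRD ?powRr1 ?(ltW tx0)//; last by rewrite (gt_eqF tx0) implybT.
  rewrite ler_piMr//; lra.
have := tempered_pow_le d l0 tx0; have := tempered_pow_ge0 d lambda (t + h - x).
set T := tp _ => T0 T1.
rewrite ger0_norm ?addr_ge0// mulrDl mul1r lerD//.
apply: (le_trans EO); rewrite -mulrA ler_wpM2l ?(ltW l0)//.
apply: (le_trans hO); rewrite mulrC ler_wpM2l// invr_ge0 ltW//.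
- apply/eqP; rewrite -subr_eq0 hE0.
rewrite (@tempered_pow_le0 _ d lambda (t + h - x)); last by lra.
rewrite (@tempered_pow_le0 _ d lambda (t - x)); last by lra.
move: EO; rewrite oriented_int_tempered_pow//.
have -> : \int[mu]_(s in `]t, t + h]) tp (s - x) = 0.
  rewrite /Rintegral integral0_eq// => s /=; rewrite in_itv/= => /andP[_ sh].
  by rewrite tempered_pow_le0//; lra.
by rewrite mulr0 => E1; apply/eqP; lra.
Qed.

Lemma kernel1_increment_bounds : kernel_increment_bounds d (kernel1 d lambda).
Proof.
apply: perturbed_kernel_bounds => t h x t0 h0; exists 0; split => //.
  by rewrite /kernel1; ring.
by rewrite mulr_ge0 ?(ltW l0)// oriented_int_tempered_pow_ge0.
Qed.

Lemma kernel2_increment_bounds : kernel_increment_bounds d (kernel2 d lambda).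
Proof.
apply: perturbed_kernel_bounds => t h x t0 h0.
exists (lambda * (oriented_int 0 (t + h) (fun s => tp (s - x))
                       - oriented_int 0 t (fun s => tp (s - x)))).
split => //; first by rewrite /kernel2; ring.
by rewrite mulr_ge0 ?(ltW l0)// oriented_int_tempered_pow_ge0.
Qed.

(** A real-valued integral is [fine] of an extended one, and [fine +oo] is 0: positivity needs
    finiteness as well. The lower bound comes from [[1, 2]]; finiteness is proved separately on the
    two sides of 2. *)
Lemma Gamma_gt0 : 0 < Gamma (1 + d).
Proof.
have d1' : -1 < d by move: d1; lra.
have d3 : d < 1 by move: d2; lra.
have dp0 : 0 < d + 1 by lra.
pose g (x : R) := x `^ d * expR (- x).
have -> : Gamma (1 + d) = \int[mu]_(x in `]0, +oo[) g x.
  by rewrite /Gamma; apply: eq_Rintegral => x _; rewrite /g addrAC subrr add0r.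
have g0 x : 0 <= g x by rewrite mulr_ge0 ?powR_ge0 ?expR_ge0.
have mg : measurable_fun setT g.
  apply: measurable_funM; first exact: measurable_powR.
  by apply: measurableT_comp => //; exact: measurableT_comp.
have mge D : measurable_fun D (EFin \o g).
  by apply/measurable_EFinP; exact: measurable_funTS.
rewrite /Rintegral; apply: fine_gt0; apply/andP; split.
  apply: (@lt_le_trans _ _ (\int[mu]_(x in `[1%R, 2%R]) (expR (- 2) / 2)%:E)%E).
    rewrite integral_cst//= lebesgue_measure_itv/= ?lte_fin ltr1n/=.
    by rewrite mule_gt0// -?EFinD lte_fin ?divr_gt0 ?expR_gt0//; lra.
  apply: (@le_trans _ _ (\int[mu]_(x in `[1%R, 2%R]) (g x)%:E)%E).
    apply: ge0_le_integral => //.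
    - exact: mge.
    - move=> x /=; rewrite in_itv/= => /andP[x1 x2]; rewrite lee_fin /g.
      have x13 : 1 <= x <= 3 by apply/andP; split; lra.
      have [hx|] := powR_ratio_bounds d1 x13; last by lra.
      rewrite mulrC; apply: ler_pM => //.
      by rewrite ler_expR lerN2.
  apply: ge0_subset_integral => //=.
  - exact: mge.
  - by move=> x _; rewrite lee_fin.
  - by move=> x /=; rewrite !in_itv/= => /andP[x1 _]; rewrite andbT; lra.
have -> : `]0%R, +oo[%classic = (`]0, 2[%classic `|` `[2, +oo[%classic : set R).
  apply/seteqP; split => x /=; rewrite !in_itv/= !andbT.
    by move=> x0; have [|] := ltP x 2; [left; rewrite x0|right].
  by move=> [/andP[]//|]; apply: lt_le_trans.
rewrite ge0_integral_setU//=; last 3 first.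
- exact: mge.
- by move=> x _; rewrite lee_fin.
- by apply/disj_setPS => x [/=]; rewrite !in_itv/= andbT => /andP[_ h1] h2; lra.
apply: lte_add_pinfty.
  apply: (@le_lt_trans _ _ (\int[mu]_(x in `]0%R, 2%R[) ((x - 0) `^ d)%:E)%E).
    apply: ge0_le_integral => //.
    - by move=> x _; rewrite lee_fin.
    - exact: mge.
    - apply/measurable_EFinP; apply: measurable_funTS.
      apply: (measurableT_comp (measurable_powR _)).
      by apply: measurable_funB => //; exact: measurable_id.
    - move=> x /=; rewrite in_itv/= => /andP[x0 _]; rewrite lee_fin /g subr0.
      rewrite ler_piMr ?powR_ge0// -expR0 ler_expR; lra.
  by apply: le_lt_trans (ltry _); apply: integral_powR_left.
apply: (@le_lt_trans _ _ (\int[mu]_(x in `[2%R, +oo[) (4 * exponential_pdf (2^-1 : R) x)%:E)%E).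
  apply: ge0_le_integral => //.
  - by move=> x _; rewrite lee_fin.
  - exact: mge.
  - apply/measurable_EFinP; apply: measurable_funTS; apply: measurable_funM => //.
    exact: measurable_exponential_pdf.
  - move=> x /=; rewrite in_itv/= andbT => x2; rewrite lee_fin.
    have x0 : 0 <= x by lra.
    rewrite exponential_pdfE// /g/=.
    have h1 : x `^ d <= x.
      by apply: powR_ratio_le => //; lra.
    have h2 : x <= 2 * expR (2^-1 * x).
      have := expR_ge1Dx (2^-1 * x); lra.
    have -> : - x = - 2^-1 * x + - 2^-1 * x by lra.
    rewrite expRD mulrA mulrA.
    rewrite ler_wpM2r ?expR_ge0//.
    apply: (@le_trans _ _ (2 * expR (2^-1 * x) * expR (- 2^-1 * x))).
      by rewrite ler_wpM2r ?expR_ge0// (le_trans h1).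
    by rewrite -mulrA -expRD mulNr subrr expR0; lra.
apply: (@le_lt_trans _ _ (\int[mu]_x (4 * exponential_pdf (2^-1 : R) x)%:E)%E).
  apply: ge0_subset_integral => //=.
  - apply/measurable_EFinP; apply: measurable_funM => //.
    exact: measurable_exponential_pdf.
  - by move=> x _; rewrite lee_fin mulr_ge0// exponential_pdf_ge0.
under eq_integral do rewrite EFinM.
rewrite ge0_integralZl//=.
- by rewrite integral_exponential_pdf// mule1 ltry.
- by apply/measurable_EFinP; exact: measurable_exponential_pdf.
- by move=> x _; rewrite lee_fin exponential_pdf_ge0.
Qed.

End IncrementBounds.

(** * Independence of the past and the future *)

Section IndependentExpectation.
Context {disp : measure_display} {T : measurableType disp} {R : realType}.
Variable P : probability T R.
Local Open Scope ereal_scope.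

(** Independence identifies the joint law with the product of the two laws, by uniqueness of the
    product measure; Fubini then factors the integral. *)
Lemma integral_indep (X Y : {mfun T >-> R}) :
  (forall A B, measurable A -> measurable B ->
    P (X @^-1` A `&` Y @^-1` B) = P (X @^-1` A) * P (Y @^-1` B)) ->
  P.-integrable setT (EFin \o X) -> P.-integrable setT (EFin \o Y) ->
  P.-integrable setT (fun w => (X w * Y w)%:E) /\
  \int[P]_w (X w * Y w)%:E = (\int[P]_w (X w)%:E) * (\int[P]_w (Y w)%:E).
Proof.
move=> XY iX iY.
pose Z w := (X w, Y w).
have mZ : measurable_fun setT Z by exact: measurable_fun_pair.
pose Zm : {mfun T >-> (R * R)%type} :=
  HB.pack Z (isMeasurableFun.Build _ _ _ _ Z mZ).
pose mX := distribution P X; pose mY := distribution P Y.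
have dE A : measurable A -> (mX \x mY)%E A = distribution P Zm A.
  apply: product_measure_unique => B C mB mC.
  exact: XY.
pose f (z : R * R) := (z.1 * z.2)%:E.
have mf : measurable_fun setT f.
  by apply/measurable_EFinP; apply: measurable_funM.
have abs_pf (U : {mfun T >-> R}) : P.-integrable setT (EFin \o U) ->
    \int[distribution P U]_x (`|x|%:E) < +oo.
  move=> /integrableP[_]; rewrite ge0_integral_pushforward//.
  by apply/measurable_EFinP; exact: normr_measurable.
have pf (U : {mfun T >-> R}) : P.-integrable setT (EFin \o U) ->
    \int[distribution P U]_x x%:E = \int[P]_w (U w)%:E.
  by move=> iU; rewrite integral_pushforward//=.
have if0 : (mX \x mY)%E.-integrable setT f.
  apply/integrable12ltyP => //.
  under eq_integral => x _.
    under eq_integral do rewrite /f/= normrM EFinM.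
    rewrite ge0_integralZl//; last 1 first.
      by apply/measurable_EFinP; exact: normr_measurable.
    over.
  rewrite ge0_integralZr//; last 2 first.
  - by apply/measurable_EFinP; exact: normr_measurable.
  - exact: integral_ge0.
  rewrite lte_mul_pinfty ?abs_pf//; first exact: integral_ge0.
  by rewrite ge0_fin_numE ?abs_pf//; exact: integral_ge0.
have ifZ : P.-integrable setT (f \o Z).
  apply/integrableP; split; first exact: measurableT_comp.
  move/integrableP : if0 => [_]; apply: le_lt_trans.
  rewrite (eq_measure_integral (distribution P Zm))//; last first.
    by move=> A mA _; exact: dE.
  rewrite ge0_integral_pushforward//.
  exact: measurableT_comp.
split; first exact: ifZ.
transitivity (\int[P]_w (f \o Z) w); first by [].
rewrite -(@integral_pushforward _ _ _ _ _ Z mZ P setT f mf ifZ measurableT).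
transitivity (\int[mX \x mY]_z f z).
  by apply: eq_measure_integral => A mA _; rewrite [RHS]dE.
rewrite -integral12_prod_meas1//.
have iYd : mY.-integrable setT EFin.
  apply/integrableP; split; first by apply/measurable_EFinP.
  exact: abs_pf.
have iXd : mX.-integrable setT EFin.
  apply/integrableP; split; first by apply/measurable_EFinP.
  exact: abs_pf.
rewrite -(pf X iX) -(pf Y iY).
rewrite /fubini_F.
under eq_integral => x _.
  rewrite /f/=; under eq_integral do rewrite EFinM.
  rewrite integralZl//; over.
have /fineK <- : \int[distribution P Y]_x x%:E \is a fin_num.
  exact: integrable_fin_num.
by rewrite integralZr.
Qed.

End IndependentExpectation.

(** * Independence under generation and augmentation *)

Section IndependentSystems.
Context {disp : measure_display} {T : measurableType disp} {R : realType}.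
Variable P : probability T R.
Implicit Types G H : set (set T).

Lemma g_sigma_algebra_measurable G :
  G `<=` measurable -> <<s G >> `<=` measurable.
Proof. exact: (smallest_sub (@sigma_algebra_measurable _ T)). Qed.

Lemma independent_g_sigma_algebra G H : G setT -> setI_closed G ->
  G `<=` measurable -> H `<=` measurable ->
  independent_systems P G H -> independent_systems P <<s G >> H.
Proof.
move=> GT GI Gm Hm GH A B sA HB.
have mB := Hm _ HB.
have mA := g_sigma_algebra_measurable Gm sA.
have PB : P B \is a fin_num by rewrite fin_num_measure.
have PB0 : 0 <= fine (P B) by rewrite fine_ge0.
pose m2 := mscale (NngNum PB0) P.
have mE : forall E, <<s G >> E -> mrestr P mB E = m2 E.
  apply: (g_sigma_algebra_measure_unique G Gm (fun _ => setT)) => //.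
  - by rewrite bigcup_const.
  - move=> E GE; rewrite /mrestr/= /mscale/= fineK// muleC.
    exact: GH.
  - move=> _; rewrite /= /mrestr setTI.
    by rewrite ltey_eq PB.
have := mE _ sA; rewrite /mrestr /m2 /mscale/= fineK// => ->.
by rewrite muleC.
Qed.

(** Augmentation within the measurable events, [P] not being assumed complete. It matches
    [filtration_null], which adds measurable null events. *)
Definition null_completion G : set (set T) :=
  [set A | measurable A /\ exists B N,
    [/\ G B, measurable N, P N = 0%E & forall w, ~ N w -> (A w <-> B w)]].

Lemma sub_null_completion G : G `<=` measurable -> G `<=` null_completion G.
Proof.
move=> Gm A GA; split; first exact: Gm.
by exists A, set0; split => //; rewrite measure0.
Qed.

Lemma null_completion_mono G H : G `<=` H ->
  null_completion G `<=` null_completion H.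
Proof.
move=> GH A [mA [B [N [GB mN PN AB]]]]; split => //; exists B, N; split => //.
exact: GH.
Qed.

Lemma null_completion_measurable G : null_completion G `<=` measurable.
Proof. by move=> A []. Qed.

Lemma null_completion_idem G :
  null_completion (null_completion G) `<=` null_completion G.
Proof.
move=> A [mA [B [N [[mB [C [M [GC mM PM BC]]]] mN PN AB]]]]; split => //.
exists C, (N `|` M); split => //; first exact: measurableU.
  exact: null_set_setU.
by move=> w /not_orP[Nw Mw]; rewrite AB// BC.
Qed.

Lemma null_completion_null G A : G set0 -> measurable A -> P A = 0%E ->
  null_completion G A.
Proof. by move=> G0 mA PA; split => //; exists set0, A; split. Qed.

Lemma null_completion_sigma_algebra G : sigma_algebra setT G ->
  sigma_algebra setT (null_completion G).
Proof.
move=> [G0 GC GU]; split.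
- by apply: null_completion_null => //; rewrite measure0.
- move=> A [mA [B [N [GB mN PN AB]]]]; split; first exact: measurableD.
  exists (setT `\` B), N; split => //; first exact: GC.
  by move=> w Nw; rewrite /= /setD/=; split => -[_ h]; split => //;
    [rewrite -AB|rewrite AB].
- move=> F hF.
  have mF n : measurable (F n) by case: (hF n).
  split; first exact: bigcup_measurable.
  have /choice[B hB] : forall n, exists B, exists N,
    [/\ G B, measurable N, P N = 0%E & forall w, ~ N w -> (F n w <-> B w)].
    by move=> n; case: (hF n).
  have /choice[N hN] := hB.
  exists (\bigcup_n B n), (\bigcup_n N n); split.
  + by apply: GU => n; case: (hN n).
  + by apply: bigcup_measurable => n _; case: (hN n).
  + apply/eqP; rewrite eq_le measure_ge0 andbT.
    have -> : 0%E = (\sum_(n <oo) P (N n))%E.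
      by apply/esym/eseries0 => n _ _; case: (hN n).
    apply: generalized_Boole_inequality.
    * by move=> n; case: (hN n).
    * by apply: bigcup_measurable => n _; case: (hN n).
  + move=> w Nw; split => -[n _ h]; exists n => //;
      have [_ _ _ FB] := hN n.
    * by rewrite -FB// => Nnw; apply: Nw; exists n.
    * by rewrite FB// => Nnw; apply: Nw; exists n.
Qed.

Lemma eq_measure_outside_null A B N : measurable A -> measurable B ->
  measurable N -> P N = 0%E -> (forall w, ~ N w -> (A w <-> B w)) -> P A = P B.
Proof.
move=> mA mB mN PN AB.
have h C : measurable C -> P C = P (C `\` N).
  move=> mC; rewrite [LHS](measureDI P mC mN) -[RHS]adde0; congr (_ + _)%E.
  apply/eqP; rewrite eq_le measure_ge0 andbT -PN le_measure ?inE//.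
  exact: measurableI.
rewrite h// [RHS]h//; congr (P _).
by apply/seteqP; split => w [h1 h2]; split => //; [rewrite -AB|rewrite AB].
Qed.

Lemma independent_null_completion G H : G `<=` measurable -> H `<=` measurable ->
  independent_systems P G H -> independent_systems P (null_completion G) H.
Proof.
move=> Gm Hm GH A D [mA [B [N [GB mN PN AB]]]] HD.
have mD := Hm _ HD; have mB := Gm _ GB.
rewrite (eq_measure_outside_null mA mB mN PN AB) -GH//.
apply: (@eq_measure_outside_null _ _ N) => //; [exact: measurableI..|].
by move=> w Nw; split => -[h1 h2]; split => //; [rewrite -AB|rewrite AB].
Qed.

End IndependentSystems.

Section Cylinders.
Context {disp : measure_display} {T : measurableType disp} {R : realType}.
Variable P : probability T R.

Definition cylinders (X : R -> T -> R) (I : set R) : set (set T) :=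
  [set A | exists (n : nat) (r : nat -> R) (B : nat -> set R),
    [/\ forall i, (i < n)%N -> I (r i), forall i, measurable (B i) &
        A = \bigcap_(i in `I_n) (X (r i) @^-1` B i)]].

Lemma cylindersT X I : cylinders X I setT.
Proof.
exists 0%N, (fun _ => 0), (fun _ => setT); split => //.
by apply/seteqP; split => // w _ i.
Qed.

Lemma cylindersI X I : setI_closed (cylinders X I).
Proof.
move=> _ _ [n [r [B [rI mB ->]]]] [m [u [C [uI mC ->]]]].
exists (n + m)%N, (fun i => if (i < n)%N then r i else u (i - n)%N),
  (fun i => if (i < n)%N then B i else C (i - n)%N); split.
- move=> i inm; case: ltnP => ni; first exact: rI.
  by apply: uI; rewrite ltn_subLR.
- by move=> i; case: ifP.
- apply/seteqP; split => w /=.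
    move=> [h1 h2] i /= inm; case: ltnP => ni; first exact: h1.
    by apply: h2; rewrite /= ltn_subLR.
  move=> h; split=> i /= ilt.
    by have := h i; rewrite /= ilt; apply; rewrite ltn_addr.
  have nn : (n + i < n)%N = false by lia.
  by have := h (n + i)%N; rewrite /= ltn_add2l nn addKn; apply.
Qed.

Lemma cylinders_measurable (X : R -> {mfun T >-> R}) I :
  cylinders X I `<=` measurable.
Proof.
move=> _ [n [r [B [rI mB ->]]]]; apply: fin_bigcap_measurable => //.
by move=> i _; rewrite -[X in measurable X]setTI; exact: measurable_funP.
Qed.

Lemma cylinders_sigma_process X I : cylinders X I `<=` sigma_process X I.
Proof.
move=> _ [n [r [B [rI mB ->]]]].
pose S := g_sigma_algebraType
  (\bigcup_(t in I) preimage_set_system setT (X t) measurable).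
have h : measurable (\bigcap_(i in `I_n) (X (r i) @^-1` B i) : set S).
  apply: fin_bigcap_measurable => // i ilt; apply: sub_sigma_algebra.
  by exists (r i); [exact: rI|exists (B i) => //; rewrite setTI].
exact: h.
Qed.

Section LevyCylinders.
Variable X : R -> {RV P >-> R}.
Hypothesis lX : levy_process P X.

(** The Levy property concerns consecutive increments, whereas cylinders constrain values. Sorting
    the times and putting 0 in front turns each value into a sum of increments, up to the null event
    where the process does not start at 0; hence the detour through [null_completion]. *)
Lemma levy_cylinder_indep (s w v : R) (D : set R) A :
  0 <= s -> s <= w -> w <= v -> measurable D ->
  cylinders X [set r | 0 <= r <= s] A ->
  P (A `&` [set x | D (X v x - X w x)%R]) =
  (P A * P [set x | D (X v x - X w x)%R])%E.
Proof.
move=> s0 sw wv mD [n [r [B [rI mB AE]]]].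
pose sr := sort <=%R (mkseq r n).
pose q := 0 :: sr.
have sizeq : size q = n.+1 by rewrite /= size_sort size_mkseq.
have sr0s x : x \in sr -> 0 <= x <= s.
  rewrite mem_sort => /mapP[i]; rewrite mem_iota add0n => /andP[_ ilt] ->.
  exact: rI.
have sq : sorted <=%R q.
  rewrite /= path_min_sorted; first exact: sort_le_sorted.
  by apply/allP => x /sr0s/andP[].
have qs x : x \in q -> 0 <= x <= s.
  by rewrite inE => /predU1P[->|/sr0s//]; rewrite lexx s0.
(* The sequence is 0, the sorted past times, [w], and then the default [v] forever: the past uses
   the first [n] increments, and the increment of index [n.+1] goes from [w] to [v]. *)
pose t i := nth v (rcons q w) i.
have tq i : (i < n.+1)%N -> t i = nth v q i.
  by move=> ilt; rewrite /t nth_rcons sizeq ilt.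
have tw : t n.+1 = w by rewrite /t nth_rcons sizeq ltnn eqxx.
have tv i : (n.+1 < i)%N -> t i = v.
  by move=> ilt; rewrite /t nth_rcons sizeq ltnNge (ltnW ilt)/= gtn_eqF.
have t0 : t 0%N = 0 by [].
have tmono i : t i <= t i.+1.
  have [i1|] := ltnP i.+1 n.+1.
    rewrite !tq//; last exact: ltn_trans i1.
    by move/(sortedP v): sq; apply; rewrite sizeq.
  rewrite leq_eqVlt => /predU1P[[ni]|].
    rewrite -ni tw tq// (le_trans _ sw)//.
    by have /qs/andP[] : nth v q n \in q by rewrite mem_nth ?sizeq.
  rewrite ltnS leq_eqVlt => /predU1P[<-|ni].
    by rewrite tw tv.
  by rewrite !tv// ltnW.
pose incr i x := X (t i.+1) x - X (t i) x.
pose G : set (set T) := [set E | exists C : nat -> set R,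
  (forall i, measurable (C i)) /\
  E = \bigcap_(i in `I_n) [set x | C i (incr i x)]].
have mincr i : measurable_fun setT (incr i) by exact: measurable_funB.
have Gm : G `<=` measurable.
  move=> _ [C [mC ->]]; apply: fin_bigcap_measurable => // i _.
  by rewrite -[X in measurable X]setTI; exact: mincr.
have mE : measurable [set x | D (X v x - X w x)%R].
  have mb : measurable_fun setT (fun x => X v x - X w x).
    exact: measurable_funB.
  by rewrite -[X in measurable X]setTI; exact: mb.
have indG : independent_systems P G [set [set x | D (X v x - X w x)%R]].
  move=> E F [C [mC ->]] ->.
  (* Index [n] is the gap between the last past time and [w]; it is left free, so its factor is
     1. *)
  pose C' i := if (i < n)%N then C i else if i == n then setT else D.
  have mC' i : measurable (C' i) by rewrite /C'; case: ifP => //; case: ifP.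
  have t0' : 0 <= t 0%N by rewrite t0.
  have h1 := levy_indep lX n t0' tmono mC'.
  have h2 := levy_indep lX n.+2 t0' tmono mC'.
  have e1 : \bigcap_(i in `I_n) [set x | C i (incr i x)] =
    \bigcap_(i in `I_n) [set x | C' i (X (t i.+1) x - X (t i) x)].
    by apply: eq_bigcapr => i /= ilt; rewrite /C' ilt.
  have e2 : \bigcap_(i in `I_n) [set x | C i (incr i x)] `&`
    [set x | D (X v x - X w x)%R] =
    \bigcap_(i in `I_n.+2) [set x | C' i (X (t i.+1) x - X (t i) x)].
    rewrite e1; apply/seteqP; split => x /=.
      move=> [h hD] i /=; rewrite ltnS leq_eqVlt => /predU1P[->|].
        by rewrite /C' ltnNge leqnSn/= gtn_eqF// tw tv.
      rewrite ltnS leq_eqVlt => /predU1P[->|]; last exact: h.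
      by rewrite /C' ltnn eqxx.
    move=> h; split => [i /= ilt|]; first by apply: h; rewrite /= ltnS ltnW// ltnW.
    by have := h n.+1; rewrite /C' ltnNge leqnSn/= gtn_eqF// tw tv//; apply.
  rewrite e2 h2 e1 h1 !big_ord_recr/=; congr (_ * _)%E; last first.
    by rewrite /C' ltnNge leqnSn/= gtn_eqF// tw tv.
  rewrite [X in (_ * P X)%E](_ : _ = setT) ?probability_setT ?mule1//.
  by rewrite /C' ltnn eqxx.
have GT : G setT.
  exists (fun _ => setT); split => //.
  by apply/seteqP; split => // x _ i.
have GI : setI_closed G.
  move=> _ _ [C [mC ->]] [C2 [mC2 ->]].
  exists (fun i => C i `&` C2 i); split; first by move=> i; exact: measurableI.
  by rewrite -bigcapI.
have mH : [set [set x | D (X v x - X w x)%R]] `<=` measurable by move=> _ ->.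
have := independent_g_sigma_algebra GT GI Gm mH indG.
move/(independent_null_completion (g_sigma_algebra_measurable Gm) mH).
apply => //.
have mA : measurable A by apply: (@cylinders_measurable X [set r | 0 <= r <= s]); exists n, r, B.
split => //.
(* The rank of [r i] among the sorted times is the number of increments whose sum is
   [X (r i) - X 0]. *)
pose k i := index (r i) q.
pose Y i x := \sum_(j < k i) incr j x.
have [N [mN PN hN]] := levy_start lX.
have rq i : (i < n)%N -> r i \in q.
  move=> ilt; rewrite inE mem_sort; apply/orP; right.
  by apply/mapP; exists i => //; rewrite mem_iota.
exists (\bigcap_(i in `I_n) [set x | B i (Y i x)]), N; split => //.
  pose S := g_sigma_algebraType G.
  have mi j : (j < n)%N -> measurable_fun [set: S] (incr j : S -> R).
    move=> jn _ C mC; rewrite setTI; apply: sub_sigma_algebra.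
    exists (fun i => if i == j then C else setT); split; first by move=> i; case: ifP.
    apply/seteqP; split => x /=.
      by move=> h i /= _; case: eqP => [->|].
    by move=> h; have := h j jn; rewrite /= eqxx.
  suff : measurable (\bigcap_(i in `I_n) [set x | B i (Y i x)] : set S) by [].
  apply: fin_bigcap_measurable => // i /= ilt.
  have mY : measurable_fun [set: S] (Y i : S -> R).
    apply: measurable_sum => j; apply: mi.
    apply: (leq_trans (ltn_ord j)).
    by have := rq i ilt; rewrite -index_mem sizeq ltnS.
  by rewrite -[X in measurable X]setTI; exact: mY.
move=> x Nx; have X0 : X 0 x = 0 by apply: contra_notP Nx => ?; exact: hN.
have XY i : (i < n)%N -> Y i x = X (r i) x.
  move=> ilt; rewrite /Y /incr -(big_mkord xpredT (fun j => X (t j.+1) x - X (t j) x)).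
  rewrite telescope_sumr// t0 X0 subr0 tq ?nth_index ?rq//.
  by rewrite -sizeq index_mem rq.
rewrite AE; split => h i ilt /=; first by rewrite XY//; exact: h.
by rewrite -XY//; exact: h.
Qed.

End LevyCylinders.
End Cylinders.

(** * The past of the two-sided process *)

Section DrivingFiltration.
Context {disp : measure_display} {T : measurableType disp} {R : realType}.
Variable P : probability T R.

Lemma sigma_process_measurable (X : R -> {RV P >-> R}) I :
  sigma_process X I `<=` measurable.
Proof.
apply: g_sigma_algebra_measurable => _ [t _ [B mB <-]].
exact: measurable_funP.
Qed.

Lemma sigma_process_preimage (X : R -> T -> R) I t B :
  I t -> measurable B -> sigma_process X I (X t @^-1` B).
Proof.
move=> It mB; apply: sub_sigma_algebra; exists t => //; exists B => //.
by rewrite setTI.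
Qed.

Lemma sigma_processS (X : R -> T -> R) (I J : set R) : I `<=` J ->
  sigma_process X I `<=` sigma_process X J.
Proof.
move=> IJ; apply: sub_sigma_algebra2; apply: bigcup_subset; exact: IJ.
Qed.

(* The left limit is almost surely the limit along [t - t / (k + 1)], and the
   [limsup] of this sequence is measurable without exception. *)
Lemma left_limit_null_completion (X : R -> {RV P >-> R}) (t : R) (B : set R) :
  levy_process P X -> 0 < t -> measurable B ->
  measurable ((fun w => lim (X s w @[s --> t^'-])) @^-1` B) ->
  null_completion P (sigma_process X [set t | 0 <= t])
    ((fun w => lim (X s w @[s --> t^'-])) @^-1` B).
Proof.
move=> lX t0 mB mL; split=> //.
have [N [mN PN hN]] := levy_cadlag lX.
pose u (k : nat) : R := t - t / k.+1%:R.
pose S := g_sigma_algebraType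
  (\bigcup_(t in [set t : R | 0 <= t]) preimage_set_system setT (X t) measurable).
pose g (w : T) := fine (limn_esup (fun k => (X (u k) w)%:E)).
have ut k : u k < t by rewrite /u ltrBlDr ltrDl divr_gt0.
have u0 k : 0 <= u k.
  by rewrite /u subr_ge0; apply: ler_piMr; [exact: ltW|rewrite invf_le1 ?ler1n].
have ucvg : u @ \oo --> t.
  rewrite -[X in _ --> X]subr0; apply: cvgB; first exact: cvg_cst.
  rewrite -[X in _ --> X](mulr0 t); apply: cvgM; first exact: cvg_cst.
  exact: cvg_harmonic.
have mg : measurable_fun [set: S] (g : S -> R).
  have mh : measurable_fun [set: S]
      ((fun w => limn_esup (fun k => (X (u k) w)%:E)) : S -> \bar R).
    apply: (@measurable_fun_limn_esup _ S _ _ (fun k w => (X (u k) w)%:E)) => k.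
    apply/measurable_EFinP.
    by move=> _ C mC; rewrite setTI; apply: sigma_process_preimage => //; exact: u0.
  exact: (measurableT_comp (fine_measurable measurableT) mh).
exists (g @^-1` B), N; split => //.
  suff : measurable (g @^-1` B : set S) by [].
  by rewrite -[X in measurable X]setTI; exact: mg.
move=> w Nw; have [_ /(_ _ t0) cl] : cadlag (X^~ w).
  by apply: contra_notP Nw => ?; exact: hN.
have hl : X (u k) w @[k --> \oo] --> lim (X s w @[s --> t^'-]).
  by have /cvg_at_leftP := cl; apply; split.
suff gw : g w = lim (X s w @[s --> t^'-]) by rewrite /preimage/= gw.
rewrite /g is_cvg_limn_esupE; last first.
  by apply/cvg_ex; eexists; apply: cvg_EFin; [exact: nearW|exact: hl].
rewrite (cvg_lim _ (cvg_EFin _ hl))//.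
exact: nearW.
Qed.

Section Driving.
Variables L L1 L2 : R -> {RV P >-> R}.
Hypothesis copies : independent_copies P L1 L2.
Hypothesis LE : forall t w, L t w = two_sided L1 L2 t w.

Lemma driving_ge0 t : 0 <= t -> L t = L1 t :> (T -> R).
Proof. by move=> t0; apply/funext => w; rewrite LE /two_sided t0. Qed.

Lemma driving_lt0 t : t < 0 ->
  L t = (fun w => - lim (L2 s w @[s --> (- t)^'-])) :> (T -> R).
Proof. by move=> t0; apply/funext => w; rewrite LE /two_sided leNgt t0. Qed.

(** Up to null events the past of [L] at time [s] is generated by [L1] on [[0, s]] together with
    [L2] at all its times. Intersections of a cylinder of [L1] with an event of [L2] form a
    pi-system, on which independence combines that of the two copies with that of the increments of
    [L1]. *)
Lemma past_increment_indep (s w v : R) : 0 <= s -> s <= w -> w <= v ->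
  independent_systems P (null_completion P (sigma_process L [set u | u <= s]))
    [set E | exists2 D : set R, measurable D &
             E = [set x | D (L v x - L w x)]].
Proof.
move=> s0 sw wv.
have w0 : 0 <= w by exact: le_trans sw.
have v0 : 0 <= v by exact: le_trans wv.
have [lX1 lX2 _ ind] := copies.
pose I0 := [set t : R | 0 <= t].
pose H := [set E | exists2 D : set R, measurable D &
             E = [set x | D (L v x - L w x)]].
pose G : set (set T) := [set E | exists A B,
  [/\ cylinders L1 [set r | 0 <= r <= s] A, sigma_process L2 I0 B &
      E = A `&` B]].
have GT : G setT.
  exists setT, setT; split; [exact: cylindersT| |by rewrite setTI].
  have := @sigma_algebraCD _ setT
    (\bigcup_(t in I0) preimage_set_system setT (L2 t) measurable) set0.
  by rewrite setD0; apply; exact: sigma_algebra0.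
have sI (X : R -> {RV P >-> R}) A B : sigma_process X I0 A ->
    sigma_process X I0 B -> sigma_process X I0 (A `&` B).
  move=> hA hB.
  pose S := g_sigma_algebraType
    (\bigcup_(t in I0) preimage_set_system setT (X t) measurable).
  exact: (@measurableI _ S).
have GI : setI_closed G.
  move=> _ _ [A [B [cA sB ->]]] [A' [B' [cA' sB' ->]]].
  exists (A `&` A'), (B `&` B'); split; [exact: cylindersI|exact: sI|].
  by rewrite setIACA.
have Gm : G `<=` measurable.
  move=> _ [A [B [cA sB ->]]]; apply: measurableI.
    exact: cylinders_measurable cA.
  exact: sigma_process_measurable sB.
have sD D : measurable D -> sigma_process L1 I0 [set x | D (L v x - L w x)].
  move=> mD.
  pose S := g_sigma_algebraType
    (\bigcup_(t in I0) preimage_set_system setT (L1 t) measurable).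
  have mL t : 0 <= t -> measurable_fun [set: S] (L1 t : S -> R).
    by move=> t0 _ C mC; rewrite setTI; exact: sigma_process_preimage.
  have mi : measurable_fun [set: S] ((fun x => L v x - L w x) : S -> R).
    rewrite (driving_ge0 v0) (driving_ge0 w0).
    by apply: measurable_funB; exact: mL.
  have := mi measurableT _ mD; rewrite setTI; exact.
have Hm : H `<=` measurable.
  by move=> _ [D mD ->]; exact: sigma_process_measurable (sD _ mD).
have sC A : cylinders L1 [set r | 0 <= r <= s] A -> sigma_process L1 I0 A.
  move=> /cylinders_sigma_process; apply: sigma_processS.
  by move=> r /= /andP[].
have indG : independent_systems P G H.
  move=> _ _ [A [B [cA sB ->]]] [D mD ->].
  rewrite setIAC ind//; last by apply: sI; [exact: sC|exact: sD].
  rewrite (ind A B)//; last exact: sC.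
  have := levy_cylinder_indep lX1 s0 sw wv mD cA.
  rewrite (driving_ge0 v0) (driving_ge0 w0) => ->.
  by rewrite muleAC.
have sGm := g_sigma_algebra_measurable Gm.
have := independent_g_sigma_algebra GT GI Gm Hm indG.
move/(independent_null_completion sGm Hm) => indN A0 E0 hA hE.
apply: indN => //.
(* Values of [L] at negative times are left limits of [L2], hence only in the completion of what [G]
   generates; completing the past completes twice. *)
apply: null_completion_idem.
apply: null_completion_mono hA.
have G1 A : cylinders L1 [set r | 0 <= r <= s] A -> G A.
  move=> cA; exists A, setT; split => //; last by rewrite setIT.
  have := @sigma_algebraCD _ setT
    (\bigcup_(t in I0) preimage_set_system setT (L2 t) measurable) set0.
  by rewrite setD0; apply; exact: sigma_algebra0.
have G2 B : sigma_process L2 I0 B -> G B.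
  move=> sB; exists setT, B; split => //; last by rewrite setTI.
  exact: cylindersT.
apply: smallest_sub.
  by apply: null_completion_sigma_algebra; exact: smallest_sigma_algebra.
move=> _ [r /= rs [B mB <-]]; rewrite setTI.
have [r0|r0] := leP 0 r.
  rewrite (driving_ge0 r0).
  apply: sub_null_completion => //; apply: sub_sigma_algebra; apply: G1.
  exists 1%N, (fun _ => r), (fun _ => B); split => //=.
    by move=> i _; rewrite r0.
  by apply/seteqP; split => x /= => [h i _ //|h]; exact: (h 0%N).
have mr : measurable (L r @^-1` B).
  by rewrite -[X in measurable X]setTI; exact: measurable_funP.
have nr0 : 0 < - r by rewrite oppr_gt0.
have E : L r @^-1` B =
    (fun w => lim (L2 s w @[s --> (- r)^'-])) @^-1` ((-%R : R -> R) @^-1` B).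
  by rewrite (driving_lt0 r0).
have mB' : measurable ((-%R : R -> R) @^-1` B).
  rewrite -[X in measurable X]setTI.
  by have : measurable_fun [set: R] (-%R : R -> R) by []; apply.
rewrite E in mr *.
have h := left_limit_null_completion lX2 nr0 mB' mr.
apply: null_completion_mono h.
by move=> B0 sB0; apply: sub_sigma_algebra; exact: G2.
Qed.

Lemma sigma_algebra_bigcapS (I : set R) (F : R -> set (set T)) :
  (forall u, I u -> sigma_algebra setT (F u)) ->
  sigma_algebra setT (\bigcap_(u in I) F u).
Proof.
move=> sF; split.
- by move=> u Iu; case: (sF u Iu).
- by move=> A hA u Iu; case: (sF u Iu) => _ + _; apply; exact: hA.
- by move=> A hA u Iu; case: (sF u Iu) => _ _; apply => n; exact: hA.
Qed.

(** The smallest filtration lies below any particular one. Intersecting the completed pasts over all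
    strictly later times gives a right-continuous candidate; the strict inequality [t < u] is the
    price. *)
Lemma past_filtration_sub (t u : R) : 0 <= t -> t < u ->
  past_filtration P L t `<=` null_completion P (sigma_process L [set r | r <= u]).
Proof.
move=> t0 tu A /(_ (fun t => \bigcap_(u in [set u | t < u])
  null_completion P (sigma_process L [set r | r <= u]))).
have mono (s v : R) : s <= v ->
    null_completion P (sigma_process L [set r | r <= s]) `<=`
    null_completion P (sigma_process L [set r | r <= v]).
  move=> sv; apply: null_completion_mono; apply: sigma_processS.
  by move=> r /= rs; exact: le_trans sv.
apply; last exact: tu.
- split.
  + move=> s s0; apply: sigma_algebra_bigcapS => v _.
    by apply: null_completion_sigma_algebra; exact: smallest_sigma_algebra.
  + move=> s s0 B /(_ (s + 1)); rewrite /= ltrDl ltr01 => /(_ isT).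
    exact: null_completion_measurable.
  + by move=> s v s0 sv B hB r /= vr; apply: hB; exact: le_lt_trans vr.
  + move=> s s0 B hB v /= sv.
    have sv2 : s < (s + v) / 2 by lra.
    by apply: (hB _ sv2); rewrite /=; lra.
  + move=> B mB PB v /= v0; apply: null_completion_null => //.
    exact: sigma_algebra0.
- move=> s s0 B sB v /= sv; apply: sub_null_completion.
    exact: sigma_process_measurable.
  by apply: sigma_processS sB => r /= rs; exact: le_trans (ltW sv).
Qed.

Lemma past_filtration_sigma_algebra (t : R) : 0 <= t ->
  sigma_algebra setT (past_filtration P L t).
Proof.
move=> t0; split.
- by move=> F hF _; have [/(_ _ t0)[]] := hF.
- move=> A hA F hF sF; have [/(_ _ t0)[_ + _] _ _ _ _] := hF; apply.
  exact: hA.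
- move=> A hA F hF sF; have [/(_ _ t0)[_ _ +] _ _ _ _] := hF; apply => n.
  exact: hA.
Qed.

Lemma past_filtration_measurable (t : R) : 0 <= t ->
  past_filtration P L t `<=` measurable.
Proof.
move=> t0; have h := @past_filtration_sub t (t + 1) t0.
apply: subset_trans (h _) _; first by rewrite ltrDl.
exact: null_completion_measurable.
Qed.

Lemma past_filtration_mono (s t : R) : 0 <= s -> s <= t ->
  past_filtration P L s `<=` past_filtration P L t.
Proof.
move=> s0 st A hA F hF sF; apply: (filtration_mono hF s0 st).
exact: hA.
Qed.

Lemma sigma_process_past (t : R) : 0 <= t ->
  sigma_process L [set r | r <= t] `<=` past_filtration P L t.
Proof. by move=> t0 A sA F hF; apply. Qed.

End Driving.
End DrivingFiltration.

(** * Characteristic functions and moments *)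

Section TrigonometricBounds.
Context {R : realType}.
Implicit Types x y : R.

Lemma sin_sub_ge0 x : 0 <= x -> - x <= sin x <= x.
Proof.
move=> x0.
have [c _] : exists2 c : R, c \in `[0, x]%R & sin x - sin 0 = cos c * (x - 0).
  apply: MVT_segment => //.
  by apply: continuous_subspaceT => y; exact: continuous_sin.
rewrite sin0 !subr0 => ->.
have := cos_le1 c; have := cos_geN1 c => h1 h2.
by apply/andP; split; nra.
Qed.

Lemma sin_norm_le x : `|sin x| <= `|x|.
Proof.
have [x0|x0] := leP 0 x.
  by rewrite ler_norml (ger0_norm x0) sin_sub_ge0.
rewrite -normrN -sinN -[X in _ <= X]normrN.
have nx0 : 0 <= - x by rewrite oppr_ge0 ltW.
by rewrite ler_norml (ger0_norm nx0) sin_sub_ge0.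
Qed.

Lemma cos_half_angle x : 1 - cos x = 2 * sin (x / 2) ^+ 2.
Proof.
have -> : cos x = cos (x / 2 *+ 2).
  by congr cos; rewrite -mulr_natr -mulrA mulVf ?mulr1.
by rewrite cos_mulr2n sin2cos2; ring.
Qed.

Lemma one_sub_cos_ge0 x : 0 <= 1 - cos x.
Proof. by rewrite subr_ge0 cos_le1. Qed.

Lemma one_sub_cos_le x : 1 - cos x <= x ^+ 2 / 2.
Proof.
rewrite cos_half_angle -[sin _ ^+ 2]real_normK ?num_real//.
have := sin_norm_le (x / 2).
have : 0 <= `|sin (x / 2)| by [].
rewrite normrM (ger0_norm (_ : 0 <= 2^-1))//.
have -> : x ^+ 2 = `|x| ^+ 2 by rewrite real_normK// num_real.
set s := `|sin _|; set a := `|x|; nra.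
Qed.

Lemma one_sub_cos_le_norm x : 1 - cos x <= `|x|.
Proof.
rewrite cos_half_angle -[sin _ ^+ 2]real_normK ?num_real//.
have := sin_norm_le (x / 2); have := sin_max (x / 2).
have : 0 <= `|sin (x / 2)| by [].
rewrite normrM (ger0_norm (_ : 0 <= 2^-1))//.
set s := `|sin _|; set a := `|x|; nra.
Qed.

(** A quadratic bound rather than the cubic one, because the Levy measure is only known to integrate
    [x ^+ 2]. *)
Lemma sin_sub_norm_le x : `|sin x - x| <= x ^+ 2.
Proof.
wlog x0 : x / 0 <= x.
  move=> h; have [x0|x0] := leP 0 x; first exact: h.
  have := h (- x); rewrite oppr_ge0 (ltW x0) sinN sqrrN -opprD normrN.
  exact.
have [c cx] : exists2 c : R, c \in `[0, x]%R & (sin x - x) - (sin 0 - 0) = (cos c - 1) * (x - 0).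
  apply: (@MVT_segment _ (fun y => sin y - y) (fun y => cos y - 1)) => //.
  apply: continuous_subspaceT => y; apply: continuousB => //.
  exact: continuous_sin.
rewrite sin0 !subr0 => ->; move: cx; rewrite in_itv/= => /andP[c0 cx].
have := one_sub_cos_le_norm c; have := one_sub_cos_ge0 c.
rewrite (ger0_norm c0) => h1 h2.
rewrite -normrN -mulNr opprB ger0_norm; first by nra.
by rewrite mulr_ge0.
Qed.

Lemma one_sub_cos_ge x : `|x| <= 1 -> x ^+ 2 / 8 <= 1 - cos x.
Proof.
wlog x0 : x / 0 <= x.
  move=> h x1; have [x0|x0] := leP 0 x; first exact: h.
  have := h (- x); rewrite oppr_ge0 (ltW x0) sqrrN cosN normrN; exact.
rewrite (ger0_norm x0) => x1; rewrite cos_half_angle.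
have := sin_sub_norm_le (x / 2); rewrite ler_norml => /andP[h1 h2].
have h3 : x / 4 <= sin (x / 2) by nra.
nra.
Qed.

End TrigonometricBounds.

(** * The Levy exponent *)

Section LevyMeasure.
Context {R : realType}.
Variable nu : {measure set R -> \bar R}.
Hypothesis nu2 : levy_measure2 nu.

Definition second_moment : R := \int[nu]_x (x ^+ 2).

Lemma measurable_cosM (v : R) : measurable_fun setT (fun x : R => cos (v * x)).
Proof.
have mcos : measurable_fun [set: R] (@cos R).
  by apply: continuous_measurable_fun; exact: continuous_cos.
by apply: (measurableT_comp mcos); exact: measurable_funM.
Qed.

Lemma measurable_sinM (v : R) : measurable_fun setT (fun x : R => sin (v * x)).
Proof.
have msin : measurable_fun [set: R] (@sin R).
  by apply: continuous_measurable_fun; exact: continuous_sin.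
by apply: (measurableT_comp msin); exact: measurable_funM.
Qed.

Lemma integrable_sqr : nu.-integrable setT (fun x => (x ^+ 2)%:E).
Proof.
apply/integrableP; split; first by apply/measurable_EFinP; exact: measurable_funX.
under eq_integral do rewrite gee0_abs ?lee_fin ?sqr_ge0//.
have mD : measurable [set x : R | 1 < `|x|].
  rewrite (_ : [set _ | _] = Num.norm @^-1` `]1, +oo[%classic).
    have := @normr_measurable R setT measurableT _ (measurable_itv `]1, +oo[).
    by rewrite setTI.
  by apply/seteqP; split => x /=; rewrite in_itv/= andbT.
pose D := [set x : R | 1 < `|x|].
pose f (x : R) := (Order.min (`|x| ^+ 2) 1)%:E : \bar R.
pose g := (fun x : R => (x ^+ 2)%:E) \_ D.
have mg : measurable_fun [set: R] g.
  apply/(measurable_restrictT _ mD)/measurable_funTS.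
  by apply/measurable_EFinP; exact: measurable_funX.
have mf : measurable_fun [set: R] f.
  apply/measurable_EFinP; apply: measurable_minr => //.
  by apply: measurable_funX; exact: normr_measurable.
have g0 x : (0 <= g x)%E.
  by apply: erestrict_ge0 => y _; rewrite lee_fin sqr_ge0.
have f0 x : (0 <= f x)%E.
  by rewrite lee_fin le_min ler01 exprn_ge0.
apply: (@le_lt_trans _ _ (\int[nu]_x (f x + g x))%E).
  apply: ge0_le_integral => //.
  - by move=> x _; rewrite lee_fin sqr_ge0.
  - by apply/measurable_EFinP; exact: measurable_funX.
  - exact: emeasurable_funD.
  - move=> x _; rewrite /g patchE; case: ifPn => xD; first by rewrite leeDr.
    rewrite adde0 /f lee_fin; have /negP : x \notin D by [].
    rewrite inE /D/= => /negP; rewrite -leNgt => x1.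
    by rewrite real_normK ?num_real// le_min lexx -real_normK ?num_real// expr_le1.
rewrite ge0_integralD//; apply: lte_add_pinfty.
  exact: levy_measure_small nu2.
by rewrite -integral_mkcond; exact: levy_measure_large nu2.
Qed.

Lemma second_moment_ge0 : 0 <= second_moment.
Proof. by apply: Rintegral_ge0 => x _; rewrite sqr_ge0. Qed.

Lemma integrable_bounded_by_sqr (f : R -> R) (c : R) :
  measurable_fun setT f -> (forall x, `|f x| <= c * x ^+ 2) ->
  nu.-integrable setT (EFin \o f).
Proof.
move=> mf fc; apply: (@le_integrable _ _ _ nu setT measurableT _
  (fun x => (c * x ^+ 2)%:E)).
- exact/measurable_EFinP.
- move=> x _; rewrite /= lee_fin; apply: (le_trans (fc x)); exact: ler_norm.
- by apply: (integrableZl _ _ integrable_sqr).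
Qed.

Lemma Rintegral_bounded_by_sqr (f : R -> R) (c : R) :
  measurable_fun setT f -> (forall x, `|f x| <= c * x ^+ 2) ->
  `|\int[nu]_x f x| <= c * second_moment.
Proof.
move=> mf fc; have if0 := integrable_bounded_by_sqr mf fc.
apply: (le_trans (le_normr_Rintegral measurableT if0)).
rewrite /second_moment -RintegralZl//; last exact: integrable_sqr.
apply: le_Rintegral => //.
- exact: integrable_norm.
- exact: (integrableZl _ _ integrable_sqr).
Qed.

(** Minus the real part of the Levy exponent: it alone governs the modulus of the characteristic
    function. *)
Definition cos_exponent (v : R) : R := \int[nu]_x (1 - cos (v * x)).

Lemma measurable_one_sub_cos (v : R) :
  measurable_fun setT (fun x : R => 1 - cos (v * x)).
Proof. by apply: measurable_funB => //; exact: measurable_cosM. Qed.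

Lemma one_sub_cos_le_sqr (v x : R) :
  `|1 - cos (v * x)| <= v ^+ 2 / 2 * x ^+ 2.
Proof.
rewrite ger0_norm ?one_sub_cos_ge0//; apply: (le_trans (one_sub_cos_le _)).
by rewrite exprMn; lra.
Qed.

Lemma cos_exponent_ge0 v : 0 <= cos_exponent v.
Proof. by apply: Rintegral_ge0 => x _; exact: one_sub_cos_ge0. Qed.

Lemma cos_exponent_le v : cos_exponent v <= v ^+ 2 / 2 * second_moment.
Proof.
apply: (le_trans (ler_norm _)); apply: Rintegral_bounded_by_sqr.
  exact: measurable_one_sub_cos.
exact: one_sub_cos_le_sqr.
Qed.

Lemma Re_levy_exponent v :
  complex.Re (levy_exponent nu v) = - cos_exponent v.
Proof.
rewrite /= /cos_exponent.
transitivity (\int[nu]_x (-1 * (1 - cos (v * x)))).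
  by apply: eq_Rintegral => x _; ring.
rewrite RintegralZl//; first by rewrite mulN1r.
apply: (integrable_bounded_by_sqr _ (@one_sub_cos_le_sqr v)).
exact: measurable_one_sub_cos.
Qed.

Lemma Im_levy_exponent_le v :
  `|complex.Im (levy_exponent nu v)| <= v ^+ 2 * second_moment.
Proof.
rewrite /=; apply: Rintegral_bounded_by_sqr.
  by apply: measurable_funB; [exact: measurable_sinM|exact: measurable_funM].
by move=> x; apply: (le_trans (sin_sub_norm_le _)); rewrite exprMn.
Qed.

(* On [1/(2v) <= x <= 1/v] both [1 - cos (v x)] and the density are bounded
   below. *)
Lemma cos_exponent_ge (h : R -> R) (alpha : R) :
  0 < alpha -> measurable_fun setT h -> (forall x, 0 <= h x) ->
  (forall A : set R, measurable A ->
       nu A = (\int[lebesgue_measure]_(x in A) (h x)%:E)%E) ->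
  h ~_(0^') (fun x : R => `|x| `^ (- 1 - alpha)) ->
  exists c v0 : R, [/\ 0 < c, 0 < v0 &
    forall v, v0 <= v -> c * v `^ alpha <= cos_exponent v].
Proof.
move=> a0 mh h0 hnu /eqaddoP/(_ 2^-1); rewrite invr_gt0 ltr0n => /(_ isT) hnear.
have [delta /= d0 hd] : exists2 delta : R, 0 < delta &
    forall x, 0 < x -> x < delta -> 2^-1 * x `^ (- 1 - alpha) <= h x.
  move: hnear => [e /= e0 he]; exists e => // x x0 xe.
  have /= := he x; rewrite sub0r normrN (gtr0_norm x0) => /(_ xe).
  rewrite gt_eqF// => /(_ isT). rewrite -[(h - _) x]/(h x - `|x| `^ (-1 - alpha)) (gtr0_norm x0).
  rewrite [X in _ <= _ * X]ger0_norm ?powR_ge0// ler_norml => /andP[+ _].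
  set y := x `^ _; lra.
exists 128^-1, (2 / delta); split => //; first by rewrite divr_gt0.
move=> v vge.
have v0 : 0 < v by apply: lt_le_trans vge; rewrite divr_gt0.
have iv0 : 0 < v^-1 by rewrite invr_gt0.
have vd : v^-1 < delta.
  rewrite invf_plt ?posrE//; apply: lt_le_trans vge.
  by rewrite -[X in X < _]mul1r ltr_pM2r ?invr_gt0// ltr1n.
pose I := `[v^-1 / 2, v^-1]%classic : set R.
have mI : measurable I by exact: measurable_itv.
have nuI : ((v `^ alpha / 4)%:E <= nu I)%E.
  rewrite hnu//.
  apply: (@le_trans _ _ (\int[lebesgue_measure]_(x in I) (2^-1 * v^-1 `^ (-1 - alpha))%:E)%E).
    rewrite integral_cst//=. rewrite /I lebesgue_measure_itv/= lte_fin.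
    rewrite ltr_pdivrMr// ltr_pMr// ltr1n -EFinB -EFinM lee_fin.
    have -> : v^-1 `^ (-1 - alpha) = v * v `^ alpha.
      rewrite -powR_inv1 ?ltW// -powRrM.
      rewrite (_ : -1 * (-1 - alpha) = 1 + alpha); last by ring.
      by rewrite powRD ?powRr1 ?ltW// (gt_eqF v0) implybT.
    have -> : 2^-1 * (v * v `^ alpha) * (v^-1 - v^-1 / 2) = v `^ alpha / 4.
      by field; rewrite gt_eqF.
    by [].
  apply: ge0_le_integral => //.
  - by move=> x _; rewrite lee_fin mulr_ge0// powR_ge0.
  - by apply/measurable_EFinP; exact: measurable_funTS.
  - move=> x; rewrite /I/= in_itv/= => /andP[x1 x2]; rewrite lee_fin.
    have x0 : 0 < x by apply: lt_le_trans x1; rewrite divr_gt0.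
    apply: le_trans (hd x x0 (le_lt_trans x2 vd)).
    rewrite ler_pM2l//.
    have p (y : R) : 0 < y -> y `^ (-1 - alpha) = (y `^ (1 + alpha))^-1.
      by move=> y0; rewrite -powRN; congr (_ `^ _); ring.
    rewrite !p// lef_pV2 ?posrE ?powR_gt0//.
    by apply: ge0_ler_powR; rewrite ?nnegrE ?(ltW iv0) ?(ltW x0)//; lra.
have i1 : nu.-integrable setT (EFin \o (fun x => 1 - cos (v * x))).
  apply: (integrable_bounded_by_sqr _ (@one_sub_cos_le_sqr v)).
  exact: measurable_one_sub_cos.
rewrite /cos_exponent /Rintegral -lee_fin fineK; last exact: integrable_fin_num.
apply: (@le_trans _ _ (\int[nu]_(x in I) (32^-1)%:E)%E).
  rewrite integral_cst//.
  apply: (@le_trans _ _ ((32^-1)%:E * (v `^ alpha / 4)%:E)%E).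
    rewrite -EFinM lee_fin; lra.
  by apply: lee_pmul => //; rewrite lee_fin// divr_ge0// powR_ge0.
apply: (@le_trans _ _ (\int[nu]_(x in I) (1 - cos (v * x))%:E)%E).
  apply: ge0_le_integral => //.
  - apply/measurable_EFinP; apply: measurable_funTS.
    exact: measurable_one_sub_cos.
  - move=> x; rewrite /I/= in_itv/= => /andP[x1 x2]; rewrite lee_fin.
    have vx1 : 2^-1 <= v * x.
      by rewrite -ler_pdivrMl.
    have vx2 : v * x <= 1 by rewrite -ler_pdivlMl// mulr1.
    have := @one_sub_cos_ge _ (v * x); rewrite ger0_norm; last by lra.
    by move=> /(_ vx2); nra.
apply: ge0_subset_integral => //.
- by apply/measurable_EFinP; exact: measurable_one_sub_cos.
Qed.

End LevyMeasure.

(** * Moments read off the characteristic function *)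

Section CharacteristicFunction.
Import complex.
Context {disp : measure_display} {T : measurableType disp} {R : realType}.
Variable P : probability T R.

Lemma bounded_integrable (f : T -> R) (M : R) : measurable_fun setT f ->
  (forall w, `|f w| <= M) -> P.-integrable setT (EFin \o f).
Proof.
move=> mf fM; apply: (@le_integrable _ _ _ P setT measurableT _ (cst M%:E)).
- exact/measurable_EFinP.
- by move=> w _; rewrite /= lee_fin (le_trans (fM w))// ler_norm.
- exact: finite_measure_integrable_cst.
Qed.

Lemma Rintegral_probability_cst (c : R) : \int[P]_w c = c.
Proof.
have PT : P [set: T] = 1%E by exact: probability_setT.
by rewrite Rintegral_cst// -[fine _]/(fine (P [set: T])) PT mulr1.
Qed.

Lemma measurable_cosZ (Y : T -> R) (v : R) : measurable_fun setT Y ->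
  measurable_fun setT (fun w => cos (v * Y w)).
Proof. by move=> mY; exact: (measurableT_comp (measurable_cosM v) mY). Qed.

Lemma measurable_sinZ (Y : T -> R) (v : R) : measurable_fun setT Y ->
  measurable_fun setT (fun w => sin (v * Y w)).
Proof. by move=> mY; exact: (measurableT_comp (measurable_sinM v) mY). Qed.

Lemma integrable_cosZ (Y : T -> R) (v : R) : measurable_fun setT Y ->
  P.-integrable setT (fun w => (cos (v * Y w))%:E).
Proof.
move=> mY; apply: (@bounded_integrable _ 1) => [|w]; last exact: cos_max.
exact: measurable_cosZ.
Qed.

Lemma integrable_sinZ (Y : T -> R) (v : R) : measurable_fun setT Y ->
  P.-integrable setT (fun w => (sin (v * Y w))%:E).
Proof.
move=> mY; apply: (@bounded_integrable _ 1) => [|w]; last exact: sin_max.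
exact: measurable_sinZ.
Qed.

Lemma same_law_Rintegral (X Y : {mfun T >-> R}) (f : R -> R) (M : R) :
  (forall B, measurable B -> P (X @^-1` B) = P (Y @^-1` B)) ->
  measurable_fun setT f -> (forall x, `|f x| <= M) ->
  \int[P]_w f (X w) = \int[P]_w f (Y w).
Proof.
move=> XY mf fM.
have h (Z : {mfun T >-> R}) :
    (\int[P]_w (f (Z w))%:E = \int[distribution P Z]_x (f x)%:E)%E.
  rewrite integral_pushforward//; first exact/measurable_EFinP.
  apply: (@bounded_integrable (f \o Z) M) => [|w]; last exact: fM.
  exact: measurableT_comp.
rewrite /Rintegral !h; congr fine.
by apply: eq_measure_integral => A mA _; exact: XY.
Qed.

Lemma increment_char_fun (X : R -> {RV P >-> R}) (u v theta : R) :
  levy_process P X -> 0 <= u -> u <= v ->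
  char_fun P (fun w => X v w - X u w) theta = char_fun P (X (v - u)) theta.
Proof.
move=> lX u0 uv; rewrite /char_fun.
have mI : measurable_fun setT (fun w => X v w - X u w) by exact: measurable_funB.
pose I : {mfun T >-> R} :=
  HB.pack (fun w => X v w - X u w) (isMeasurableFun.Build _ _ _ _ _ mI).
have law B : measurable B -> P (I @^-1` B) = P (X (v - u) @^-1` B).
  move=> mB; have := levy_stationary lX u0 (_ : 0 <= v - u) mB.
  by rewrite subr_ge0 => /(_ uv); rewrite addrC subrK.
congr Complex.
- exact: (same_law_Rintegral law (measurable_cosM theta) (fun x => cos_max _)).
- exact: (same_law_Rintegral law (measurable_sinM theta) (fun x => sin_max _)).
Qed.

Section Moments.
Variable nu : {measure set R -> \bar R}.
Hypothesis nu2 : levy_measure2 nu.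
Let m2 := second_moment nu.

Lemma expC_levy_exponentE (h theta : R) :
  expC (h%:C%C * levy_exponent nu theta) =
  let a := h * cos_exponent nu theta in
  let b := h * complex.Im (levy_exponent nu theta) in
  Complex (expR (- a) * cos b) (expR (- a) * sin b).
Proof.
have Re := Re_levy_exponent nu2 theta.
case: (levy_exponent nu theta) Re => x y /= ->.
by rewrite /expC /= !mul0r subr0 addr0 mulrN.
Qed.

(** Equal to [8 * (m2 / 2 + m2 ^+ 2 / 2)], the 8 coming from [one_sub_cos_ge] and the rest from
    [cos_char_fun_le]. Linearity of the resulting bound in the elapsed time is what matters, not the
    constant. *)
Definition second_moment_bound := 4 * m2 + 4 * m2 ^+ 2.

Lemma second_moment_bound_ge0 : 0 <= second_moment_bound.
Proof.
by rewrite addr_ge0// mulr_ge0// ?sqr_ge0//; exact: second_moment_ge0.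
Qed.

Variables (Y : {mfun T >-> R}) (h : R).
Hypothesis h0 : 0 <= h.
Hypothesis YE : forall theta,
  char_fun P Y theta = expC (h%:C%C * levy_exponent nu theta).

(** The real part of the characteristic function is [expR (- a) * cos b] with [a] and [b] of order
    [h * theta ^+ 2], and [1 - expR (- a) * cos b <= a + b ^+ 2 / 2]. The constraints on [theta]
    make [b ^+ 2], which has order [h ^+ 2 * theta ^+ 4], at most of order [h * theta ^+ 2]. *)
Lemma cos_char_fun_le (theta : R) : 0 < theta -> theta <= 1 ->
  theta * h <= 1 ->
  \int[P]_w (1 - cos (theta * Y w)) <=
  theta ^+ 2 * (h * (m2 / 2 + m2 ^+ 2 / 2)).
Proof.
move=> t0 t1 th1.
have m20 : 0 <= m2 by exact: second_moment_ge0.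
have := YE theta; rewrite expC_levy_exponentE /char_fun => -[hc _].
rewrite RintegralB//; last 2 first.
- exact: (finite_measure_integrable_cst _ 1).
- exact: integrable_cosZ.
rewrite Rintegral_probability_cst hc.
set a := h * _; set b := h * _.
have a0 : 0 <= a by rewrite mulr_ge0// cos_exponent_ge0.
have ale : a <= h * (theta ^+ 2 / 2 * m2).
  by rewrite ler_wpM2l// cos_exponent_le.
have ble : `|b| <= h * (theta ^+ 2 * m2).
  rewrite normrM (ger0_norm h0) ler_wpM2l//; exact: Im_levy_exponent_le.
have e1 : 1 - expR (- a) <= a by have := expR_ge1Dx (- a); lra.
have e2 : expR (- a) <= 1 by rewrite -expR0 ler_expR oppr_le0.
have e3 : 0 <= expR (- a) by exact: expR_ge0.
have c1 := one_sub_cos_le b; have c0 := one_sub_cos_ge0 b.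
have bb : b ^+ 2 <= theta ^+ 2 * h * m2 ^+ 2.
  rewrite -[X in X <= _]real_normK ?num_real//.
  apply: (@le_trans _ _ ((h * (theta ^+ 2 * m2)) ^+ 2)).
    have q0 : 0 <= h * (theta ^+ 2 * m2).
      by apply: mulr_ge0 => //; apply: mulr_ge0 => //; exact: sqr_ge0.
    by rewrite ler_pXn2r.
  rewrite !exprMn.
  have -> : h ^+ 2 * ((theta ^+ 2) ^+ 2 * m2 ^+ 2) =
    (theta * (theta * h)) * (theta ^+ 2 * h * m2 ^+ 2) by ring.
  apply: ler_piMl.
    apply: mulr_ge0; last exact: sqr_ge0.
    by apply: mulr_ge0 => //; exact: sqr_ge0.
  have th0 : 0 <= theta * h by rewrite mulr_ge0// ltW.
  by rewrite mulr_ile1// ltW.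
have : 1 - expR (- a) * cos b <= a + b ^+ 2 / 2 by nra.
nra.
Qed.

(** On the event [|Y| <= 1 / t] one has [Y ^+ 2 <= 8 / t ^+ 2 * (1 - cos (t * Y))], whose
    expectation is bounded uniformly in [t]; monotone convergence lets [t] go to 0. *)
Lemma char_fun_second_moment :
  (\int[P]_w (Y w ^+ 2)%:E <= (second_moment_bound * h)%:E)%E.
Proof.
(* Starting the truncation levels above [h] guarantees [t * h <= 1] for every frequency used. *)
pose N := Num.truncn h.
pose A n := [set w | `|Y w| <= (n + N).+1%:R].
have mY2 : measurable_fun setT (fun w => (Y w ^+ 2)%:E).
  by apply/measurable_EFinP; exact: measurable_funX.
have mA n : measurable (A n).
  have mN : measurable_fun setT (fun w => `|Y w|).
    exact: (measurableT_comp (@normr_measurable R setT)).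
  have -> : A n = [set: T] `&` (fun w => `|Y w|) @^-1` `]-oo, ((n + N).+1%:R : R)].
    by rewrite setTI; apply/seteqP; split => w; rewrite /A /= in_itv.
  exact: mN (measurable_itv _).
have AT : \bigcup_n A n = setT.
  apply/seteqP; split => // w _; exists (Num.truncn `|Y w|) => //=.
  rewrite /A/= ltW//; apply: (lt_le_trans (truncnS_gt _)).
  by rewrite ler_nat ltnS leq_addr.
have ndA : nondecreasing_seq A.
  move=> m n mn; rewrite subsetEset => w /=; rewrite /A/= => /le_trans; apply.
  by rewrite ler_nat ltnS leq_add2r.
have Y20 : forall (n : nat) w, A n w -> (0 <= (Y w ^+ 2)%:E)%E.
  by move=> n w _; rewrite lee_fin sqr_ge0.
have hc := @ge0_nondecreasing_set_cvg_integral _ _ _ A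
  (fun w => (Y w ^+ 2)%:E) P ndA mA (fun n => measurable_funTS mY2) Y20.
rewrite AT in hc; rewrite -(cvg_lim _ hc)//.
apply: lime_le; first exact: (cvgP _ hc).
apply: nearW => n.
pose t : R := (n + N).+1%:R^-1.
have t0 : 0 < t by rewrite invr_gt0.
have t1 : t <= 1 by rewrite invf_le1// ler1n.
have th : t * h <= 1.
  rewrite /t ler_pdivrMl// mulr1 ltW//; apply: (lt_le_trans (truncnS_gt _)).
  by rewrite ler_nat ltnS leq_addl.
have := cos_char_fun_le t0 t1 th => hY.
have ic : P.-integrable setT (fun w => (1 - cos (t * Y w))%:E).
  apply: (@bounded_integrable _ 2).
    by apply: measurable_funB => //; exact: measurable_cosZ.
  move=> w; rewrite ger0_norm ?one_sub_cos_ge0//.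
  by have := cos_geN1 (t * Y w); lra.
apply: (@le_trans _ _ (\int[P]_w (8 / t ^+ 2 * (1 - cos (t * Y w)))%:E)%E); last first.
  under eq_integral do rewrite EFinM.
  rewrite integralZl// -[X in (_ * X)%E]fineK; last exact: integrable_fin_num.
  rewrite -EFinM lee_fin.
  apply: (@le_trans _ _ (8 / t ^+ 2 * (t ^+ 2 * (h * (m2 / 2 + m2 ^+ 2 / 2))))).
    by rewrite ler_wpM2l// divr_ge0// sqr_ge0.
  rewrite /second_moment_bound le_eqVlt; apply/orP; left; apply/eqP.
  by field; rewrite gt_eqF.
rewrite integral_mkcond; apply: ge0_le_integral => //.
- by move=> w _; apply: erestrict_ge0 => x _; rewrite lee_fin sqr_ge0.
- by apply/(measurable_restrictT _ (mA n)); exact: measurable_funTS.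
- apply/measurable_EFinP; apply: measurable_funM => //.
  by apply: measurable_funB => //; exact: measurable_cosZ.
- move=> w _; rewrite patchE; case: ifPn => wA; last first.
    by rewrite lee_fin mulr_ge0// ?one_sub_cos_ge0// divr_ge0// sqr_ge0.
  rewrite lee_fin; have : `|t * Y w| <= 1.
    rewrite normrM (gtr0_norm t0) /t ler_pdivrMl// mulr1.
    by move: wA; rewrite inE.
  move=> /one_sub_cos_ge; rewrite exprMn => hh.
  have -> : Y w ^+ 2 = 8 / t ^+ 2 * (t ^+ 2 * Y w ^+ 2 / 8).
    by field; rewrite gt_eqF.
  by rewrite ler_wpM2l// divr_ge0// sqr_ge0.
Qed.

Lemma char_fun_integrable_sqr :
  P.-integrable setT (fun w => (Y w ^+ 2)%:E).
Proof.
apply/integrableP; split; first by apply/measurable_EFinP; exact: measurable_funX.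
under eq_integral do rewrite gee0_abs ?lee_fin ?sqr_ge0//.
exact: le_lt_trans char_fun_second_moment (ltry _).
Qed.

Lemma sqr_integrable (f : T -> R) : measurable_fun setT f ->
  P.-integrable setT (fun w => (f w ^+ 2)%:E) ->
  P.-integrable setT (EFin \o f).
Proof.
move=> mf if2.
apply: (@le_integrable _ _ _ P setT measurableT _ (fun w => (1 + f w ^+ 2)%:E)).
- exact/measurable_EFinP.
- move=> w _; rewrite /= lee_fin [X in _ <= X]ger0_norm ?addr_ge0 ?sqr_ge0//.
  rewrite -[f w ^+ 2]real_normK ?num_real//.
  by have := sqr_ge0 (`|f w| - 1); have := normr_ge0 (f w); nra.
- under eq_fun do rewrite EFinD.
  by apply: integrableD => //; exact: finite_measure_integrable_cst.
Qed.

Lemma char_fun_integrable : P.-integrable setT (EFin \o Y).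
Proof. by apply: sqr_integrable => //; exact: char_fun_integrable_sqr. Qed.

(** The expectations of [sin (theta * Y)] and of [sin (theta * Y) - theta * Y] are both
    [O(theta ^+ 2)]: the first by the quadratic bound on the imaginary part of the exponent, the
    second by the second moment. Divide by [theta] and let it tend to 0. *)
Lemma char_fun_mean0 : \int[P]_w Y w = 0.
Proof.
have m20 : 0 <= m2 by exact: second_moment_ge0.
have K0 := second_moment_bound_ge0.
have iY := char_fun_integrable.
have iY2 := char_fun_integrable_sqr.
have key (theta : R) : 0 < theta -> theta <= 1 ->
    `|\int[P]_w Y w| <= theta * (h * (second_moment_bound + m2)).
  move=> t0 t1.
  have := YE theta; rewrite expC_levy_exponentE /char_fun => -[_ hs].
  have is0 := @integrable_sinZ Y theta (measurable_funP _).
  have itY : P.-integrable setT (fun w => (theta * Y w)%:E).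
    exact: (integrableZl measurableT theta iY).
  have iD : P.-integrable setT (fun w => (sin (theta * Y w) - theta * Y w)%:E).
    under eq_fun do rewrite EFinB; exact: integrableB.
  have e1 : theta * \int[P]_w Y w = \int[P]_w sin (theta * Y w)
      - \int[P]_w (sin (theta * Y w) - theta * Y w).
    rewrite [X in _ = _ - X]RintegralB// opprB addrC subrK RintegralZl//.
  have e2 : `|\int[P]_w (sin (theta * Y w) - theta * Y w)| <=
      theta ^+ 2 * (second_moment_bound * h).
    apply: (le_trans (le_normr_Rintegral measurableT iD)).
    apply: (@le_trans _ _ (\int[P]_w (theta ^+ 2 * Y w ^+ 2))).
      apply: le_Rintegral => //; first exact: integrable_norm.
        exact: (integrableZl measurableT _ iY2).
      by move=> w _; rewrite -exprMn; exact: sin_sub_norm_le.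
    rewrite RintegralZl// ler_wpM2l ?sqr_ge0//.
    rewrite /Rintegral -lee_fin fineK; first exact: char_fun_second_moment.
    exact: integrable_fin_num.
  have e3 : `|\int[P]_w sin (theta * Y w)| <= theta ^+ 2 * (h * m2).
    rewrite hs; set a := h * _; set b := h * _.
    have a0 : 0 <= a by rewrite mulr_ge0// cos_exponent_ge0.
    have ble : `|b| <= h * (theta ^+ 2 * m2).
      rewrite normrM (ger0_norm h0) ler_wpM2l//; exact: Im_levy_exponent_le.
    rewrite normrM (ger0_norm (expR_ge0 _)).
    have e2' : expR (- a) <= 1 by rewrite -expR0 ler_expR oppr_le0.
    apply: (@le_trans _ _ `|sin b|); first by rewrite ler_piMl.
    apply: (le_trans (sin_norm_le b)); apply: (le_trans ble).
    by rewrite mulrCA.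
  have e4 : theta * `|\int[P]_w Y w| <= theta * (theta * (h * (second_moment_bound + m2))).
    rewrite -[X in X * `|_|](gtr0_norm t0) -normrM e1.
    apply: (le_trans (ler_normB _ _)).
    apply: (le_trans (lerD e3 e2)).
    rewrite expr2; lra.
  by move: e4; rewrite ler_pM2l.
apply/eqP; rewrite -normr_eq0 eq_le normr_ge0 andbT.
apply/ler_addgt0Pr => e e0; rewrite add0r.
pose K := h * (second_moment_bound + m2).
have KK : 0 <= K by rewrite mulr_ge0// addr_ge0.
pose theta := Num.min 1 (e / (K + 1)).
have K1 : 0 < K + 1 by rewrite ltr_wpDl.
have t0 : 0 < theta by rewrite lt_min ltr01 divr_gt0.
have t1 : theta <= 1 by rewrite ge_min lexx.
apply: (le_trans (key _ t0 t1)); rewrite -/K.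
apply: (@le_trans _ _ (e / (K + 1) * K)).
  by rewrite ler_wpM2r// ge_min lexx orbT.
rewrite mulrAC ler_pdivrMr// ler_pM2l//; lra.
Qed.

Lemma char_fun_cf2 (theta : R) :
  (\int[P]_w cos (theta * Y w)) ^+ 2 + (\int[P]_w sin (theta * Y w)) ^+ 2
  = expR (- (2 * h * cos_exponent nu theta)).
Proof.
have := YE theta; rewrite expC_levy_exponentE /char_fun => -[-> ->].
set a := h * _; set b := h * _.
rewrite !exprMn -mulrDr cos2Dsin2 mulr1 -expRM_natl.
by congr expR; rewrite /a; ring.
Qed.

End Moments.
End CharacteristicFunction.

(** * Increments of the driving process against its past *)

Section DrivingIncrements.
Import complex.
Context {disp : measure_display} {T : measurableType disp} {R : realType}.
Variable P : probability T R.
Variable nu : {measure set R -> \bar R}.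
Variable L : R -> {RV P >-> R}.
Hypothesis hL : driving_levy nu L.

Lemma integrable_funD (f g : T -> R) : P.-integrable setT (EFin \o f) ->
  P.-integrable setT (EFin \o g) ->
  P.-integrable setT (fun w => (f w + g w)%:E).
Proof. by move=> i1 i2; exact: (integrableD measurableT i1 i2). Qed.

Definition past (s : R) : set (set T) :=
  null_completion P (sigma_process L [set r | r <= s]).

(** Phrased with [g_sigma_algebraType] so that closure properties of measurable functions apply
    directly; [past s] being a sigma-algebra, generating adds nothing. *)
Definition past_measurable (s : R) (X : T -> R) : Prop :=
  measurable_fun [set: g_sigma_algebraType (past s)]
    (X : g_sigma_algebraType (past s) -> R).

Lemma past_sigma_algebra s : sigma_algebra setT (past s).
Proof.
by apply: null_completion_sigma_algebra; exact: smallest_sigma_algebra.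
Qed.

Lemma past_measurableP s X :
  past_measurable s X <-> forall B, measurable B -> past s (X @^-1` B).
Proof.
have E := sigma_algebra_id (past_sigma_algebra s).
split=> [mX B mB|h _ B mB].
  by have := mX measurableT B mB; rewrite setTI -[in X in _ -> X]E.
by rewrite setTI; change (<<s past s >> (X @^-1` B)); rewrite E; exact: h.
Qed.

Lemma past_measurable_fun s X : past_measurable s X -> measurable_fun setT X.
Proof.
move=> /past_measurableP mX _ B mB; rewrite setTI.
exact: null_completion_measurable (mX B mB).
Qed.

Lemma past_measurable_mono s t X : s <= t ->
  past_measurable s X -> past_measurable t X.
Proof.
move=> st /past_measurableP mX; apply/past_measurableP => B mB.
apply: null_completion_mono (mX B mB); apply: sigma_processS.
by move=> r /= rs; exact: le_trans st.
Qed.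

Lemma past_measurable_driving s t : t <= s -> past_measurable s (L t).
Proof.
move=> ts; apply/past_measurableP => B mB.
apply: sub_null_completion; first exact: sigma_process_measurable.
exact: sigma_process_preimage.
Qed.

Lemma past_filtration_past_measurable (t u : R) (X : T -> R) : 0 <= t -> t < u ->
  (forall B, measurable B -> past_filtration P L t (X @^-1` B)) ->
  past_measurable u X.
Proof.
move=> t0 tu hX; apply/past_measurableP => B mB.
exact: (past_filtration_sub t0 tu (hX B mB)).
Qed.

Definition increment (u v : R) (w : T) : R := L v w - L u w.

Lemma measurable_increment u v : measurable_fun setT (increment u v).
Proof. exact: measurable_funB. Qed.
Hint Resolve measurable_increment : core.

Let K := second_moment_bound nu.

Lemma driving_increment_char_fun (u v theta : R) : 0 <= u -> u <= v ->
  char_fun P (increment u v) theta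
  = expC ((v - u)%:C%C * levy_exponent nu theta).
Proof.
move=> u0 uv; have [[L1 [L2 [[lX1 _ _ _] LE]]] _ _ hexp] := hL.
rewrite -hexp ?subr_ge0//.
have v0 : 0 <= v by exact: le_trans uv.
rewrite (driving_ge0 LE (_ : 0 <= v - u)) ?subr_ge0//.
rewrite -(increment_char_fun theta lX1 u0 uv); congr (char_fun P _ theta).
by rewrite /increment (driving_ge0 LE v0) (driving_ge0 LE u0).
Qed.

Let incr (u v : R) : {mfun T >-> R} :=
  HB.pack (increment u v) (isMeasurableFun.Build _ _ _ _ _ (measurable_increment u v)).

Lemma increment_integrable_sqr (u v : R) : 0 <= u -> u <= v ->
  P.-integrable setT (fun w => (increment u v w ^+ 2)%:E).
Proof.
move=> u0 uv; have nu2 := driving_measure hL.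
have vu : 0 <= v - u by rewrite subr_ge0.
apply: (@char_fun_integrable_sqr _ _ _ P nu nu2 (incr u v) (v - u)) => //.
by move=> theta; exact: driving_increment_char_fun.
Qed.

Lemma increment_second_moment (u v : R) : 0 <= u -> u <= v ->
  \int[P]_w (increment u v w ^+ 2) <= K * (v - u).
Proof.
move=> u0 uv; have nu2 := driving_measure hL.
have vu : 0 <= v - u by rewrite subr_ge0.
rewrite /Rintegral -lee_fin fineK; last first.
  apply: integrable_fin_num => //; exact: increment_integrable_sqr.
apply: (@char_fun_second_moment _ _ _ P nu nu2 (incr u v) (v - u)) => //.
by move=> theta; exact: driving_increment_char_fun.
Qed.

Lemma increment_integrable (u v : R) : 0 <= u -> u <= v ->
  P.-integrable setT (EFin \o increment u v).
Proof.
by move=> u0 uv; apply: sqr_integrable => //; exact: increment_integrable_sqr.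
Qed.

Lemma increment_mean0 (u v : R) : 0 <= u -> u <= v ->
  \int[P]_w increment u v w = 0.
Proof.
move=> u0 uv; have nu2 := driving_measure hL.
have vu : 0 <= v - u by rewrite subr_ge0.
apply: (@char_fun_mean0 _ _ _ P nu nu2 (incr u v) (v - u)) => //.
by move=> theta; exact: driving_increment_char_fun.
Qed.

Lemma increment_cf2 (u v theta : R) : 0 <= u -> u <= v ->
  (\int[P]_w cos (theta * increment u v w)) ^+ 2 +
  (\int[P]_w sin (theta * increment u v w)) ^+ 2
  = expR (- (2 * (v - u) * cos_exponent nu theta)).
Proof.
move=> u0 uv; have nu2 := driving_measure hL.
have vu : 0 <= v - u by rewrite subr_ge0.
apply: (@char_fun_cf2 _ _ _ P nu nu2 (incr u v) (v - u)) => //.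
by move=> theta'; exact: driving_increment_char_fun.
Qed.

Lemma past_expectation_indep (s u v : R) (X : T -> R) (f : R -> R) :
  0 <= s -> s <= u -> u <= v ->
  past_measurable s X -> measurable_fun setT f ->
  P.-integrable setT (EFin \o X) ->
  P.-integrable setT (fun w => (f (increment u v w))%:E) ->
  P.-integrable setT (fun w => (X w * f (increment u v w))%:E) /\
  \int[P]_w (X w * f (increment u v w)) =
  \int[P]_w X w * \int[P]_w f (increment u v w).
Proof.
move=> s0 su uv mX mf iX if0.
have mX' := past_measurable_fun mX.
have mfI : measurable_fun setT (fun w => f (increment u v w)).
  exact: measurableT_comp.
pose X' : {mfun T >-> R} := HB.pack X (isMeasurableFun.Build _ _ _ _ X mX').
pose Y : {mfun T >-> R} :=
  HB.pack (fun w => f (increment u v w)) (isMeasurableFun.Build _ _ _ _ _ mfI).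
have [[L1 [L2 [cp LE]]] _ _ _] := hL.
have [h1 h2] : P.-integrable setT (fun w => (X' w * Y w)%:E) /\
  (\int[P]_w (X' w * Y w)%:E = (\int[P]_w (X' w)%:E) * (\int[P]_w (Y w)%:E))%E.
  apply: integral_indep => // A B mA mB.
  apply: (past_increment_indep cp LE s0 su uv).
    by move/past_measurableP : mX; exact.
  exists (f @^-1` B) => //.
  by rewrite -[X in measurable X]setTI; exact: mf.
split; first exact: h1.
by rewrite /Rintegral h2 fineM//; exact: integrable_fin_num.
Qed.

Lemma past_increment_mean0 (s u v : R) (X : T -> R) :
  0 <= s -> s <= u -> u <= v -> past_measurable s X ->
  P.-integrable setT (EFin \o X) ->
  P.-integrable setT (fun w => (X w * increment u v w)%:E) /\
  \int[P]_w (X w * increment u v w) = 0.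
Proof.
move=> s0 su uv mX iX.
have u0 : 0 <= u by exact: le_trans su.
have [h1 h2] := past_expectation_indep s0 su uv mX (@measurable_id _ _ setT) iX
  (increment_integrable u0 uv).
by split => //; rewrite h2 increment_mean0// mulr0.
Qed.

(* Right continuity of the filtration costs nothing: a short increment
   [L u - L w], with [u] decreasing to [w], is small in L^2. *)
Lemma past_filtration_increment_mean0 (t w v M : R) (Z : T -> R) :
  0 <= t -> t <= w -> w <= v ->
  (forall B, measurable B -> past_filtration P L t (Z @^-1` B)) ->
  (forall x, `|Z x| <= M) ->
  P.-integrable setT (fun x => (Z x * increment w v x)%:E) /\
  \int[P]_x (Z x * increment w v x) = 0.
Proof.
move=> t0 tw wv mZ ZM.
have w0 : 0 <= w by exact: le_trans tw.
have mZ' : measurable_fun setT Z.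
  have t1 : t < t + 1 by rewrite ltrDl.
  exact: past_measurable_fun (past_filtration_past_measurable t0 t1 mZ).
have iZ : P.-integrable setT (EFin \o Z) by exact: bounded_integrable ZM.
have iZI (a b : R) : 0 <= a -> a <= b ->
    P.-integrable setT (fun x => (Z x * increment a b x)%:E).
  move=> a0 ab; apply: (@le_integrable _ _ _ P setT measurableT _
    (fun x => (M * increment a b x)%:E)).
  - by apply/measurable_EFinP; exact: measurable_funM.
  - move=> x _; rewrite lee_fin !normrM ler_wpM2r//.
    exact: (le_trans (ZM x) (ler_norm _)).
  - exact: (integrableZl measurableT _ (increment_integrable a0 ab)).
split; first exact: iZI.
have K0 : 0 <= K := second_moment_bound_ge0 nu.
have M0 : 0 <= M by have := ZM point; exact: le_trans.
have [->|wneqv] := eqVneq w v.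
  rewrite (_ : (fun x => _) = cst 0) ?Rintegral_probability_cst//.
  by apply/funext => x; rewrite /increment subrr mulr0.
have {}wv : w < v by rewrite lt_neqAle wneqv.
(* With [u = w + dl ^+ 2], the increment from [u] to [v] averages to 0 against [Z]. For the
   remaining one, [|y| <= dl + y ^+ 2 / dl] and its second moment is at most [K * dl ^+ 2], so both
   terms are of order [dl]. *)
have key (dl : R) : 0 < dl -> dl ^+ 2 <= v - w ->
    `|\int[P]_x (Z x * increment w v x)| <= dl * (M * (1 + K)).
  move=> dl0 dlv; pose u := w + dl ^+ 2.
  have wu : w <= u by rewrite lerDl sqr_ge0.
  have tu : t < u by rewrite (le_lt_trans tw)// ltrDl exprn_gt0.
  have uv : u <= v by rewrite /u -lerBrDl.
  have u0 : 0 <= u by exact: le_trans wu.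
  have mZu : past_measurable u Z := past_filtration_past_measurable t0 tu mZ.
  have [_ hz] := past_increment_mean0 u0 (lexx u) uv mZu iZ.
  have -> : \int[P]_x (Z x * increment w v x) = \int[P]_x (Z x * increment w u x).
    transitivity (\int[P]_x (Z x * increment w u x + Z x * increment u v x)).
      by apply: eq_Rintegral => x _; rewrite /increment; ring.
    by rewrite RintegralD//; [rewrite hz addr0|exact: iZI|exact: iZI].
  apply: (le_trans (le_normr_Rintegral measurableT (iZI _ _ w0 wu))).
  have i1 : P.-integrable setT (fun x => (dl + dl^-1 * increment w u x ^+ 2)%:E).
    under eq_fun do rewrite EFinD.
    apply: integrableD => //; first exact: finite_measure_integrable_cst.
    exact: (integrableZl measurableT _ (increment_integrable_sqr w0 wu)).
  apply: (@le_trans _ _ (\int[P]_x (M * (dl + dl^-1 * increment w u x ^+ 2)))).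
    apply: le_Rintegral => //.
    - exact: (integrable_norm (iZI _ _ w0 wu)).
    - exact: (integrableZl measurableT _ i1).
    - move=> x _; rewrite normrM; apply: ler_pM => //.
      set y := increment w u x.
      rewrite -[X in _ <= _ + _ * X]real_normK ?num_real//.
      have z0 := normr_ge0 y; move: z0; set z := `|y| => z0.
      have : 0 <= dl^-1 * (z - dl) ^+ 2.
        by rewrite mulr_ge0 ?sqr_ge0// invr_ge0 ltW.
      have -> : dl^-1 * (z - dl) ^+ 2 = dl^-1 * z ^+ 2 - 2 * z + dl.
        by field; rewrite gt_eqF.
      lra.
  rewrite RintegralZl// RintegralD//; last 2 first.
  - exact: finite_measure_integrable_cst.
  - exact: (integrableZl measurableT _ (increment_integrable_sqr w0 wu)).
  rewrite Rintegral_probability_cst RintegralZl//; last exact: increment_integrable_sqr.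
  rewrite mulrCA ler_wpM2l// mulrDr mulr1 lerD2l.
  apply: (@le_trans _ _ (dl^-1 * (K * dl ^+ 2))).
    rewrite ler_wpM2l ?invr_ge0 ?(ltW dl0)//.
    by apply: (le_trans (increment_second_moment w0 wu)); rewrite /u addrAC subrr add0r.
  by rewrite le_eqVlt; apply/orP; left; apply/eqP; field; rewrite gt_eqF.
apply/eqP; rewrite -normr_eq0 eq_le normr_ge0 andbT.
apply/ler_addgt0Pr => e e0; rewrite add0r.
pose C := M * (1 + K).
have C0 : 0 <= C by rewrite mulr_ge0// addr_ge0.
have C1 : 0 < C + 1 by rewrite ltr_wpDl.
pose dl := Num.min (Num.min 1 (v - w)) (e / (C + 1)).
have vw : 0 < v - w by rewrite subr_gt0.
have dl0 : 0 < dl by rewrite !lt_min ltr01 vw divr_gt0.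
have dl1 : dl <= 1 by rewrite !ge_min lexx.
have dlv : dl <= v - w by rewrite !ge_min lexx orbT.
have dle : dl <= e / (C + 1) by rewrite !ge_min lexx !orbT.
apply: (le_trans (key dl dl0 _)).
  by rewrite expr2 (le_trans _ dlv)// ler_piMl// ltW.
rewrite -/C; apply: (@le_trans _ _ (e / (C + 1) * C)); first by rewrite ler_wpM2r.
rewrite mulrAC ler_pdivrMr// ler_pM2l//; lra.
Qed.

Section GridSums.
Variables (x : nat -> R) (c : nat -> R).
Hypotheses (x0 : 0 <= x 0%N) (xmono : forall i, x i <= x i.+1).

Definition grid_sum (m : nat) (w : T) : R :=
  \sum_(i < m) c i * increment (x i) (x i.+1) w.

Lemma grid_ge0 i : 0 <= x i.
Proof. by elim: i => // i IH; exact: le_trans (xmono i). Qed.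

Lemma grid_sumS m w :
  grid_sum m.+1 w = grid_sum m w + c m * increment (x m) (x m.+1) w.
Proof. by rewrite /grid_sum big_ord_recr. Qed.

Lemma past_measurableD s X Y : past_measurable s X -> past_measurable s Y ->
  past_measurable s (fun w => X w + Y w).
Proof. exact: measurable_funD. Qed.

Lemma grid_sum_past m : past_measurable (x m) (grid_sum m).
Proof.
elim: m => [|m IH].
  rewrite (_ : grid_sum 0 = cst 0); last by apply/funext => w; rewrite /grid_sum big_ord0.
  exact: measurable_cst.
rewrite (_ : grid_sum m.+1 = fun w => grid_sum m w + c m * increment (x m) (x m.+1) w).
  apply: past_measurableD; first exact: past_measurable_mono (xmono m) IH.
  apply: measurable_funM; first exact: measurable_cst.
  by apply: measurable_funB; exact: past_measurable_driving.
by apply/funext => w; exact: grid_sumS.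
Qed.

(** Orthogonality: the cross term pairs a past variable with a later centred increment. *)
Lemma grid_sum_second_moment m :
  P.-integrable setT (fun w => (grid_sum m w ^+ 2)%:E) /\
  \int[P]_w (grid_sum m w ^+ 2) <= K * \sum_(i < m) c i ^+ 2 * (x i.+1 - x i).
Proof.
elim: m => [|m [iX IH]].
  rewrite (_ : (fun w => grid_sum 0 w ^+ 2) = cst 0); last first.
    by apply/funext => w; rewrite /grid_sum big_ord0 expr0n.
  rewrite Rintegral_probability_cst big_ord0 mulr0; split => //.
  rewrite (_ : (fun w => _) = cst 0%:E); last first.
    by apply/funext => w; rewrite /grid_sum big_ord0 expr0n.
  exact: finite_measure_integrable_cst.
pose D := increment (x m) (x m.+1).
have xm := grid_ge0 m; have xmm := xmono m.
have mX := @grid_sum_past m.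
have iD2 := increment_integrable_sqr xm xmm.
have iX1 : P.-integrable setT (EFin \o grid_sum m).
  by apply: sqr_integrable => //; exact: past_measurable_fun mX.
have [iXD eXD] := past_increment_mean0 xm (lexx _) xmm mX iX1.
have E : (fun w => grid_sum m.+1 w ^+ 2) =
  (fun w => grid_sum m w ^+ 2 + (2 * c m * (grid_sum m w * D w) + c m ^+ 2 * D w ^+ 2)).
  by apply/funext => w; rewrite grid_sumS -/D; ring.
have i1 : P.-integrable setT (fun w => (2 * c m * (grid_sum m w * D w))%:E).
  exact: (integrableZl measurableT _ iXD).
have i2 : P.-integrable setT (fun w => (c m ^+ 2 * D w ^+ 2)%:E).
  exact: (integrableZl measurableT _ iD2).
have i3 : P.-integrable setT
    (fun w => (2 * c m * (grid_sum m w * D w) + c m ^+ 2 * D w ^+ 2)%:E).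
  by under eq_fun do rewrite EFinD; exact: integrableD.
split.
  rewrite (_ : (fun w => (grid_sum m.+1 w ^+ 2)%:E) = (fun w => (grid_sum m w ^+ 2)%:E +
    (2 * c m * (grid_sum m w * D w) + c m ^+ 2 * D w ^+ 2)%:E)%E).
    exact: integrableD.
  by apply/funext => w; rewrite -EFinD grid_sumS -/D; congr (_%:E); ring.
rewrite E RintegralD// RintegralD// RintegralZl// eXD mulr0 add0r RintegralZl//.
rewrite big_ord_recr/= mulrDr lerD//.
rewrite mulrCA ler_wpM2l ?sqr_ge0//.
exact: increment_second_moment.
Qed.

(** Squared modulus of the characteristic function: it stays real, and phases disappear when
    independent terms are added. *)
Definition cf2 (X : T -> R) (theta : R) : R :=
  (\int[P]_w cos (theta * X w)) ^+ 2 + (\int[P]_w sin (theta * X w)) ^+ 2.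

Lemma sqr_Rintegral_le (f : T -> R) (M : R) : measurable_fun setT f ->
  (forall w, `|f w| <= M) -> (\int[P]_w f w) ^+ 2 <= \int[P]_w (f w ^+ 2).
Proof.
move=> mf fM; have if0 := bounded_integrable P mf fM.
have i2 : P.-integrable setT (fun w => (f w ^+ 2)%:E).
  apply: (@bounded_integrable _ _ _ P (fun w => f w ^+ 2) (M ^+ 2)); first exact: measurable_funX.
  move=> w; rewrite normrX ler_pXn2r// nnegrE//.
  exact: le_trans (fM w).
set a := \int[P]_w f w.
have : 0 <= \int[P]_w ((f w - a) ^+ 2) by apply: Rintegral_ge0 => w _; exact: sqr_ge0.
rewrite (_ : (fun w => (f w - a) ^+ 2) = (fun w => f w ^+ 2 + ((- 2 * a) * f w + a ^+ 2))).
  have i3 : P.-integrable setT (fun w => ((- 2 * a) * f w)%:E).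
    exact: (integrableZl measurableT _ if0).
  have i4 : P.-integrable setT (EFin \o cst (a ^+ 2)).
    exact: finite_measure_integrable_cst.
  rewrite RintegralD//; last exact: (integrable_funD i3 i4).
  rewrite RintegralD// RintegralZl// Rintegral_probability_cst -/a; nra.
by apply/funext => w; ring.
Qed.

Lemma cf2_le1 X theta : measurable_fun setT X -> cf2 X theta <= 1.
Proof.
move=> mX.
have ms := measurable_sinZ theta mX; have mc := measurable_cosZ theta mX.
have h1 := sqr_Rintegral_le mc (fun w => cos_max (theta * X w)).
have h2 := sqr_Rintegral_le ms (fun w => sin_max (theta * X w)).
apply: (le_trans (lerD h1 h2)).
have b (f : T -> R) : measurable_fun setT f -> (forall w, `|f w| <= 1) ->
    P.-integrable setT (fun w => (f w ^+ 2)%:E).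
  move=> mf f1; apply: (@bounded_integrable _ _ _ P (fun w => f w ^+ 2) 1); first exact: measurable_funX.
  by move=> w; rewrite normrX expr_le1.
rewrite -RintegralD//; [|by apply: b => // w; exact: cos_max|by apply: b => // w; exact: sin_max].
rewrite (_ : (fun w => _) = cst 1) ?Rintegral_probability_cst//.
by apply/funext => w; rewrite cos2Dsin2.
Qed.

(** The modulus of a product of characteristic functions, written in real form: the addition
    formulas reduce it to four products of independent factors. *)
Lemma cf2_add_increment (s u v a theta : R) (X : T -> R) :
  0 <= s -> s <= u -> u <= v -> past_measurable s X ->
  cf2 (fun w => X w + a * increment u v w) theta =
  cf2 X theta * expR (- (2 * (v - u) * cos_exponent nu (theta * a))).
Proof.
move=> s0 su uv mX.
have u0 : 0 <= u by exact: le_trans su.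
rewrite -(increment_cf2 (theta * a) u0 uv).
have mX' := past_measurable_fun mX.
have mc : past_measurable s (fun w => cos (theta * X w)) by exact: measurable_cosZ.
have ms : past_measurable s (fun w => sin (theta * X w)) by exact: measurable_sinZ.
pose I := increment u v.
have iI f : (f = cos \/ f = sin :> (R -> R)) ->
    P.-integrable setT (fun w => (f (theta * a * I w))%:E).
  by case=> ->; [apply: integrable_cosZ|apply: integrable_sinZ]; exact: measurable_increment.
have ind f g : (f = cos \/ f = sin :> (R -> R)) -> (g = cos \/ g = sin :> (R -> R)) ->
    P.-integrable setT (fun w => (f (theta * X w) * g (theta * a * I w))%:E) /\
    \int[P]_w (f (theta * X w) * g (theta * a * I w)) =
    \int[P]_w f (theta * X w) * \int[P]_w g (theta * a * I w).
  move=> hf hg.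
  apply: (@past_expectation_indep s u v (fun w => f (theta * X w))
    (fun y => g (theta * a * y))) => //.
  - by case: hf => ->; [exact: mc|exact: ms].
  - by case: hg => ->; [exact: measurable_cosM|exact: measurable_sinM].
  - by case: hf => ->; [exact: integrable_cosZ|exact: integrable_sinZ].
  - exact: iI.
have [i1 e1] := ind cos cos (or_introl erefl) (or_introl erefl).
have [i2 e2] := ind cos sin (or_introl erefl) (or_intror erefl).
have [i3 e3] := ind sin cos (or_intror erefl) (or_introl erefl).
have [i4 e4] := ind sin sin (or_intror erefl) (or_intror erefl).
rewrite /cf2.
rewrite (_ : (fun w => cos _) = (fun w => cos (theta * X w) * cos (theta * a * I w)
   - sin (theta * X w) * sin (theta * a * I w))); last first.
  by apply/funext => w; rewrite -cosD; congr cos; rewrite /I; ring.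
rewrite (_ : (fun w => sin (theta * (X w + _))) = (fun w => sin (theta * X w) * cos (theta * a * I w)
   + cos (theta * X w) * sin (theta * a * I w))); last first.
  by apply/funext => w; rewrite -sinD; congr sin; rewrite /I; ring.
rewrite RintegralB// RintegralD// e1 e2 e3 e4; ring.
Qed.

(** Nothing is asked of [X] beyond measurability: the start of the induction bounds its modulus by
    1. This is how all of [L] before the grid is handled. *)
Lemma cf2_grid_sum m theta (X : T -> R) : past_measurable (x 0%N) X ->
  cf2 (fun w => X w + grid_sum m w) theta <=
  expR (- (2 * \sum_(i < m) (x i.+1 - x i) * cos_exponent nu (theta * c i))).
Proof.
move=> mX; elim: m => [|m IH].
  rewrite big_ord0 mulr0 oppr0 expR0.
  rewrite (_ : (fun w => _) = X); first by apply: cf2_le1; exact: past_measurable_fun mX.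
  by apply/funext => w; rewrite /grid_sum big_ord0 addr0.
rewrite (_ : (fun w => _) = (fun w => (X w + grid_sum m w) + c m * increment (x m) (x m.+1) w)); last first.
  by apply/funext => w; rewrite grid_sumS addrA.
have x0m : x 0%N <= x m by elim: m {IH} => // m IH; exact: le_trans (xmono m).
rewrite (@cf2_add_increment (x m)) ?grid_ge0//; last first.
  by apply: past_measurableD; [exact: past_measurable_mono x0m mX|exact: grid_sum_past].
move: IH; rewrite big_ord_recr/=; set s := \sum_(i < m) _ => IH.
set d := x m.+1 - x m; set e := cos_exponent _ _.
have -> : - (2 * (s + d * e)) = - (2 * s) - (2 * d * e) by ring.
by rewrite expRD ler_wpM2r ?expR_ge0.
Qed.

End GridSums.
End DrivingIncrements.

(** * Integrals of step functions *)

Section StepGrid.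
Context {R : realType}.
Notation mu := (@lebesgue_measure R).
Implicit Types (a b s t u v y : R) (p : seq (R * (R * R))).

Definition clamp a b y : R := Num.min (Num.max y a) b.

Lemma clamp_itv a b y : a <= b -> a <= clamp a b y <= b.
Proof.
by move=> ab; rewrite /clamp le_min ge_min lexx orbT andbT le_max lexx orbT ab.
Qed.

Lemma clamp_id a b y : a <= y <= b -> clamp a b y = y.
Proof. by move=> /andP[ay yb]; rewrite /clamp max_l// min_l. Qed.

Lemma clamp_le a b y : a <= b -> y <= a -> clamp a b y = a.
Proof. by move=> ab ya; rewrite /clamp max_r// min_l. Qed.

Lemma clamp_ge a b y : a <= b -> b <= y -> clamp a b y = b.
Proof. by move=> ab bY; rewrite /clamp max_l ?min_r// (le_trans ab). Qed.

Lemma clamp_mono a b y z : a <= b -> y <= z -> clamp a b y <= clamp a b z.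
Proof.
move=> ab yz; have [ya|ay] := leP y a.
  by rewrite (clamp_le ab ya); case/andP: (clamp_itv z ab).
have [bz|zb] := leP b z.
  by rewrite (clamp_ge ab bz); case/andP: (clamp_itv y ab).
by rewrite !clamp_id// ?(ltW ay)/= ?(ltW (le_lt_trans yz zb))// ?(ltW zb) (ltW (lt_le_trans ay yz)).
Qed.

(** Sort the points behind [a]. The default value [b] of [nth] closes the grid and extends it to a
    monotone sequence on all of [nat]. *)
Lemma exists_grid a b (es : seq R) : a <= b ->
  (forall e, e \in es -> a <= e <= b) ->
  exists (x : nat -> R) (m : nat), [/\ x 0%N = a, x m = b,
    forall i, x i <= x i.+1 &
    forall e, e \in es -> forall i, e <= x i \/ x i.+1 <= e].
Proof.
move=> ab esab.
pose q := a :: sort <=%R es.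
pose x i := nth b q i.
have qb e : e \in q -> a <= e <= b.
  rewrite inE mem_sort => /predU1P[->|/esab//].
  by rewrite lexx ab.
have sq : sorted <=%R q.
  rewrite /= path_min_sorted; first exact: sort_le_sorted.
  by apply/allP => e; rewrite mem_sort => /esab/andP[].
have xmono i : x i <= x i.+1.
  have [i1|i1] := ltnP i.+1 (size q).
    by move/(sortedP b) : sq; exact.
  rewrite [leRHS]/x nth_default//.
  have [i2|i2] := ltnP i (size q); last by rewrite /x nth_default.
  by have /andP[] := qb _ (mem_nth b i2).
have xle i j : (i <= j)%N -> x i <= x j.
  elim: j => [|j IH]; first by rewrite leqn0 => /eqP->.
  by rewrite leq_eqVlt => /predU1P[->//|/IH/le_trans]; apply.
exists x, (size q); split => //; first by rewrite /x nth_default.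
move=> e ees i.
have eq : e \in q by rewrite inE mem_sort ees orbT.
have ex : e = x (index e q) by rewrite /x nth_index.
rewrite ex; have [ij|ij] := leqP (index e q) i; [left|right]; exact: xle.
Qed.

Lemma cell_indic s t a b u v y : a <= u -> v <= b -> u < y <= v ->
  (clamp a b s <= u \/ v <= clamp a b s) ->
  (clamp a b t <= u \/ v <= clamp a b t) ->
  \1_(`]s, t]%classic) y = \1_(`]s, t]%classic) v :> R.
Proof.
move=> au vb /andP[uy yv] cs ct.
have uv : u < v by exact: lt_le_trans yv.
have ab : a <= b by apply: ltW; apply: le_lt_trans au (lt_le_trans uv vb).
rewrite !indicE; congr (_%:R); congr nat_of_bool.
apply/idP/idP; rewrite !inE/= !in_itv/= => /andP[h1 h2].
  rewrite (lt_le_trans h1 yv)/=.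
  have [//|tv] := leP v t.
  have ta : a <= t by apply: le_trans h2; apply: ltW; exact: le_lt_trans uy.
  have tb : t <= b by apply: ltW; exact: lt_le_trans tv vb.
  by move: ct; rewrite clamp_id ?ta//; lra.
rewrite (le_trans yv h2) andbT.
have [sa|sa] := leP s a; first by lra.
have sb : s <= b by lra.
by move: cs; rewrite clamp_id ?(ltW sa)//; lra.
Qed.

(** The right-hand side is the increment, from [u] to [v], of a single function independent of the
    cell; summed over consecutive cells it telescopes. *)
Lemma cell_increment (f : R -> R) s t a b u v : s <= t -> a <= u -> u <= v ->
  v <= b ->
  (clamp a b s <= u \/ v <= clamp a b s) ->
  (clamp a b t <= u \/ v <= clamp a b t) ->
  \1_(`]s, t]%classic) v * (f v - f u) =
  f (clamp (clamp a b s) (clamp a b t) v) - f (clamp (clamp a b s) (clamp a b t) u).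
Proof.
move=> st au uv vb cs ct.
have ab : a <= b by lra.
have [->|unv] := eqVneq u v; first by rewrite !subrr mulr0.
have {unv}uv' : u < v by rewrite lt_neqAle unv.
have s't' := clamp_mono ab st.
set s' := clamp a b s in cs s't' *; set t' := clamp a b t in ct s't' *.
have [sv|vs] := leP v s'.
  rewrite !clamp_le ?subrr//; last exact: ltW (lt_le_trans uv' sv).
  rewrite indicE memNset ?mul0r//= in_itv/= => /andP[h1 _].
  have [as_|sa] := leP a s; last by move: sv; rewrite /s' clamp_le ?(ltW sa)//; lra.
  have [sb|bs] := leP s b; last by lra.
  by move: sv; rewrite /s' clamp_id ?as_//; lra.
have su : s' <= u by case: cs => //; lra.
have sv1 : s < v.
  have [sa|as_] := leP s a; first by lra.
  have [sb|bs] := leP s b; last by move: vs; rewrite /s' clamp_ge ?(ltW bs)//; lra.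
  by move: vs; rewrite /s' clamp_id ?(ltW as_).
have [vt|tv] := leP v t'.
  rewrite !clamp_id ?(ltW vs) ?su//=; last by lra.
  rewrite indicE mem_set ?mul1r//= in_itv/= sv1/=.
  have [ta|at_] := leP t a; first by move: vt; rewrite /t' clamp_le//; lra.
  have [tb|bt] := leP t b; last by lra.
  by move: vt; rewrite /t' clamp_id ?(ltW at_).
have tu : t' <= u by case: ct => //; lra.
rewrite !clamp_ge ?subrr ?(ltW tv)//.
rewrite indicE memNset ?mul0r//= in_itv/= => /andP[_ h2].
have [ta|at_] := leP t a; first by lra.
have [tb|bt] := leP t b; last by move: tv; rewrite /t' clamp_ge ?(ltW bt)//; lra.
by move: tv; rewrite /t' clamp_id ?(ltW at_)//; lra.
Qed.

(** A subdivision of [[a, b]] adapted to [p]: no endpoint of a step, once projected on [[a, b]],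
    falls strictly inside a cell. *)
Definition grid_of (x : nat -> R) (m : nat) a b p : Prop :=
  [/\ x 0%N = a, x m = b, forall i, x i <= x i.+1 &
    forall q, q \in p -> forall i,
     (clamp a b q.2.1 <= x i \/ x i.+1 <= clamp a b q.2.1) /\
     (clamp a b q.2.2 <= x i \/ x i.+1 <= clamp a b q.2.2)].

Lemma exists_grid_of a b p : a <= b -> exists x m, grid_of x m a b p.
Proof.
move=> ab.
have [e|x [m [x0 xm xmono xe]]] := @exists_grid a b
  ([seq clamp a b q.2.1 | q <- p] ++ [seq clamp a b q.2.2 | q <- p]) ab.
  by rewrite mem_cat => /orP[] /mapP[q _ ->]; exact: clamp_itv.
exists x, m; split => // q qp i; split; apply: xe; rewrite mem_cat; apply/orP.
  by left; apply/mapP; exists q.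
by right; apply/mapP; exists q.
Qed.

Lemma grid_le x m a b p : grid_of x m a b p ->
  forall i j, (i <= j)%N -> x i <= x j.
Proof.
move=> [_ _ xmono _] i j.
elim: j => [|j IH]; first by rewrite leqn0 => /eqP->.
  by rewrite leq_eqVlt => /predU1P[->//|/IH/le_trans]; apply.
Qed.

(** The steps of [p] may overlap, so their increments are not independent of one another. Exchanging
    the sums regroups them over disjoint cells, where the coefficient is the value of the step
    function at the right end. *)
Lemma clamp_sum_grid (f : R -> R) x m a b p : a <= b -> wf_steps p ->
  grid_of x m a b p ->
  \sum_(q <- p) q.1 * (f (clamp a b q.2.2) - f (clamp a b q.2.1)) =
  \sum_(i < m) step_fun p (x i.+1) * (f (x i.+1) - f (x i)).
Proof.
move=> ab /allP wf g; have gle := grid_le g; case: g => x0 xm xmono xe.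
under [RHS]eq_bigr => i _ do rewrite /step_fun mulr_suml.
rewrite exchange_big/= big_seq [RHS]big_seq; apply: eq_bigr => q qp.
under eq_bigr => i _ do rewrite -mulrA.
rewrite -mulr_sumr; congr (_ * _).
pose k y := f (clamp (clamp a b q.2.1) (clamp a b q.2.2) y).
transitivity (\sum_(i < m) (k (x i.+1) - k (x i))).
  rewrite -(big_mkord xpredT (fun i => k (x i.+1) - k (x i))) telescope_sumr//.
  have s't' := clamp_mono ab (wf _ qp).
  have /andP[s1 s2] := clamp_itv q.2.1 ab; have /andP[t1 t2] := clamp_itv q.2.2 ab.
  by rewrite /k x0 xm (clamp_ge s't' t2) (clamp_le s't' s1).
apply: eq_bigr => i _; have [c1 c2] := xe _ qp i.
rewrite (@cell_increment f _ _ a b)//; first exact: wf.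
  by rewrite -x0; exact: gle.
by rewrite -xm; apply: gle; exact: ltn_ord.
Qed.

Lemma measurable_step_fun p : measurable_fun setT (step_fun p : R -> R).
Proof.
rewrite /step_fun; apply: measurable_sum => q.
by apply: measurable_funM => //; exact: measurable_indic.
Qed.

Lemma step_fun_cell x m a b p i y : grid_of x m a b p -> (i < m)%N ->
  x i < y <= x i.+1 -> step_fun p y = step_fun p (x i.+1).
Proof.
move=> g im xy; have gle := grid_le g; case: g => x0 xm xmono xe.
rewrite /step_fun big_seq [RHS]big_seq; apply: eq_bigr => q qp; congr (_ * _).
have [c1 c2] := xe _ qp i.
apply: (@cell_indic _ _ a b (x i)) => //.
  by rewrite -x0; exact: gle.
by rewrite -xm; apply: gle.
Qed.

Lemma integral_step_fun_grid (phi : R -> R) x m a b p :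
  grid_of x m a b p -> measurable_fun setT phi -> (forall y, 0 <= phi y) ->
  (\int[mu]_(y in `]a, b]) (phi (step_fun p y))%:E =
   (\sum_(i < m) phi (step_fun p (x i.+1)) * (x i.+1 - x i))%:E)%E.
Proof.
move=> g mphi phi0; have gle := grid_le g; case: (g) => x0 xm xmono xe.
rewrite -x0 -xm.
have mf : measurable_fun [set: R] (fun y => (phi (step_fun p y))%:E).
  apply/measurable_EFinP; apply: measurableT_comp mphi _.
  exact: measurable_step_fun.
suff key : forall k, (k <= m)%N -> (\int[mu]_(y in `]x 0%N, x k]) (phi (step_fun p y))%:E =
   (\sum_(i < k) phi (step_fun p (x i.+1)) * (x i.+1 - x i)%R)%:E)%E by exact: key.
elim=> [_|k IH km].
  by rewrite big_ord0 set_itvoc0 integral_set0.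
rewrite big_ord_recr/= EFinD -IH ?(ltnW km)//.
rewrite (@itv_bndbnd_setU _ _ _ (BRight (x k))); last 2 first.
- by rewrite bnd_simp gle.
- by rewrite bnd_simp gle.
rewrite ge0_integral_setU//=; last 3 first.
- exact: measurable_funTS.
- by move=> y _; rewrite lee_fin.
- apply/disj_setPS => y [/=]; rewrite !in_itv/= => /andP[_ h1] /andP[h2 _].
  by move: (lt_le_trans h2 h1); rewrite ltxx.
congr (_ + _)%E.
transitivity (\int[mu]_(y in `]x k, x k.+1]) (phi (step_fun p (x k.+1)))%:E)%E.
  apply: eq_integral => y; rewrite inE/= in_itv/= => hy.
  by rewrite (step_fun_cell g km hy).
rewrite integral_cst//= lebesgue_measure_itv/= lte_fin.
case: ltP => [h|h]; first by rewrite -EFinB -EFinM.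
have -> : x k.+1 = x k by apply/eqP; rewrite eq_le h xmono.
by rewrite subrr mulr0 mule0.
Qed.

End StepGrid.

(** * Splitting a step integral at a given time *)

Section StepIntegralSplit.
Context {disp : measure_display} {T : measurableType disp} {R : realType}.
Variable P : probability T R.
Variable nu : {measure set R -> \bar R}.
Variable L : R -> {RV P >-> R}.
Hypothesis hL : driving_levy nu L.
Notation mu := (@lebesgue_measure R).
Let K := second_moment_bound nu.

Definition step_int_before (t : R) (p : seq (R * (R * R))) (w : T) : R :=
  \sum_(q <- p) q.1 * (L (Num.min q.2.2 t) w - L (Num.min q.2.1 t) w).

Definition step_int_after (t : R) (p : seq (R * (R * R))) (w : T) : R :=
  \sum_(q <- p) q.1 * (L (Num.max q.2.2 t) w - L (Num.max q.2.1 t) w).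

Lemma step_int_split t p w :
  step_int L p w = step_int_before t p w + step_int_after t p w.
Proof.
rewrite /step_int -big_split/=; apply: eq_bigr => q _; rewrite -mulrDr.
congr (_ * _).
have h y : L y w = L (Num.min y t) w + L (Num.max y t) w - L t w.
  by case: (leP y t) => _; ring.
by rewrite [in LHS](h q.2.2) [in LHS](h q.2.1); ring.
Qed.

Lemma step_int_before_split a t p w : a <= t ->
  step_int_before t p w = step_int_before a p w +
  \sum_(q <- p) q.1 * (L (clamp a t q.2.2) w - L (clamp a t q.2.1) w).
Proof.
move=> at_; rewrite /step_int_before -big_split/=; apply: eq_bigr => q _.
rewrite -mulrDr; congr (_ * _).
have h y : L (Num.min y t) w = L (Num.min y a) w + L (clamp a t y) w - L a w.
  have [ya|ay] := leP y a.
    by rewrite clamp_le// min_l ?(le_trans ya)//; ring.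
  have [yt|ty] := leP y t.
    by rewrite clamp_id ?(ltW ay)//; ring.
  by rewrite clamp_ge ?(ltW ty)//; ring.
by rewrite [in LHS](h q.2.2) [in LHS](h q.2.1); ring.
Qed.

Lemma step_int_before_sigma_process t p :
  measurable_fun [set: g_sigma_algebraType
    (\bigcup_(r in [set r | r <= t]) preimage_set_system setT (L r) measurable)]
  (step_int_before t p : T -> R).
Proof.
apply: measurable_sum => q; apply: measurable_funM; first exact: measurable_cst.
have mLr r : r <= t -> measurable_fun [set: g_sigma_algebraType
    (\bigcup_(r in [set r | r <= t]) preimage_set_system setT (L r) measurable)]
    (L r : T -> R).
  by move=> rt _ B mB; rewrite setTI; exact: sigma_process_preimage.
by apply: measurable_funB; apply: mLr; rewrite ge_min lexx orbT.
Qed.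

Lemma step_int_before_past_filtration t p B : 0 <= t -> measurable B ->
  past_filtration P L t (step_int_before t p @^-1` B).
Proof.
move=> t0 mB; apply: sigma_process_past => //.
have := (@step_int_before_sigma_process t p) measurableT B mB.
by rewrite setTI; exact.
Qed.

Lemma step_int_before_past t p : past_measurable L t (step_int_before t p).
Proof.
apply/past_measurableP => B mB.
apply: sub_null_completion; first exact: sigma_process_measurable.
have := (@step_int_before_sigma_process t p) measurableT B mB.
by rewrite setTI; exact.
Qed.

(** The part of the integral before [a] is absorbed as an arbitrary past variable. Over []a, t]] the
    exponent is an integral of [cos_exponent], at least [l] on a set of length at least [rho]. *)
Lemma step_int_before_cf2 (a t theta kappa l rho : R) (p : seq (R * (R * R))) :
  0 <= a -> a <= t -> wf_steps p -> 0 <= l ->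
  (forall v, kappa <= `|v| -> l <= cos_exponent nu (theta * v)) ->
  (rho%:E <= \int[mu]_(y in `]a, t]) ((kappa <= `|step_fun p y|)%R%:R)%:E)%E ->
  cf2 P (step_int_before t p) theta <= expR (- (2 * (l * rho))).
Proof.
move=> a0 at_ wf l0 hl hrho.
have [x [m g]] := exists_grid_of p at_; case: (g) => x0 xm xmono _.
pose c i := step_fun p (x i.+1).
have xa : 0 <= x 0%N by rewrite x0.
have -> : step_int_before t p = fun w => step_int_before a p w + grid_sum L x c m w.
  apply/funext => w; rewrite (step_int_before_split p w at_); congr (_ + _).
  by rewrite (clamp_sum_grid (fun y => L y w) at_ wf g).
have mB : past_measurable L (x 0%N) (step_int_before a p).
  by rewrite x0; exact: step_int_before_past.
apply: (le_trans (cf2_grid_sum hL c xa xmono m theta mB)).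
rewrite ler_expR lerN2 ler_pM2l//.
pose phi (v : R) : R := (kappa <= `|v|)%R%:R.
have mphi : measurable_fun setT phi.
  have mb : measurable_fun [set: R] (fun v : R => kappa <= `|v|).
    by apply: measurable_fun_ler; [exact: measurable_cst|exact: normr_measurable].
  rewrite (_ : phi = fun v => if kappa <= `|v| then 1 else 0); last first.
    by apply/funext => v; rewrite /phi; case: ifP.
  exact: measurable_fun_ifT.
have phi0 v : 0 <= phi v by rewrite /phi.
move: hrho; rewrite (integral_step_fun_grid g mphi phi0) lee_fin => hrho.
apply: (@le_trans _ _ (l * \sum_(i < m) phi (c i) * (x i.+1 - x i))).
  by rewrite ler_wpM2l.
rewrite mulr_sumr; apply: ler_sum => i _.
rewrite mulrA mulrC ler_wpM2l ?subr_ge0//.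
rewrite /phi; case: (leP kappa) => [h|_]; first by rewrite mulr1 hl.
by rewrite mulr0 cos_exponent_ge0//; exact: driving_measure hL.
Qed.

Lemma step_int_after_grid t p : 0 <= t -> wf_steps p ->
  exists (x c : nat -> R) (m : nat), [/\ x 0%N = t, forall i, x i <= x i.+1,
    step_int_after t p = grid_sum L x c m &
    ((\sum_(i < m) c i ^+ 2 * (x i.+1 - x i))%:E <=
     \int[mu]_(y in `]t, +oo[) (step_fun p y ^+ 2)%:E)%E].
Proof.
move=> t0 wf.
(* With [M] beyond every endpoint, clamping to [[t, M]] is the same as taking the maximum with
   [t]. *)
pose M := foldr Num.max t [seq q.2.2 | q <- p].
have tM : t <= M.
  rewrite /M; elim: [seq q.2.2 | q <- p] => //= y s IH.
  by rewrite le_max IH orbT.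
have pM q : q \in p -> q.2.2 <= M.
  rewrite /M => /(map_f (fun q => q.2.2)); elim: [seq q.2.2 | q <- p] => //= y s IH.
  rewrite inE le_max => /predU1P[->|/IH->]; first by rewrite lexx.
  by rewrite orbT.
have [x [m g]] := exists_grid_of p tM; case: (g) => x0 xm xmono _.
exists x, (fun i => step_fun p (x i.+1)), m; split => //.
  apply/funext => w; rewrite /step_int_after /grid_sum.
  rewrite -(clamp_sum_grid (fun y => L y w) tM wf g).
  rewrite big_seq [RHS]big_seq; apply: eq_bigr => q qp.
  have q1 := allP wf _ qp; have q2 := pM _ qp.
  by rewrite /clamp !(min_l (_ : Num.max _ t <= M))// ge_max tM ?q2 ?(le_trans q1).
have mphi : measurable_fun [set: R] (fun v : R => v ^+ 2) by exact: measurable_funX.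
rewrite -(integral_step_fun_grid g mphi (fun y => sqr_ge0 y)).
apply: ge0_subset_integral => //.
- apply/measurable_EFinP; apply: measurable_funTS; apply: measurable_funX.
  exact: measurable_step_fun.
- by move=> y _; rewrite lee_fin sqr_ge0.
- by move=> y /=; rewrite !in_itv/= andbT => /andP[].
Qed.

Lemma step_int_after_second_moment t p (C : R) : 0 <= t -> wf_steps p ->
  (\int[mu]_(y in `]t, +oo[) (step_fun p y ^+ 2)%:E <= C%:E)%E ->
  P.-integrable setT (fun w => (step_int_after t p w ^+ 2)%:E) /\
  \int[P]_w (step_int_after t p w ^+ 2) <= K * C.
Proof.
move=> t0 wf hC.
have [x [c [m [x0 xmono -> hle]]]] := step_int_after_grid t0 wf.
have xa : 0 <= x 0%N by rewrite x0.
have [h1 h2] := grid_sum_second_moment hL c xa xmono m.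
split => //; apply: (le_trans h2); rewrite ler_wpM2l ?second_moment_bound_ge0//.
by rewrite -lee_fin (le_trans hle).
Qed.

Lemma step_int_after_mean0 t p (Z : T -> R) (M : R) : 0 <= t -> wf_steps p ->
  (forall B, measurable B -> past_filtration P L t (Z @^-1` B)) ->
  (forall w, `|Z w| <= M) ->
  \int[P]_w (Z w * step_int_after t p w) = 0.
Proof.
move=> t0 wf mZ ZM.
have h q : q \in p ->
    P.-integrable setT (fun w => (Z w * increment L (Num.max q.2.1 t) (Num.max q.2.2 t) w)%:E) /\
    \int[P]_w (Z w * increment L (Num.max q.2.1 t) (Num.max q.2.2 t) w) = 0.
  move=> qp; apply: (@past_filtration_increment_mean0 _ _ _ P nu L hL t _ _ M) => //.
    by rewrite le_max lexx orbT.
  by rewrite ge_max !le_max lexx orbT (allP wf _ qp).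
suff : P.-integrable setT (fun w => (Z w * step_int_after t p w)%:E) /\
  \int[P]_w (Z w * step_int_after t p w) = 0 by case.
have {wf h} : forall q, q \in p -> P.-integrable setT (fun w => (Z w * increment L (Num.max q.2.1 t) (Num.max q.2.2 t) w)%:E) /\
    \int[P]_w (Z w * increment L (Num.max q.2.1 t) (Num.max q.2.2 t) w) = 0 by [].
rewrite /step_int_after; elim: p => [_|q p IH h].
  rewrite (_ : (fun w => _) = cst 0%:E); last by apply/funext => w; rewrite big_nil mulr0.
  rewrite (_ : (fun w => _) = cst 0); last by apply/funext => w; rewrite big_nil mulr0.
  by split; [exact: finite_measure_integrable_cst|rewrite Rintegral_probability_cst].
have [|i1 e1] := IH; first by move=> q' q'p; apply: h; rewrite inE q'p orbT.
have [i2 e2] := h q (mem_head _ _).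
have i3 : P.-integrable setT (fun w => (q.1 * (Z w * increment L (Num.max q.2.1 t) (Num.max q.2.2 t) w))%:E).
  exact: (integrableZl measurableT _ i2).
have E : (fun w => Z w * \sum_(r <- q :: p) r.1 * (L (Num.max r.2.2 t) w - L (Num.max r.2.1 t) w)) =
  (fun w => q.1 * (Z w * increment L (Num.max q.2.1 t) (Num.max q.2.2 t) w)
     + Z w * \sum_(r <- p) r.1 * (L (Num.max r.2.2 t) w - L (Num.max r.2.1 t) w)).
  by apply/funext => w; rewrite big_cons mulrDr /increment; congr (_ + _); ring.
split.
  have := integrable_funD i3 i1.
  congr (P.-integrable _ _); apply/funext => w; congr (_%:E).
  exact: (esym (congr1 (@^~ w) E)).
by rewrite E RintegralD// e1 RintegralZl// e2 mulr0 addr0.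
Qed.

End StepIntegralSplit.

(** * Stopped transforms of discrete semimartingales *)

Section DiscreteSemimartingale.
Context {disp : measure_display} {T : measurableType disp} {R : realType}.
Variable P : probability T R.
Local Notation integ X := (P.-integrable setT (EFin \o (X : T -> R))).

Lemma integ_boundedM (Z X : T -> R) (M : R) : measurable_fun setT Z ->
  (forall w, `|Z w| <= M) -> integ X -> integ (fun w => Z w * X w).
Proof.
move=> mZ ZM iX.
have mX : measurable_fun setT X by move/integrableP : iX => [/measurable_EFinP].
apply: (@le_integrable _ _ _ P setT measurableT _ (fun w => (M * X w)%:E)).
- by apply/measurable_EFinP; exact: measurable_funM.
- move=> w _; rewrite lee_fin !normrM ler_wpM2r//.
  exact: (le_trans (ZM w) (ler_norm _)).
- exact: (integrableZl measurableT _ iX).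
Qed.

Lemma indic_norm_le (C : set T) w : `|\1_C w| <= 1 :> R.
Proof. by rewrite indicE; case: (w \in C); rewrite ?normr1 ?normr0. Qed.

Lemma indic_ge0 (C : set T) w : 0 <= \1_C w :> R.
Proof. by rewrite indicE. Qed.

Lemma indic_le1 (C : set T) w : \1_C w <= 1 :> R.
Proof. by rewrite indicE; case: (w \in C). Qed.

Lemma integ_indic (C : set T) X : measurable C -> integ X ->
  integ (fun w => \1_C w * X w).
Proof.
move=> mC iX; apply: integ_boundedM iX; first exact: measurable_indic.
exact: indic_norm_le.
Qed.

Lemma Rintegral_indic (C : set T) : measurable C ->
  \int[P]_w (\1_C w) = fine (P C).
Proof. by move=> mC; rewrite /Rintegral integral_indic// setIT. Qed.

Lemma Rintegral_indicM (C : set T) X : measurable C ->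
  \int[P]_w (\1_C w * X w) = \int[P]_(w in C) X w.
Proof.
move=> mC; rewrite [RHS]Rintegral_mkcond; apply: eq_Rintegral => w _.
by rewrite patchE indicE; case: ifP => _; rewrite ?mul1r ?mul0r.
Qed.

Lemma integ_sum (m : nat) (X : nat -> T -> R) :
  (forall i, (i < m)%N -> integ (X i)) -> integ (fun w => \sum_(i < m) X i w).
Proof.
elim: m => [_|m IH h].
  rewrite (_ : (fun w => _) = cst 0); last by apply/funext => w; rewrite big_ord0.
  exact: finite_measure_integrable_cst.
rewrite (_ : (fun w => _) = (fun w => \sum_(i < m) X i w + X m w)).
  apply: integrable_funD; last exact: h.
  by apply: IH => i im; apply: h; exact: ltnW.
by apply/funext => w; rewrite big_ord_recr.
Qed.

Lemma Rintegral_sum (m : nat) (X : nat -> T -> R) :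
  (forall i, (i < m)%N -> integ (X i)) ->
  \int[P]_w (\sum_(i < m) X i w) = \sum_(i < m) \int[P]_w X i w.
Proof.
elim: m => [_|m IH h].
  rewrite big_ord0 (_ : (fun w => _) = cst 0) ?Rintegral_probability_cst//.
  by apply/funext => w; rewrite big_ord0.
have hm i : (i < m)%N -> integ (X i) by move=> im; apply: h; exact: ltnW.
rewrite big_ord_recr/= -IH//.
rewrite (_ : (fun w => _) = (fun w => \sum_(i < m) X i w + X m w)).
  by rewrite RintegralD//; [exact: integ_sum|exact: h].
by apply/funext => w; rewrite big_ord_recr.
Qed.

Section Core.
Variables (F : nat -> set (set T)) (n : nat).
Hypothesis Fsigma : forall i, sigma_algebra setT (F i).
Hypothesis Fmeas : forall i, F i `<=` measurable.
Hypothesis Fmono : forall i j, (i <= j)%N -> F i `<=` F j.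

Lemma filtrationI i A B : F i A -> F i B -> F i (A `&` B).
Proof.
move=> hA hB; pose S := g_sigma_algebraType (F i).
have E := sigma_algebra_id (Fsigma i).
have hA' : <<s F i >> A by rewrite E.
have hB' : <<s F i >> B by rewrite E.
have : <<s F i >> (A `&` B) by exact: (@measurableI _ S A B hA' hB').
by rewrite E.
Qed.

Lemma filtrationC i A : F i A -> F i (~` A).
Proof. by move=> hA; rewrite -setTD; case: (Fsigma i) => _ + _; apply. Qed.

Lemma filtrationD i A B : F i A -> F i B -> F i (A `\` B).
Proof. by move=> hA hB; rewrite setDE; apply: filtrationI => //; exact: filtrationC. Qed.

Variable N : nat -> T -> R.
Hypothesis Nadapt : forall i B, measurable B -> F i (N i @^-1` B).
Hypothesis Nint : forall i, integ (N i).
Hypothesis Nmart : forall i j A, (i <= j)%N -> F i A ->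
  (\int[P]_(w in A) (N j w)%:E = \int[P]_(w in A) (N i w)%:E)%E.

Lemma martingale_indic i j C : (i <= j)%N -> F i C ->
  \int[P]_w (\1_C w * N j w) = \int[P]_w (\1_C w * N i w).
Proof.
by move=> ij FC; have mC := Fmeas FC; rewrite !Rintegral_indicM// /Rintegral (Nmart ij FC).
Qed.

Lemma integ_normN i : integ (fun w => `|N i w|).
Proof. exact: (integrable_norm (Nint i)). Qed.

(** The sign of [N i] is known at time [i], so [C] can be split by it. On each piece the martingale
    identity replaces [N i] by [N j], and a sign times [N j] is at most [|N j|]. *)
Lemma submartingale_norm i j C : (i <= j)%N -> F i C ->
  \int[P]_w (\1_C w * `|N i w|) <= \int[P]_w (\1_C w * `|N j w|).
Proof.
move=> ij FC; have mC := Fmeas FC.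
pose Q := N i @^-1` `[0, +oo[.
have FQ : F i Q by exact: Nadapt.
pose C1 := C `&` Q; pose C2 := C `\` Q.
have F1 : F i C1 by exact: filtrationI.
have F2 : F i C2 by exact: filtrationD.
have m1 := Fmeas F1; have m2 := Fmeas F2.
have inQ w : (w \in Q) = (0 <= N i w).
  by apply/idP/idP; rewrite inE /Q/= in_itv/= andbT.
have E : (fun w => \1_C w * `|N i w|) = (fun w => \1_C1 w * N i w - \1_C2 w * N i w).
  apply/funext => w; rewrite !indicE /C1 /C2 in_setI in_setD inQ.
  case: (w \in C) => /=; last by rewrite !mul0r subr0.
  case: leP => h /=; first by rewrite ger0_norm// !mul1r mul0r subr0.
  by rewrite ltr0_norm// !mul1r mul0r sub0r.
rewrite E RintegralB//; try exact: integ_indic.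
rewrite -(martingale_indic ij F1) -(martingale_indic ij F2).
rewrite -RintegralB//; try exact: integ_indic.
apply: le_Rintegral => //.
- by have := integrableB measurableT (integ_indic m1 (Nint j)) (integ_indic m2 (Nint j)).
- exact: integ_indic (integ_normN j).
- move=> w _; rewrite !indicE /C1 /C2 in_setI in_setD.
  case: (w \in C) => /=; last by rewrite !mul0r subr0.
  case: (w \in Q) => /=; rewrite !mul1r mul0r ?subr0 ?sub0r ?ler_norm//.
  by rewrite -normrN ler_norm.
Qed.

Variables (E : nat -> set T) (K : R).
Hypothesis FE : forall i, F i (E i).
Hypothesis Emono : forall i, E i.+1 `<=` E i.
Hypothesis EN : forall i w, (i <= n)%N -> E i w -> `|N i w| <= K.
Hypothesis K0 : 0 <= K.

Let mE i : measurable (E i). Proof. exact: Fmeas (FE i). Qed.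

(** As [E] decreases, this is the indicator of leaving [E] between [i] and [i.+1]; the difference
    form makes the sum over [i] telescope. *)
Definition exit_indic i (w : T) : R := \1_(E i) w - \1_(E i.+1) w.

Lemma exit_indicE i w : exit_indic i w = \1_(E i `\` E i.+1) w.
Proof.
rewrite /exit_indic !indicE in_setD.
have h : w \in E i.+1 -> w \in E i by rewrite !inE; exact: Emono.
case: (boolP (w \in E i.+1)) => [/h ->|_]; first by rewrite subrr andbF.
by rewrite subr0 andbT.
Qed.

Lemma exit_indic_ge0 i w : 0 <= exit_indic i w.
Proof. by rewrite exit_indicE indic_ge0. Qed.

Lemma exit_indic_le1 i w : `|exit_indic i w| <= 1.
Proof. by rewrite exit_indicE; exact: indic_norm_le. Qed.

Lemma measurable_exit_indic i : measurable_fun setT (exit_indic i).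
Proof. by apply: measurable_funB; exact: measurable_indic. Qed.

Lemma sum_exit_indic_le1 w : \sum_(i < n) exit_indic i w <= 1.
Proof.
have -> : \sum_(i < n) exit_indic i w = \1_(E 0%N) w - \1_(E n) w.
  rewrite -(big_mkord xpredT (exit_indic^~ w)) -[RHS]opprB.
  rewrite -(telescope_sumr (fun i => \1_(E i) w : R) (leq0n n)) -sumrN.
  by apply: eq_bigr => i _; rewrite opprB.
by have := indic_le1 (E 0%N) w; have := indic_ge0 (E n) w; lra.
Qed.

(* Stopping at the exit from [E] one step early costs only the exit term. *)
Lemma stopped_transform_norm (H X : nat -> T -> R) :
  (forall i, measurable_fun setT (H i)) -> (forall i w, `|H i w| <= 1) ->
  (forall i, (i < n)%N -> integ (X i)) ->
  (forall i, (i < n)%N -> \int[P]_w (\1_(E i) w * H i w * X i w) = 0) ->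
  `|\sum_(i < n) \int[P]_w (\1_(E i.+1) w * H i w * X i w)| <=
  \sum_(i < n) \int[P]_w (exit_indic i w * `|X i w|).
Proof.
move=> mH H1 iX X0.
apply: (le_trans (ler_norm_sum _ _ _)); apply: ler_sum => i _.
have iXi := iX i (ltn_ord i).
have mH' j : measurable_fun setT (fun w => \1_(E j) w * H i w : R).
  by apply: measurable_funM => //; exact: measurable_indic.
have H1' j w : `|\1_(E j) w * H i w| <= 1.
  by rewrite normrM -[leRHS]mulr1; apply: ler_pM => //; exact: indic_norm_le.
have i1 j : integ (fun w => \1_(E j) w * H i w * X i w).
  exact: (integ_boundedM (mH' j) (H1' j) iXi).
have -> : \int[P]_w (\1_(E i.+1) w * H i w * X i w) =
    - \int[P]_w (exit_indic i w * H i w * X i w).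
  rewrite (_ : (fun w => exit_indic i w * H i w * X i w) =
     (fun w => \1_(E i) w * H i w * X i w - \1_(E i.+1) w * H i w * X i w)).
    by rewrite RintegralB// X0// sub0r opprK.
  by apply/funext => w; rewrite /exit_indic; ring.
rewrite normrN.
have i2 : integ (fun w => exit_indic i w * H i w * X i w).
  have mexH : measurable_fun setT (fun w => exit_indic i w * H i w).
    by apply: measurable_funM => //; exact: measurable_exit_indic.
  apply: (@integ_boundedM (fun w => exit_indic i w * H i w) (X i) 1 mexH _ iXi) => w.
  by rewrite normrM -[leRHS]mulr1; apply: ler_pM => //; exact: exit_indic_le1.
apply: (le_trans (le_normr_Rintegral measurableT i2)).
apply: le_Rintegral => //.
- exact: (integrable_norm i2).
- apply: (integ_boundedM (measurable_exit_indic i) (exit_indic_le1 i)).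
  exact: (integrable_norm iXi).
- move=> w _; rewrite !normrM (ger0_norm (exit_indic_ge0 i w)).
  by rewrite ler_wpM2r// ler_piMr// exit_indic_ge0.
Qed.

Lemma integ_exit i X : integ X -> integ (fun w => exit_indic i w * X w).
Proof.
by move=> iX; exact: (integ_boundedM (measurable_exit_indic i) (exit_indic_le1 i)).
Qed.

Lemma sum_exit_le (Y : T -> R) : integ Y -> (forall w, 0 <= Y w) ->
  \sum_(i < n) \int[P]_w (exit_indic i w * Y w) <= \int[P]_w Y w.
Proof.
move=> iY Y0; rewrite -(Rintegral_sum (X := fun i w => exit_indic i w * Y w)); last first.
  by move=> i _; exact: integ_exit.
apply: le_Rintegral => //.
  by apply: (integ_sum (X := fun i w => exit_indic i w * Y w)) => i _; exact: integ_exit.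
by move=> w _; rewrite -mulr_suml ler_piMl// sum_exit_indic_le1.
Qed.

(** Only exit steps count, and there [|N i.+1 - N i| <= K + |N i.+1|]. The exit event is known at
    time [i.+1], so in mean [|N i.+1|] may be replaced by [|N n|]; the exit events are disjoint. No
    second moment is involved. *)
Lemma martingale_transform_bound (Cp Cm : nat -> set T) :
  (forall i, F i (Cp i)) -> (forall i, F i (Cm i)) ->
  `|\sum_(i < n) \int[P]_w (\1_(E i.+1) w * (\1_(Cp i) w - \1_(Cm i) w)
      * (N i.+1 w - N i w))| <= K + \int[P]_w `|N n w|.
Proof.
move=> Fp Fm.
pose H i w : R := \1_(Cp i) w - \1_(Cm i) w.
have mH i : measurable_fun setT (H i).
  by apply: measurable_funB; apply: measurable_indic; exact: Fmeas.
have H1 i w : `|H i w| <= 1.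
  have := indic_ge0 (Cp i) w; have := indic_ge0 (Cm i) w.
  have := indic_le1 (Cp i) w; have := indic_le1 (Cm i) w.
  by rewrite /H ler_norml; move=> *; apply/andP; split; lra.
have iD i : integ (fun w => N i.+1 w - N i w).
  by have := integrableB measurableT (Nint i.+1) (Nint i).
have D0 i : \int[P]_w (\1_(E i) w * H i w * (N i.+1 w - N i w)) = 0.
  have z C : F i C -> integ (fun w => \1_C w * (N i.+1 w - N i w)) /\
      \int[P]_w (\1_C w * (N i.+1 w - N i w)) = 0.
    move=> FC; have mC := Fmeas FC; split; first exact: integ_indic.
    rewrite (_ : (fun w => _) = (fun w => \1_C w * N i.+1 w - \1_C w * N i w)).
      rewrite RintegralB//; try exact: integ_indic.
      by rewrite (martingale_indic (leqnSn i) FC) subrr.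
    by apply/funext => w; ring.
  have [ip ep] := z _ (filtrationI (FE i) (Fp i)).
  have [im em] := z _ (filtrationI (FE i) (Fm i)).
  rewrite (_ : (fun w => _) = (fun w => \1_(E i `&` Cp i) w * (N i.+1 w - N i w)
     - \1_(E i `&` Cm i) w * (N i.+1 w - N i w))).
    by rewrite RintegralB// ep em subrr.
  by apply/funext => w; rewrite !indicI/= /H; ring.
apply: (le_trans (@stopped_transform_norm H (fun i w => N i.+1 w - N i w) mH H1
  (fun i _ => iD i) (fun i _ => D0 i))).
apply: (@le_trans _ _ (\sum_(i < n) (\int[P]_w (exit_indic i w * cst K w)
   + \int[P]_w (exit_indic i w * `|N n w|)))); last first.
  rewrite big_split/= lerD//.
    apply: (le_trans (@sum_exit_le (cst K) _ _)) => //.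
      exact: finite_measure_integrable_cst.
    by rewrite Rintegral_probability_cst.
  by apply: sum_exit_le => //; exact: integ_normN.
apply: ler_sum => i _.
have iK : integ (fun w => exit_indic i w * cst K w).
  by apply: integ_exit; exact: finite_measure_integrable_cst.
apply: (@le_trans _ _ (\int[P]_w (exit_indic i w * cst K w)
   + \int[P]_w (exit_indic i w * `|N i.+1 w|))).
  rewrite -RintegralD//; last exact: integ_exit (integ_normN _).
  apply: le_Rintegral => //.
  - by apply: integ_exit; exact: (integrable_norm (iD i)).
  - exact: integrable_funD iK (integ_exit i (integ_normN i.+1)).
  - move=> w _; rewrite -mulrDr exit_indicE indicE.
    case: (boolP (_ \in _)); rewrite ?mul0r// !mul1r inE => -[Ei _] /=.
    have := EN (ltnW (ltn_ord i)) Ei; have := ler_normB (N i.+1 w) (N i w).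
    lra.
rewrite lerD2l.
have FD : F i.+1 (E i `\` E i.+1).
  by apply: filtrationD => //; exact: Fmono (leqnSn i) _ (FE i).
have := submartingale_norm (ltn_ord i) FD.
have h X : \int[P]_w (\1_(E i `\` E i.+1) w * X w) = \int[P]_w (exit_indic i w * X w).
  by apply: eq_Rintegral => w _; rewrite exit_indicE.
by rewrite !h.
Qed.

(** At exit steps use [|x| <= c + x ^+ 2 / c]. The constant is counted once in all, the exits being
    disjoint, while the squares are summed over every step; [c] is left free for balancing the
    two. *)
Lemma noise_transform_bound (H X : nat -> T -> R) (c C : R) : 0 < c ->
  (forall i, measurable_fun setT (H i)) -> (forall i w, `|H i w| <= 1) ->
  (forall i, (i < n)%N -> integ (X i)) ->
  (forall i, (i < n)%N -> integ (fun w => X i w ^+ 2)) ->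
  (forall i, (i < n)%N -> \int[P]_w (\1_(E i) w * H i w * X i w) = 0) ->
  (forall i, (i < n)%N -> \int[P]_w (X i w ^+ 2) <= C) ->
  `|\sum_(i < n) \int[P]_w (\1_(E i.+1) w * H i w * X i w)| <=
  c + c^-1 * (n%:R * C).
Proof.
move=> c0 mH H1 iX iX2 X0 XC.
apply: (le_trans (stopped_transform_norm mH H1 iX X0)).
have ic i : integ (fun w => exit_indic i w * cst c w).
  by apply: integ_exit; exact: finite_measure_integrable_cst.
apply: (@le_trans _ _ (\sum_(i < n) (\int[P]_w (exit_indic i w * cst c w)
   + c^-1 * \int[P]_w (X i w ^+ 2)))).
  apply: ler_sum => i _.
  have iX2i := iX2 i (ltn_ord i).
  have i3 : integ (fun w => c^-1 * X i w ^+ 2).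
    exact: (integrableZl measurableT _ iX2i).
  rewrite -RintegralZl// -RintegralD//.
  apply: le_Rintegral => //.
  - apply: integ_exit; exact: (integrable_norm (iX i (ltn_ord i))).
  - exact: integrable_funD (ic i) i3.
  - move=> w _; rewrite exit_indicE indicE.
    have z0 : 0 <= `|X i w| by [].
    rewrite -[X in _ <= _ + _ * X]real_normK ?num_real//; set z := `|X i w| in z0 *.
    have h0 : 0 <= c^-1 * z ^+ 2 by rewrite mulr_ge0 ?sqr_ge0// invr_ge0 ltW.
    case: (_ \in _); rewrite ?mul1r ?mul0r ?add0r//=.
    have : 0 <= c^-1 * (z - c) ^+ 2.
      by rewrite mulr_ge0 ?sqr_ge0// invr_ge0 ltW.
    have -> : c^-1 * (z - c) ^+ 2 = c^-1 * z ^+ 2 - 2 * z + c.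
      by field; rewrite gt_eqF.
    lra.
rewrite big_split/= lerD//.
  apply: (le_trans (@sum_exit_le (cst c) _ _)).
  - exact: finite_measure_integrable_cst.
  - by move=> w; exact: ltW.
  - by rewrite Rintegral_probability_cst.
rewrite -mulr_sumr ler_wpM2l ?invr_ge0 ?(ltW c0)//.
apply: (@le_trans _ _ (\sum_(i < n) C)).
  by apply: ler_sum => i _; exact: XC.
by rewrite sumr_const card_ord mulr_natl.
Qed.

End Core.

Section DoobInequality.
Variables (F : nat -> set (set T)) (n : nat).
Hypothesis Fsigma : forall i, sigma_algebra setT (F i).
Hypothesis Fmeas : forall i, F i `<=` measurable.
Hypothesis Fmono : forall i j, (i <= j)%N -> F i `<=` F j.
Variable N : nat -> T -> R.
Hypothesis Nadapt : forall i B, measurable B -> F i (N i @^-1` B).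
Hypothesis Nint : forall i, integ (N i).
Hypothesis Nmart : forall i j A, (i <= j)%N -> F i A ->
  (\int[P]_(w in A) (N j w)%:E = \int[P]_(w in A) (N i w)%:E)%E.

(** The strict bound [j < i] makes level 0 the sure event, at the price of a shift: [below K i.+1]
    is the event known at time [i]. *)
Definition below (K : R) (i : nat) : set T :=
  [set w | forall j, (j < i)%N -> `|N j w| <= K].

Lemma belowS K i : below K i.+1 = below K i `&` N i @^-1` `[- K, K].
Proof.
apply/seteqP; split => w /=.
  move=> h; split; first by move=> j ji; apply: h; exact: ltnW.
  by rewrite in_itv/= -ler_norml; exact: h.
move=> [h1]; rewrite in_itv/= -ler_norml => h2 j; rewrite ltnS leq_eqVlt.
by move=> /predU1P[->//|]; exact: h1.
Qed.

Lemma below_filtration K i : F i (below K i.+1).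
Proof.
elim: i => [|i IH]; rewrite belowS; apply: (filtrationI Fsigma); try exact: Nadapt.
  rewrite (_ : below K 0 = setT); last by apply/seteqP; split.
  rewrite -setC0; apply: (filtrationC Fsigma).
  by case: (Fsigma 0).
exact: (Fmono (leqnSn i)).
Qed.

(** Doob's maximal inequality, read on the complementary event: [D i] says that [|N|] exceeds [K] at
    time [i] for the first time, and these events are disjoint. *)
Lemma doob_below K : 0 < K ->
  1 - (\int[P]_w `|N n w|) / K <= fine (P (below K n.+1)).
Proof.
move=> K0.
have b0 : below K 0 = setT by apply/seteqP; split.
have mb i : measurable (below K i).
  by case: i => [|i]; [rewrite b0|exact: Fmeas (below_filtration K i)].
pose D i := below K i `\` below K i.+1.
have FD i : F i (D i).
  apply: (filtrationD Fsigma) (below_filtration K i).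
  case: i => [|i]; last exact: (Fmono (leqnSn i) (below_filtration K i)).
  by rewrite b0 -setC0; apply: (filtrationC Fsigma); case: (Fsigma 0).
have iN := fun i => integrable_norm (Nint i).
have step i : (i <= n)%N ->
    K * \int[P]_w (\1_(D i) w) <= \int[P]_w (\1_(D i) w * `|N n w|).
  move=> iln; have mD := Fmeas (FD i).
  apply: (le_trans _ (submartingale_norm Fsigma Fmeas Nadapt Nint Nmart iln (FD i))).
  have i1 : integ (\1_(D i) : T -> R).
    by apply: (@bounded_integrable _ _ _ P _ 1) => //; exact: indic_norm_le.
  rewrite -RintegralZl//.
  apply: le_Rintegral => //.
  - exact: (integrableZl measurableT K i1).
  - exact: integ_indic (iN i).
  - move=> w _; rewrite indicE; case: (boolP (w \in D i)); rewrite ?mulr0 ?mul0r//.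
    rewrite inE mulr1 mul1r => -[h1 h2].
    have [h|h] := leP K `|N i w|; first by [].
    exfalso; apply: h2; rewrite belowS; split => //=.
    by rewrite in_itv/= -ler_norml ltW.
have sumD w : \sum_(i < n.+1) \1_(D i) w = 1 - \1_(below K n.+1) w :> R.
  have E i : \1_(D i) w = \1_(below K i) w - \1_(below K i.+1) w :> R.
    rewrite !indicE in_setD.
    have h : w \in below K i.+1 -> w \in below K i by rewrite !inE belowS => -[].
    case: (boolP (w \in below K i.+1)) => [/h ->|_]; first by rewrite subrr andbF.
    by rewrite subr0 andbT.
  rewrite (eq_bigr (fun i : 'I_n.+1 => \1_(below K i) w - \1_(below K i.+1) w)
    (fun i _ => E i)).
  rewrite -(big_mkord xpredT (fun i => \1_(below K i) w - \1_(below K i.+1) w)).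
  elim: n => [|k IH]; first by rewrite big_nat1 b0 indicT.
  by rewrite big_nat_recr//= IH; ring.
have iD i : integ (\1_(D i) : T -> R).
  apply: (@bounded_integrable _ _ _ P _ 1); last exact: indic_norm_le.
  exact: measurable_indic (Fmeas (FD i)).
have h1 : K * (1 - fine (P (below K n.+1))) <= \int[P]_w `|N n w|.
  have -> : 1 - fine (P (below K n.+1)) = \sum_(i < n.+1) \int[P]_w (\1_(D i) w).
    rewrite -(Rintegral_sum (X := fun i => \1_(D i) : T -> R))//.
    rewrite (_ : (fun w => _) = (fun w => 1 - \1_(below K n.+1) w)); last first.
      by apply/funext => w; exact: sumD.
    rewrite RintegralB//; last 2 first.
    - exact: finite_measure_integrable_cst.
    - apply: (@bounded_integrable _ _ _ P _ 1); last exact: indic_norm_le.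
      exact: measurable_indic.
    by rewrite Rintegral_probability_cst Rintegral_indic.
  rewrite mulr_sumr.
  apply: (@le_trans _ _ (\sum_(i < n.+1) \int[P]_w (\1_(D i) w * `|N n w|))).
    by apply: ler_sum => i _; apply: step; rewrite -ltnS.
  have iDN i : integ (fun w => \1_(D i) w * `|N n w|).
    exact: (integ_indic (Fmeas (FD i)) (iN n)).
  rewrite -(Rintegral_sum (X := fun i w => \1_(D i) w * `|N n w|))//.
  apply: le_Rintegral => //.
    exact: (@integ_sum n.+1 (fun i w => \1_(D i) w * `|N n w|) (fun i _ => iDN i)).
    exact: (iN n).
  by move=> w _; rewrite -mulr_suml sumD ler_piMl// lerBlDr lerDl indic_ge0.
rewrite lerBlDr -lerBlDl ler_pdivlMr// mulrC.
exact: h1.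
Qed.

End DoobInequality.
End DiscreteSemimartingale.

(** * One step of the moving average *)

Section Approximation.
Context {disp : measure_display} {T : measurableType disp} {R : realType}.
Variable P : probability T R.
Notation mu := (@lebesgue_measure R).

Lemma ereal_cvg0_lt (u : nat -> \bar R) (e : R) :
  (u @ \oo --> 0)%E -> 0 < e -> \forall n \near \oo, (u n < e%:E)%E.
Proof.
move=> u0 e0; apply: (u0 [set x | (x < e%:E)%E]).
by apply: open_nbhs_nbhs; split; [exact: open_ereal_lt_ereal|rewrite /= lte_fin].
Qed.

Lemma integral_sqrB_le d' (U : measurableType d')
    (m : {measure set U -> \bar R}) (f g : U -> R) (a b : R) :
  measurable_fun setT f -> measurable_fun setT g ->
  (\int[m]_x (f x ^+ 2)%:E <= a%:E)%E -> (\int[m]_x (g x ^+ 2)%:E <= b%:E)%E ->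
  (\int[m]_x ((f x - g x) ^+ 2)%:E <= (2 * a + 2 * b)%:E)%E.
Proof.
move=> mf mg fa gb.
have m2 (k : U -> R) : measurable_fun setT k ->
    measurable_fun setT (fun x => (2 * k x ^+ 2)%:E).
  move=> mk; apply/measurable_EFinP; apply: measurable_funM => //.
  exact: measurable_funX.
apply: (@le_trans _ _ (\int[m]_x ((2 * f x ^+ 2)%:E + (2 * g x ^+ 2)%:E))%E).
  apply: ge0_le_integral => //.
  - by move=> x _; rewrite lee_fin sqr_ge0.
  - by apply/measurable_EFinP; apply: measurable_funX; exact: measurable_funB.
  - by apply: emeasurable_funD; exact: m2.
  - move=> x _; rewrite -EFinD lee_fin.
    by have := sqr_ge0 (f x + g x); nra.
rewrite ge0_integralD//; try by move=> x _; rewrite lee_fin mulr_ge0// sqr_ge0.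
- rewrite EFinD; apply: leeD.
    under eq_integral do rewrite EFinM.
    rewrite ge0_integralZl//; first by rewrite EFinM lee_pmul2l ?lte_fin.
      by apply/measurable_EFinP; exact: measurable_funX.
    by move=> x _; rewrite lee_fin sqr_ge0.
  under eq_integral do rewrite EFinM.
  rewrite ge0_integralZl//; first by rewrite EFinM lee_pmul2l ?lte_fin.
    by apply/measurable_EFinP; exact: measurable_funX.
  by move=> x _; rewrite lee_fin sqr_ge0.
- exact: m2.
- exact: m2.
Qed.

Definition oppose_steps (p : seq (R * (R * R))) := [seq (- q.1, q.2) | q <- p].

Lemma step_fun_sub p1 p2 x :
  step_fun (p1 ++ oppose_steps p2) x = step_fun p1 x - step_fun p2 x.
Proof.
rewrite /step_fun big_cat/= big_map/=; congr (_ + _).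
by rewrite -sumrN; apply: eq_bigr => q _; rewrite mulNr.
Qed.

Lemma step_int_sub (L : R -> T -> R) p1 p2 w :
  step_int L (p1 ++ oppose_steps p2) w = step_int L p1 w - step_int L p2 w.
Proof.
rewrite /step_int big_cat/= big_map/=; congr (_ + _).
by rewrite -sumrN; apply: eq_bigr => q _; rewrite mulNr.
Qed.

Lemma measurable_step_int (L : R -> {RV P >-> R}) p :
  measurable_fun setT (step_int L p).
Proof.
apply: measurable_sum => q; apply: measurable_funM => //.
exact: measurable_funB.
Qed.

Variables (L : R -> {RV P >-> R}) (d : R) (k : R -> R -> R).
Variable S : R -> {RV P >-> R}.
Hypothesis hS : levy_moving_average L d k S.
Let G := Gamma (1 + d).
Hypothesis G0 : 0 < G.

Lemma moving_average_measurable t : measurable_fun setT (k t).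
Proof. by have [Y [[mk _ _] _]] := hS t. Qed.

(** The same step function has to serve in [L^2(R)] and in [L^2(P)], so both convergences of the
    defining sequence are read at a common index. The tolerance [e / 4] comes from
    [(x - y) ^+ 2 <= 2 * x ^+ 2 + 2 * y ^+ 2]. *)
Lemma moving_average_approx u v (e : R) : 0 < e ->
  exists p, [/\ wf_steps p,
    (\int[mu]_x ((step_fun p x - (k v x - k u x)) ^+ 2)%:E <= e%:E)%E &
    (\int[P]_w ((G * (S v w - S u w) - step_int L p w) ^+ 2)%:E <= e%:E)%E].
Proof.
move=> e0.
have e4 : 0 < e / 4 by rewrite divr_gt0.
have one t : exists p (Y : {RV P >-> R}), [/\ wf_steps p,
    (\int[mu]_x ((step_fun p x - k t x) ^+ 2)%:E <= (e / 4)%:E)%E,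
    (\int[P]_w ((step_int L p w - Y w) ^+ 2)%:E <= (e / 4)%:E)%E &
    {ae P, forall w, S t w = G^-1 * Y w}].
  have [Y [[mk _ [phi [wf c1 c2]]] ae]] := hS t.
  have [n [h1 h2]] := filter_ex (filterI (ereal_cvg0_lt c1 e4) (ereal_cvg0_lt c2 e4)).
  by exists (phi n), Y; split => //; exact: ltW.
have [p1 [Y1 [wf1 f1 i1 a1]]] := one v.
have [p2 [Y2 [wf2 f2 i2 a2]]] := one u.
have ee : e = 2 * (e / 4) + 2 * (e / 4) by field.
exists (p1 ++ oppose_steps p2); split.
- rewrite /wf_steps all_cat; apply/andP; split; first exact: wf1.
  by rewrite all_map; apply/allP => q qp /=; exact: (allP wf2 _ qp).
- rewrite ee.
  have mm (p : seq (R * (R * R))) t : measurable_fun setT (fun x => step_fun p x - k t x).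
    by apply: measurable_funB; [exact: measurable_step_fun|exact: moving_average_measurable].
  have := @integral_sqrB_le _ _ mu _ _ _ _ (mm p1 v) (mm p2 u) f1 f2.
  apply: le_trans; rewrite le_eqVlt; apply/orP; left; apply/eqP/esym.
  apply: eq_integral => x _; congr (_%:E); rewrite step_fun_sub.
  by congr (_ ^+ 2); ring.
- rewrite ee.
  have mm (p : seq (R * (R * R))) (Y : {RV P >-> R}) :
      measurable_fun setT (fun x => step_int L p x - Y x).
    by apply: measurable_funB => //; exact: measurable_step_int.
  have := @integral_sqrB_le _ _ P _ _ _ _ (mm p1 Y1) (mm p2 Y2) i1 i2.
  apply: le_trans; rewrite le_eqVlt; apply/orP; left; apply/eqP/esym.
  apply: ae_eq_integral => //.
  + apply/measurable_EFinP; apply: measurable_funX.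
    by apply: measurable_funB; exact: mm.
  + apply/measurable_EFinP; apply: measurable_funX.
    apply: measurable_funB; last exact: measurable_step_int.
    by apply: measurable_funM => //; exact: measurable_funB.
  + move: a1 a2; apply: filterS2 => w E1 E2 _ /=; congr (_%:E).
    rewrite step_int_sub E1 E2.
    have Gn : G != 0 by rewrite gt_eqF.
    have -> : G * (G^-1 * Y1 w - G^-1 * Y2 w) = Y1 w - Y2 w by field.
    ring.
Qed.

End Approximation.

Section StepBounds.
Context {R : realType}.
Notation mu := (@lebesgue_measure R).
Variables (f g : R -> R) (e : R).
Hypotheses (mf : measurable_fun setT f) (mg : measurable_fun setT g).
Hypothesis e0 : 0 <= e.
Hypothesis fg : (\int[mu]_x ((f x - g x) ^+ 2)%:E <= e%:E)%E.

Lemma tail_sqr_le (d C t h : R) : - 2^-1 < d -> 0 < h -> 0 <= C ->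
  (forall x, t < x < t + h -> `|g x| <= C * (t + h - x) `^ d) ->
  (forall x, t + h <= x -> g x = 0) ->
  (\int[mu]_(x in `]t, +oo[) (f x ^+ 2)%:E <=
   (2 * e + 2 * (C ^+ 2 * (h `^ (2 * d + 1) / (2 * d + 1))))%:E)%E.
Proof.
move=> d1 h0 C0 g1 g2.
have d1' : 0 < 2 * d + 1 by lra.
have gC : (\int[mu]_(x in `]t, +oo[) (g x ^+ 2)%:E <=
   (C ^+ 2 * (h `^ (2 * d + 1) / (2 * d + 1)))%:E)%E.
  have th : t < t + h by rewrite ltrDl.
  have := @integral_powR_right R t (t + h) (2 * d) th _.
  have dd : -1 < 2 * d by lra.
  move=> /(_ dd); rewrite (_ : t + h - t = h); last by ring.
  move=> hp.
  apply: (@le_trans _ _ (\int[mu]_(x in `]t, (t + h)%R[) (C ^+ 2 * (t + h - x) `^ (2 * d))%:E)%E).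
    rewrite integral_mkcond [leRHS]integral_mkcond; apply: ge0_le_integral => //.
    - by move=> x _; apply: erestrict_ge0 => y _; rewrite lee_fin sqr_ge0.
    - apply/(measurable_restrictT _ (measurable_itv _))/measurable_funTS.
      by apply/measurable_EFinP; exact: measurable_funX.
    - apply/(measurable_restrictT _ (measurable_itv _))/measurable_funTS.
      apply/measurable_EFinP; apply: measurable_funM => //.
      apply: (measurableT_comp (measurable_powR _)).
      by apply: measurable_funB => //; exact: measurable_id.
    - move=> x _; rewrite !patchE; case: ifPn; case: ifPn => //.
      + rewrite !inE/= !in_itv/= => /andP[x1 x2] _; rewrite lee_fin.
        have := g1 x; rewrite x1 x2 => /(_ isT) gx.
        rewrite -[g x ^+ 2]real_normK ?num_real//.
        apply: (@le_trans _ _ ((C * (t + h - x) `^ d) ^+ 2)).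
          by rewrite ler_pXn2r// nnegrE// mulr_ge0// powR_ge0.
        rewrite exprMn mulrC (mulrC (C ^+ 2)) ler_wpM2r ?sqr_ge0//.
        by rewrite mulrC powRrM powR_mulrn ?powR_ge0.
      + move=> xn; rewrite inE/= in_itv/= andbT => tx.
        rewrite g2 ?expr0n//= leNgt; apply/negP => xh.
        by move/negP: xn; apply; rewrite inE/= in_itv/= tx.
      + by move=> _ _; rewrite lee_fin mulr_ge0 ?sqr_ge0// powR_ge0.
  under eq_integral do rewrite EFinM.
  rewrite ge0_integralZl//.
  - by rewrite [leRHS]EFinM; apply: lee_pmul => //; [rewrite lee_fin sqr_ge0|
      apply: integral_ge0 => x _; rewrite lee_fin powR_ge0].
  - apply/measurable_EFinP; apply: measurable_funTS.
    apply: (measurableT_comp (measurable_powR _)).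
    by apply: measurable_funB => //; exact: measurable_id.
  - by move=> x _; rewrite lee_fin powR_ge0.
  - by rewrite lee_fin sqr_ge0.
have mI : measurable (`]t, +oo[%classic : set R) by [].
(* The sign is there because [integral_sqrB_le] bounds a difference: [f = (f - g) - (- g)]. *)
pose gt := (fun x => - g x) \_ `]t, +oo[.
pose dt := (fun x => f x - g x) \_ `]t, +oo[.
have r2 (k : R -> R) x : (((k \_ `]t, +oo[) x) ^+ 2)%:E =
    ((fun y => (k y ^+ 2)%:E) \_ `]t, +oo[) x.
  by rewrite !patchE; case: ifP => // _; rewrite /= expr0n.
have mdt : measurable_fun setT dt.
  by apply/(measurable_restrictT _ mI)/measurable_funTS; exact: measurable_funB.
have mgt : measurable_fun setT gt.
  apply/(measurable_restrictT _ mI)/measurable_funTS.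
  by apply: measurableT_comp.
have i1 : (\int[mu]_x (dt x ^+ 2)%:E <= e%:E)%E.
  apply: le_trans fg; under eq_integral do rewrite r2.
  rewrite -integral_mkcond; apply: ge0_subset_integral => //.
  - by apply/measurable_EFinP; apply: measurable_funX; exact: measurable_funB.
  - by move=> x _; rewrite lee_fin sqr_ge0.
have i2 : (\int[mu]_x (gt x ^+ 2)%:E <=
   (C ^+ 2 * (h `^ (2 * d + 1) / (2 * d + 1)))%:E)%E.
  apply: le_trans gC; under eq_integral do rewrite r2.
  rewrite -integral_mkcond le_eqVlt; apply/orP; left; apply/eqP.
  by apply: eq_integral => x _; rewrite sqrrN.
have := @integral_sqrB_le _ _ _ mu _ _ _ _ mdt mgt i1 i2.
apply: le_trans; rewrite le_eqVlt; apply/orP; left; apply/eqP/esym.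
rewrite [RHS]integral_mkcond; apply: eq_integral => x _.
rewrite -[RHS](r2 f x) /dt /gt !patchE; case: ifP => _; congr (_%:E).
  by congr (_ ^+ 2); ring.
by rewrite subr0.
Qed.

(** Chebyshev: where [|g| >= 2 * kappa] but [|f| < kappa], the two differ by at least [kappa], which
    happens on a set of length at most [e / kappa ^+ 2]. *)
Lemma large_values_integral_ge (a b c kappa : R) : a <= b -> b <= c -> 0 < kappa ->
  (forall x, a < x <= b -> 2 * kappa <= `|g x|) ->
  ((b - a - e / kappa ^+ 2)%:E <=
    \int[mu]_(y in `]a, c]) ((kappa <= `|f y|)%R%:R)%:E)%E.
Proof.
move=> ab bc k0 gk.
pose phi y : R := (kappa <= `|f y|)%R%:R.
have mphi : measurable_fun [set: R] phi.
  have mb : measurable_fun [set: R] (fun v : R => kappa <= `|f v|).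
    apply: measurable_fun_ler; first exact: measurable_cst.
    exact: (measurableT_comp (@normr_measurable R setT) mf).
  rewrite (_ : phi = fun v => if kappa <= `|f v| then 1 else 0); last first.
    by apply/funext => v; rewrite /phi; case: ifP.
  exact: measurable_fun_ifT.
have mdiff : measurable_fun [set: R] (fun y => (kappa ^- 2 * (f y - g y) ^+ 2)%:E).
  apply/measurable_EFinP; apply: measurable_funM => //.
  by apply: measurable_funX; exact: measurable_funB.
have h1 : ((b - a)%:E <= \int[mu]_(y in `]a, b]) (phi y)%:E + (e / kappa ^+ 2)%:E)%E.
  apply: (@le_trans _ _ (\int[mu]_(y in `]a, b]) 1%:E)%E).
    rewrite integral_cst//= mul1e lebesgue_measure_itv/= lte_fin.
    case: ltP => [_|ba]; first by rewrite -EFinB.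
    by rewrite lee_fin subr_le0.
  apply: (@le_trans _ _ (\int[mu]_(y in `]a, b])
      ((phi y)%:E + (kappa ^- 2 * (f y - g y) ^+ 2)%:E))%E).
    apply: ge0_le_integral => //.
    - apply: emeasurable_funD; last exact: measurable_funTS.
      by apply/measurable_EFinP; exact: measurable_funTS.
    - move=> y /=; rewrite in_itv/= => /gk gy; rewrite -EFinD lee_fin.
      rewrite /phi; case: (leP kappa) => fy.
        by rewrite lerDl mulr_ge0 ?sqr_ge0// invr_ge0 exprn_ge0// ltW.
      rewrite add0r mulrC ler_pdivlMr ?exprn_gt0// mul1r.
      rewrite -[(f y - g y) ^+ 2]real_normK ?num_real//.
      rewrite ler_pXn2r ?nnegrE ?(ltW k0)//.
      by have := lerB_dist (g y) (f y); rewrite distrC; lra.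
  rewrite ge0_integralD//; last 4 first.
  - by move=> y _; rewrite lee_fin.
  - by apply/measurable_EFinP; exact: measurable_funTS.
  - by move=> y _; rewrite lee_fin mulr_ge0 ?sqr_ge0// invr_ge0 exprn_ge0// ltW.
  - exact: measurable_funTS.
  rewrite leeD2l//.
  apply: (@le_trans _ _ (\int[mu]_y (kappa ^- 2 * (f y - g y) ^+ 2)%:E)%E).
    apply: ge0_subset_integral => //.
    by move=> y _; rewrite lee_fin mulr_ge0 ?sqr_ge0// invr_ge0 exprn_ge0// ltW.
  under eq_integral do rewrite EFinM.
  rewrite ge0_integralZl//; last 3 first.
  - by apply/measurable_EFinP; apply: measurable_funX; exact: measurable_funB.
  - by move=> y _; rewrite lee_fin sqr_ge0.
  - by rewrite lee_fin invr_ge0 exprn_ge0// ltW.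
  rewrite (mulrC e) [leRHS]EFinM; apply: lee_pmul => //.
  - by rewrite lee_fin invr_ge0 exprn_ge0// ltW.
  - by apply: integral_ge0 => y _; rewrite lee_fin sqr_ge0.
rewrite EFinB leeBlDr//; apply: (le_trans h1); rewrite leeD2r//.
apply: ge0_subset_integral => //.
- by apply/measurable_EFinP; exact: measurable_funTS.
- by move=> y _; rewrite lee_fin.
- by move=> y /=; rewrite !in_itv/= => /andP[-> yb]/=; exact: le_trans bc.
Qed.

End StepBounds.

Section AntiConcentration.
Context {disp : measure_display} {T : measurableType disp} {R : realType}.
Variable P : probability T R.

(* [1 + cos y >= 15/8 1_(|y| < 1/2)], so one small value of the characteristic
   function already prevents concentration near the origin. *)
Lemma cf2_small_ball (X : T -> R) (theta : R) : measurable_fun setT X ->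
  0 < theta -> cf2 P X theta <= 16^-1 ^+ 2 ->
  fine (P [set w | `|X w| < (2 * theta)^-1]) <= 17 / 30.
Proof.
move=> mX t0 hcf.
pose A := [set w | `|X w| < (2 * theta)^-1].
have mA : measurable A.
  have mN : measurable_fun setT (fun w => `|X w|).
    exact: (measurableT_comp (@normr_measurable R setT)).
  have -> : A = [set: T] `&` (fun w => `|X w|) @^-1` `]-oo, (2 * theta)^-1[.
    by rewrite setTI; apply/seteqP; split => w; rewrite /A /= in_itv.
  exact: mN (measurable_itv _).
have c1 : \int[P]_w cos (theta * X w) <= 16^-1.
  have := sqr_ge0 (\int[P]_w sin (theta * X w)).
  move: hcf; rewrite /cf2; set a := \int[P]_w cos _; set b := \int[P]_w sin _.
  move=> h1 h2.
  have h3 : a ^+ 2 <= 16^-1 ^+ 2 by lra.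
  by rewrite leNgt; apply/negP => h4; nra.
have ic := integrable_cosZ P theta mX.
have i1 : P.-integrable setT (EFin \o cst (1 : R)).
  exact: finite_measure_integrable_cst.
have iA : P.-integrable setT (EFin \o (\1_A : T -> R)).
  apply: (@bounded_integrable _ _ _ P _ 1); first exact: measurable_indic.
  exact: indic_norm_le.
have h : \int[P]_w (15 / 8 * \1_A w) <= \int[P]_w (cst 1 w + cos (theta * X w)).
  apply: le_Rintegral => //.
  - exact: (integrableZl measurableT _ iA).
  - exact: (integrable_funD i1 ic).
  - move=> w _; rewrite indicE; case: (boolP (w \in A)) => [|_]; last first.
      by rewrite mulr0; have := cos_geN1 (theta * X w); rewrite /cst; lra.
    rewrite inE /A/= => hw.
    have : `|theta * X w| <= 2^-1.
      rewrite normrM (gtr0_norm t0); apply: ltW.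
      by move: hw; rewrite invfM ltr_pdivlMr// mulrC.
    move=> h2; have := one_sub_cos_le (theta * X w).
    rewrite -[(theta * X w) ^+ 2]real_normK ?num_real// /cst.
    have z0 := normr_ge0 (theta * X w).
    move: z0 h2; set z := `|_ * _| => z0 h2.
    rewrite mulr1; nra.
(* The mean of the cosine is at most 1/16, whence [15 / 8 * P A <= 17 / 16]. *)
move: h; rewrite RintegralZl// Rintegral_indic// RintegralD// Rintegral_probability_cst.
rewrite -/A; lra.
Qed.

End AntiConcentration.

Section Tightness.
Context {disp : measure_display} {T : measurableType disp} {R : realType}.
Variable P : probability T R.

(** Continuity from above along the tail unions, whose intersection is null. *)
Lemma eventually_small (A : nat -> set T) (e : R) :
  (forall k, measurable (A k)) ->
  {ae P, forall w, exists k0, forall k, (k0 <= k)%N -> ~ A k w} ->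
  0 < e -> exists k, fine (P (A k)) <= e.
Proof.
move=> mA [N [mN PN hN]] e0.
pose B k := \bigcup_(j in [set j | (k <= j)%N]) A j.
have mB k : measurable (B k) by apply: bigcup_measurable => j _.
have mI : measurable (\bigcap_k B k) by exact: bigcapT_measurable.
have niB : nonincreasing_seq B.
  move=> m n mn; rewrite subsetEset => w [j /= nj Aj].
  by exists j => //=; exact: leq_trans nj.
have P0 : P (\bigcap_k B k) = 0%E.
  apply/eqP; rewrite eq_le measure_ge0 andbT -PN le_measure ?inE//.
  move=> w hw; apply: hN => /= -[k0 hk0].
  by have [j /= kj Aj] := hw k0 I; exact: (hk0 j kj).
have Pfin C : measurable C -> P C \is a fin_num by move=> mC; exact: fin_num_measure.
have B0 : (P (B 0%N) < +oo)%E by rewrite ltey_eq Pfin.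
have hc : P (B k) @[k --> \oo] --> 0%E.
  by rewrite -P0; exact: (nonincreasing_cvg_mu B0 mB mI niB).
have : \forall k \near \oo, (P (B k) < e%:E)%E by exact: (ereal_cvg0_lt hc e0).
move=> /filter_ex[k hk]; exists k.
rewrite -lee_fin fineK ?Pfin//; apply: ltW; apply: le_lt_trans hk.
by apply: le_measure; rewrite ?inE// => w Aw; exists k => /=.
Qed.

Lemma tight_rv (X : T -> R) (e : R) : measurable_fun setT X -> 0 < e ->
  exists M : R, 0 < M /\ fine (P [set w | M < `|X w|]) <= e.
Proof.
move=> mX e0.
have mN : measurable_fun setT (fun w => `|X w|).
  exact: (measurableT_comp (@normr_measurable R setT)).
pose A k := [set w | k.+1%:R < `|X w|].
have mA k : measurable (A k).
  have -> : A k = [set: T] `&` (fun w => `|X w|) @^-1` `]k.+1%:R, +oo[.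
    by rewrite setTI; apply/seteqP; split => w; rewrite /A /= in_itv/= andbT.
  exact: mN (measurable_itv _).
have [|k hk] := eventually_small mA _ e0; last by exists k.+1%:R.
apply: aeW => w; exists (Num.truncn `|X w|) => k kw; apply/negP.
rewrite -leNgt ltW//; apply: (lt_le_trans (truncnS_gt _)).
by rewrite ler_nat.
Qed.

End Tightness.

Section StepPackage.
Context {disp : measure_display} {T : measurableType disp} {R : realType}.
Variable P : probability T R.
Variable nu : {measure set R -> \bar R}.
Variable L : R -> {RV P >-> R}.
Hypothesis hL : driving_levy nu L.
Notation mu := (@lebesgue_measure R).
Let K := second_moment_bound nu.

Lemma cos_exponentN v : cos_exponent nu (- v) = cos_exponent nu v.
Proof. by apply: eq_Rintegral => x _; rewrite mulNr cosN. Qed.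

Lemma cos_exponent_norm v : cos_exponent nu `|v| = cos_exponent nu v.
Proof.
by have [v0|v0] := leP 0 v; [rewrite ger0_norm|rewrite ltr0_norm// cos_exponentN].
Qed.

(** [Cp] and [Cm] carry the sign of the past part [B] where its size lies between [a] and the cap
    [M]; [xi] is the noise of the current step and [r] the approximation error. The identity for [X]
    is asked only after multiplication by the sign, so empty events give a trivial instance. The cap
    stands in for integrability of [B]. *)
Record step_decomposition (t h a C2 M : R) (X B xi r : T -> R) (Cp Cm : set T)
    : Prop := {
  step_eq : forall w, (\1_Cp w - \1_Cm w) * X w
                      = (\1_Cp w - \1_Cm w) * (B w + xi w + r w) ;
  step_pos : past_filtration P L t Cp ;
  step_neg : past_filtration P L t Cm ;
  step_ge : forall w, a * (\1_Cp w + \1_Cm w) <= (\1_Cp w - \1_Cm w) * B w ;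
  step_le : forall w, (\1_Cp w - \1_Cm w) * B w <= M ;
  step_mB : measurable_fun setT B ;
  step_xi : measurable_fun setT xi ;
  step_xi2 : P.-integrable setT (fun w => (xi w ^+ 2)%:E) ;
  step_xi2_le : \int[P]_w (xi w ^+ 2) <= C2 * h ;
  step_xi_mean : forall Z : T -> R,
    (forall A, measurable A -> past_filtration P L t (Z @^-1` A)) ->
    (forall w, `|Z w| <= 1) -> \int[P]_w (Z w * xi w) = 0 ;
  step_r : P.-integrable setT (EFin \o r) ;
  step_r_le : \int[P]_w `|r w| <= 2 * h }.

Variables (d alpha : R) (k : R -> R -> R) (S : R -> {RV P >-> R}).
Hypothesis hS : levy_moving_average L d k S.
Let G := Gamma (1 + d).
Hypothesis G0 : 0 < G.
Hypothesis d1 : - 2^-1 < d.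
Hypothesis alpha0 : 0 < alpha.
Variables (c C h0 cL v0 : R).
Hypotheses (c0 : 0 < c) (C0 : 0 < C) (cL0 : 0 < cL) (v00 : 0 < v0).
Hypothesis hk : forall t h x : R, 0 <= t -> 0 < h -> h < h0 ->
  (t - 2 * h <= x <= t - h -> c * h `^ d <= `|k (t + h) x - k t x|) /\
  (t < x < t + h -> `|k (t + h) x - k t x| <= C * (t + h - x) `^ d) /\
  (t + h <= x -> k (t + h) x = k t x).
Hypothesis hLam : forall v, v0 <= v -> cL * v `^ alpha <= cos_exponent nu v.

Definition jump_scale : R := c / (4 * (8 / cL) `^ alpha^-1).
Definition noise_const : R := K * (2 + 2 * (C ^+ 2 / (2 * d + 1))).

(** On at least half of the strip of length [h] the approximating step function is at least [kappa]
    in size. The frequency is chosen so that the exponent there is at least [8 / h], giving squared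
    modulus at most [expR (- 8)] for every [h]. *)
Lemma step_decomposition_exists (t h : R) :
  0 < h -> h < h0 -> cL * v0 `^ alpha * h <= 8 -> 2 * h <= t ->
  exists M B xi r Cp Cm,
    step_decomposition t h (jump_scale * h `^ (d + alpha^-1))
      (noise_const * h `^ (2 * d)) M
      (fun w => G * (S (t + h) w - S t w)) B xi r Cp Cm /\
    2 / 5 <= \int[P]_w (\1_Cp w + \1_Cm w).
Proof.
move=> hh hh0 hv ht.
have dd1 := d1; have al0 := alpha0; have c0' := c0; have cL0' := cL0.
have t0 : 0 <= t by lra.
have a0 : 0 <= t - 2 * h by lra.
have at_ : t - 2 * h <= t by lra.
have hd0 : 0 < h `^ d by exact: powR_gt0.
pose kappa := c * h `^ d / 2.
have k0 : 0 < kappa by rewrite divr_gt0// mulr_gt0.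
pose v := (8 / (cL * h)) `^ alpha^-1.
have cLh : 0 < cL * h by rewrite mulr_gt0.
have q0 : 0 < 8 / (cL * h) by rewrite divr_gt0.
have vpos : 0 < v by exact: powR_gt0.
have va : v `^ alpha = 8 / (cL * h).
  by rewrite /v -powRrM mulVf ?gt_eqF// powRr1// ltW.
have v0v : v0 <= v.
  have -> : v0 = (v0 `^ alpha) `^ alpha^-1.
    by rewrite -powRrM divff ?gt_eqF// powRr1// ltW.
  apply: ge0_ler_powR; rewrite ?nnegrE ?powR_ge0 ?invr_ge0 ?(ltW al0) ?(ltW q0)//.
  by rewrite ler_pdivlMr//; move: hv; lra.
pose theta := v / kappa.
have th0 : 0 < theta by rewrite divr_gt0.
pose e := Num.min (kappa ^+ 2 * h / 2) (Num.min (h ^+ 2) (h `^ (2 * d + 1))).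
have e0 : 0 < e.
  rewrite !lt_min !divr_gt0 ?mulr_gt0 ?exprn_gt0//=.
  exact: powR_gt0.
have e1 : e <= kappa ^+ 2 * h / 2 by rewrite ge_min lexx.
have e2 : e <= h ^+ 2 by rewrite !ge_min lexx orbT.
have e3 : e <= h `^ (2 * d + 1) by rewrite !ge_min lexx !orbT.
have [p [wf hp1 hp2]] := moving_average_approx hS G0 t (t + h) e0.
pose B := step_int_before L t p; pose xi := step_int_after L t p.
pose r w := G * (S (t + h) w - S t w) - step_int L p w.
have mB : measurable_fun setT B.
  by apply: (@past_measurable_fun _ _ _ P L t); exact: step_int_before_past.
have mxi : measurable_fun setT xi.
  apply: measurable_sum => q; apply: measurable_funM => //.
  exact: measurable_funB.
have mstep := @measurable_step_fun R p.
have mg : measurable_fun setT (fun x => k (t + h) x - k t x).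
  by apply: measurable_funB; exact: (moving_average_measurable hS).
have h2d : 0 < 2 * d + 1 by lra.
have hcf : cf2 P B theta <= 16^-1 ^+ 2.
  have hrho := @large_values_integral_ge R (step_fun p) _ e mstep mg hp1
    (t - 2 * h) (t - h) t kappa _ _ k0 _.
  have {}hrho : ((h / 2)%:E <= \int[mu]_(y in `](t - 2 * h)%R, t])
      ((kappa <= `|step_fun p y|)%R%:R)%:E)%E.
    have i1 : t - 2 * h <= t - h by lra.
    have i2 : t - h <= t by lra.
    have i3 x : t - 2 * h < x <= t - h -> 2 * kappa <= `|k (t + h) x - k t x|.
      move=> /andP[x1 x2].
      have [+ _] := hk x t0 hh hh0; rewrite x2 (ltW x1) => /(_ isT).
      by rewrite /kappa; lra.
    apply: (le_trans _ (hrho i1 i2 i3)); rewrite lee_fin.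
    have : e / kappa ^+ 2 <= h / 2.
      rewrite ler_pdivrMr ?exprn_gt0//; move: e1; lra.
    lra.
  have hl u : kappa <= `|u| -> 8 / h <= cos_exponent nu (theta * u).
    move=> ku; rewrite -cos_exponent_norm normrM (gtr0_norm th0).
    have vu : v <= theta * `|u|.
      by rewrite /theta mulrAC ler_pdivlMr// ler_pM2l.
    apply: le_trans (hLam (le_trans v0v vu)).
    have -> : 8 / h = cL * v `^ alpha.
      by rewrite va; field; rewrite !gt_eqF.
    rewrite ler_pM2l//; apply: ge0_ler_powR; rewrite ?nnegrE ?(ltW al0) ?(ltW vpos)//.
    by rewrite (le_trans (ltW vpos)).
  have l0 : 0 <= 8 / h by rewrite divr_ge0// ltW.
  apply: (le_trans (step_int_before_cf2 hL a0 at_ wf l0 hl hrho)).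
  have -> : 8 / h * (h / 2) = 4 by field; rewrite gt_eqF.
  have -> : - (2 * 4) = - (1 *+ 8) :> R by rewrite -mulr_natl; ring.
  (* [expR (- 8) <= 16^-1 ^+ 2] because [expR 1 >= 2] and [16 ^+ 2 = 2 ^+ 8]. *)
  rewrite expRN -mulr_natl mulr1 -[8%:R]mulr1 expRM_natl exprVn lef_pV2 ?posrE ?exprn_gt0 ?expR_gt0//.
  have -> : 16 ^+ 2 = 2 ^+ 8 :> R by ring.
  by rewrite ler_pXn2r ?nnegrE ?expR_ge0//; have := expR_ge1Dx (1 : R); lra.
pose a := (2 * theta)^-1.
have apos : 0 < a by rewrite invr_gt0 mulr_gt0.
have aE : a = jump_scale * h `^ (d + alpha^-1).
  rewrite /a /theta /kappa /v /jump_scale.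
  have -> : 8 / (cL * h) = 8 / cL * h^-1 by field; rewrite !gt_eqF.
  rewrite powRM ?invr_ge0 ?(ltW hh) ?divr_ge0 ?(ltW cL0)//.
  rewrite powRD; last by rewrite (gt_eqF hh) implybT.
  have -> : h^-1 `^ alpha^-1 = (h `^ alpha^-1)^-1.
    by rewrite -powR_inv1 ?(ltW hh)// -powRrM mulN1r powRN.
  have : 0 < h `^ alpha^-1 by exact: powR_gt0.
  have : 0 < (8 / cL) `^ alpha^-1 by rewrite powR_gt0// divr_gt0.
  set x1 := _ `^ _; set x2 := h `^ alpha^-1 => x10 x20.
  by field; rewrite !gt_eqF.
have small := cf2_small_ball mB th0 hcf.
(* Small and large values of [|B|] cost [17 / 30] and [1 / 32], which leaves slightly more than
   [2 / 5]. *)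
have e32 : 0 < 32^-1 :> R by rewrite invr_gt0.
have [M [M0 hM]] := tight_rv P mB e32.
pose Cp := B @^-1` `[a, M]; pose Cm := B @^-1` `[- M, - a].
have FCp : past_filtration P L t Cp by exact: step_int_before_past_filtration.
have FCm : past_filtration P L t Cm by exact: step_int_before_past_filtration.
have mCp : measurable Cp.
  by rewrite -[X in measurable X]setTI; exact: mB (measurable_itv _).
have mCm : measurable Cm.
  by rewrite -[X in measurable X]setTI; exact: mB (measurable_itv _).
have inCp w : (w \in Cp) = (a <= B w <= M).
  by apply/idP/idP; rewrite inE /Cp/= in_itv.
have inCm w : (w \in Cm) = (- M <= B w <= - a).
  by apply/idP/idP; rewrite inE /Cm/= in_itv.
have cases w : [\/ (w \in Cp) /\ (w \in Cm) = false,
    (w \in Cp) = false /\ (w \in Cm) | (w \in Cp) = false /\ (w \in Cm) = false].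
  rewrite inCp inCm.
  case: (boolP (a <= B w <= M)) => [/andP[b1 b2]|_].
    apply: Or31; split => //; apply/negP => /andP[_ b3]; lra.
  by case: (boolP (_ <= _ <= - a)) => _; [apply: Or32|apply: Or33].
have [ixi2 exi2] : P.-integrable setT (fun w => (xi w ^+ 2)%:E) /\
    \int[P]_w (xi w ^+ 2) <= noise_const * h `^ (2 * d) * h.
  have hC : (\int[mu]_(y in `]t, +oo[) (step_fun p y ^+ 2)%:E <=
     (2 * e + 2 * (C ^+ 2 * (h `^ (2 * d + 1) / (2 * d + 1))))%:E)%E.
    apply: (tail_sqr_le mstep mg hp1 dd1 hh (ltW C0)) => x.
      by move=> xth; have [_ [+ _]] := hk x t0 hh hh0; exact.
    by move=> xth /=; have [_ [_ kx]] := hk x t0 hh hh0; rewrite (kx xth) subrr.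
  have [i1 i2] := step_int_after_second_moment hL t0 wf hC.
  split => //; apply: (le_trans i2).
  have E1 : h `^ (2 * d) * h = h `^ (2 * d + 1).
    by rewrite powRD ?powRr1 ?(ltW hh)// (gt_eqF hh) implybT.
  rewrite /noise_const -[leRHS]mulrA E1 -[leRHS]mulrA.
  rewrite ler_wpM2l ?second_moment_bound_ge0//.
  move: e3; set Hd := h `^ (2 * d + 1) => e3.
  have -> : (2 + 2 * (C ^+ 2 / (2 * d + 1))) * Hd =
      2 * Hd + 2 * (C ^+ 2 * (Hd / (2 * d + 1))) by field; rewrite gt_eqF.
  by rewrite lerD2r ler_pM2l.
have mr : measurable_fun setT r.
  apply: measurable_funB; last exact: measurable_step_int.
  by apply: measurable_funM => //; exact: measurable_funB.
have ir2 : P.-integrable setT (fun w => (r w ^+ 2)%:E).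
  apply/integrableP; split; first by apply/measurable_EFinP; exact: measurable_funX.
  under eq_integral do rewrite gee0_abs ?lee_fin ?sqr_ge0//.
  exact: le_lt_trans hp2 (ltry _).
have ir : P.-integrable setT (EFin \o r) by exact: sqr_integrable.
have er2 : \int[P]_w (r w ^+ 2) <= h ^+ 2.
  rewrite /Rintegral -lee_fin fineK; last exact: integrable_fin_num.
  by rewrite (le_trans hp2)// lee_fin.
exists M, B, xi, r, Cp, Cm; split.
  split => //.
  - move=> w; congr (_ * _); rewrite /r (step_int_split L t p w) -/B -/xi.
    by rewrite /B /xi; ring.
  - move=> w; rewrite -aE !indicE; have := inCp w; have := inCm w.
    case: (cases w) => -[-> ->] /=; last by move=> *; lra.
      by move=> _ /esym/andP[]; lra.
    by move=> /esym/andP[_ b] _; lra.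
  - move=> w; rewrite !indicE; have := inCp w; have := inCm w.
    case: (cases w) => -[-> ->] /=; last by move=> *; lra.
      by move=> _ /esym/andP[]; lra.
    by move=> /esym/andP[b _] _; lra.
  - by move=> Z mZ Z1; exact: (step_int_after_mean0 hL t0 wf mZ Z1).
  - have i1 : P.-integrable setT (EFin \o cst h) by exact: finite_measure_integrable_cst.
    have i2 : P.-integrable setT (fun w => (h^-1 * r w ^+ 2)%:E).
      exact: (integrableZl measurableT _ ir2).
    apply: (@le_trans _ _ (\int[P]_w (cst h w + h^-1 * r w ^+ 2))).
      apply: le_Rintegral => //.
      + exact: (integrable_norm ir).
      + exact: (integrable_funD i1 i2).
      + move=> w _; rewrite /cst -[r w ^+ 2]real_normK ?num_real//.
        have z0 := normr_ge0 (r w); set z := `|r w| in z0 *.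
        have : 0 <= h^-1 * (z - h) ^+ 2 by rewrite mulr_ge0 ?sqr_ge0// invr_ge0 ltW.
        have -> : h^-1 * (z - h) ^+ 2 = h^-1 * z ^+ 2 - 2 * z + h.
          by field; rewrite gt_eqF.
        lra.
    rewrite RintegralD// Rintegral_probability_cst RintegralZl//.
    have : h^-1 * \int[P]_w (r w ^+ 2) <= h^-1 * h ^+ 2.
      by rewrite ler_wpM2l// invr_ge0 ltW.
    rewrite (_ : h^-1 * h ^+ 2 = h); last by field; rewrite gt_eqF.
    lra.
pose A1 := [set w | `|B w| < a]; pose A2 := [set w | M < `|B w|].
have mN : measurable_fun setT (fun w => `|B w|).
  exact: (measurableT_comp (@normr_measurable R setT)).
have mA1 : measurable A1.
  have -> : A1 = [set: T] `&` (fun w => `|B w|) @^-1` `]-oo, a[.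
    by rewrite setTI; apply/seteqP; split => w; rewrite /A1 /= in_itv.
  exact: mN (measurable_itv _).
have mA2 : measurable A2.
  have -> : A2 = [set: T] `&` (fun w => `|B w|) @^-1` `]M, +oo[.
    by rewrite setTI; apply/seteqP; split => w; rewrite /A2 /= in_itv/= andbT.
  exact: mN (measurable_itv _).
have iI A : measurable A -> P.-integrable setT (EFin \o (\1_A : T -> R)).
  move=> mA; apply: (@bounded_integrable _ _ _ P _ 1); first exact: measurable_indic.
  exact: indic_norm_le.
have i1 : P.-integrable setT (EFin \o (cst 1 : T -> R)) by exact: finite_measure_integrable_cst.
have i12 := integrable_funD (iI _ mA1) (iI _ mA2).
have : \int[P]_w (cst 1 w - (\1_A1 w + \1_A2 w)) <= \int[P]_w (\1_Cp w + \1_Cm w).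
  apply: le_Rintegral => //.
  - by have := integrableB measurableT i1 i12.
  - exact: (integrable_funD (iI _ mCp) (iI _ mCm)).
  - move=> w _; rewrite !indicE.
    have iA1 : (w \in A1) = (`|B w| < a) by apply/idP/idP; rewrite inE.
    have iA2 : (w \in A2) = (M < `|B w|) by apply/idP/idP; rewrite inE.
    have n1 := ler0n R (w \in A1); have n2 := ler0n R (w \in A2).
    have n3 := ler0n R (w \in Cp); have n4 := ler0n R (w \in Cm).
    rewrite /cst; have [b1|b1] := ltP `|B w| a.
      by rewrite iA1 b1/=; lra.
    have [b2|b2] := ltP M `|B w|.
      by rewrite iA2 b2/=; lra.
    have [bs|bs] := leP 0 (B w).
      rewrite ger0_norm// in b1 b2.
      by rewrite inCp b1 b2/=; lra.
    rewrite ltr0_norm// in b1 b2.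
    have iCm : (w \in Cm) by rewrite inCm; apply/andP; split; lra.
    by rewrite iCm/=; lra.
rewrite RintegralB// Rintegral_probability_cst RintegralD; [|by []|exact: iI|exact: iI].
rewrite !Rintegral_indic//.
move: small hM; rewrite -/a -/A1 -/A2; lra.
Qed.

End StepPackage.

(** * Localisation and the contradiction *)

Section Localisation.
Context {disp : measure_display} {T : measurableType disp} {R : realType}.
Variable P : probability T R.
Variable L : R -> {RV P >-> R}.
Local Notation F := (past_filtration P L).

Lemma stopping_time_late (tau : nat -> T -> \bar R) (e : R) :
  (forall n, stopping_time F (tau n)) ->
  {ae P, forall w, (forall n, (tau n w <= tau n.+1 w)%E) /\
                   tau n w @[n --> \oo] --> +oo%E} ->
  0 < e -> exists k, fine (P [set w | (tau k w <= 1%:E)%E]) <= e.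
Proof.
move=> st ae e0; apply: eventually_small => //.
  move=> k; apply: (@past_filtration_measurable _ _ _ P L 1) => //.
  by have [_ h] := st k; apply: h.
move: ae; apply: filterS => w [_ hc].
have : \forall n \near \oo, (1%:E < tau n w)%E.
  apply: (hc [set x | (1%:E < x)%E]).
  by apply: open_nbhs_nbhs; split; [exact: open_ereal_gt_ereal|rewrite /= ltry].
move=> [k0 _ hk0]; exists k0 => k kk0 /=.
by apply/negP; rewrite -ltNge; exact: hk0.
Qed.

Definition grid_variation (A : R -> T -> R) (h : R) (m : nat) (w : T) : R :=
  \sum_(j < m) `|A (j.+1%:R * h) w - A (j%:R * h) w|.

Lemma grid_variation_bounded (f : R -> R) : bounded_variation 0 1 f ->
  exists M, forall n, (0 < n)%N ->
    \sum_(j < n) `|f (j.+1%:R * n%:R^-1) - f (j%:R * n%:R^-1)| <= M.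
Proof.
move=> [M hM]; exists M => n n0.
have nR : 0 < (n%:R : R) by rewrite ltr0n.
apply: hM; exists (mkseq (fun j => j.+1%:R * n%:R^-1) n).
  split.
    apply/(pathP 1) => i; rewrite size_mkseq => ilt.
    have nthE j : (j < n)%N -> nth 1 (0 :: mkseq (fun j => j.+1%:R * n%:R^-1 : R) n) j = j%:R * n%:R^-1.
      case: j => [_|j jn]; first by rewrite mul0r.
      by rewrite /= nth_mkseq// ltnW.
    rewrite nthE// nth_mkseq// ltr_pM2r ?invr_gt0// ltr_nat//.
  rewrite (last_nth 1) size_mkseq; case: n n0 nR => // n _ nR.
  by rewrite /= nth_mkseq// divff// gt_eqF.
rewrite /variation size_mkseq big_mkord; apply: eq_bigr => j _.
have nthE i : (i <= n)%N -> nth 1 (0 :: mkseq (fun j => j.+1%:R * n%:R^-1 : R) n) i = i%:R * n%:R^-1.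
  case: i => [_|i jn]; first by rewrite mul0r.
  by rewrite /= nth_mkseq.
by rewrite /= -[nth 1 (mkseq _ _) j]/(nth 1 (0 :: mkseq (fun j => j.+1%:R * n%:R^-1 : R) n) j.+1) !nthE// ltnW.
Qed.

Lemma measurable_adapted (X : R -> T -> R) t : 0 <= t -> adapted F X ->
  measurable_fun setT (X t).
Proof.
move=> t0 aX _ B mB; rewrite setTI.
exact: (past_filtration_measurable t0 (aX t t0 B mB)).
Qed.

(** The level is uniform in the mesh, since the total variation of a path bounds its variation along
    every grid. This order of quantifiers lets [K] be fixed before [h]. *)
Lemma variation_tight (A : R -> T -> R) (e : R) : finite_variation0 P F A ->
  0 < e -> exists K0 : R, forall n (K : R), (0 < n)%N -> K0 <= K ->
    fine (P [set w | K < grid_variation A n%:R^-1 n w]) <= e.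
Proof.
move=> [aA ae] e0.
pose D k := \bigcup_n [set w | k%:R < grid_variation A n.+1%:R^-1 n.+1 w].
have mV n : measurable_fun setT (grid_variation A n.+1%:R^-1 n.+1).
  apply: measurable_sum => j; apply: (measurableT_comp (@normr_measurable R setT)).
  by apply: measurable_funB; apply: measurable_adapted => //; rewrite mulr_ge0// invr_ge0.
have mS n (K : R) : measurable [set w | K < grid_variation A n.+1%:R^-1 n.+1 w].
  have -> : [set w | K < grid_variation A n.+1%:R^-1 n.+1 w] =
      [set: T] `&` (grid_variation A n.+1%:R^-1 n.+1) @^-1` `]K, +oo[.
    by rewrite setTI; apply/seteqP; split => w; rewrite /= in_itv/= andbT.
  exact: mV (measurable_itv _).
have mD k : measurable (D k) by apply: bigcup_measurable => n _; exact: mS.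
have [|k hk] := eventually_small (P := P) mD _ e0.
  move: ae; apply: filterS => w [_ _ bv].
  have [M hM] := grid_variation_bounded (bv 1 ler01).
  exists (Num.truncn M).+1 => k Mk [n _ /=]; apply/negP; rewrite -leNgt.
  apply: (le_trans (hM n.+1 isT)); apply: ltW; apply: (lt_le_trans (truncnS_gt _)).
  by rewrite ler_nat.
exists k%:R => -[//|n] K _ kK; apply: le_trans hk.
rewrite fine_le ?fin_num_measure//.
apply: le_measure; rewrite ?inE// => w /= Kw.
by exists n => //=; exact: le_lt_trans Kw.
Qed.

End Localisation.

(** * The discrete estimate on the unit interval *)

Section MainBound.
Context {disp : measure_display} {T : measurableType disp} {R : realType}.
Variable P : probability T R.
Variable L : R -> {RV P >-> R}.
Local Notation Ft := (past_filtration P L).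
Local Notation integ X := (P.-integrable setT (EFin \o (X : T -> R))).
Variables (S M A : R -> T -> R) (tau : T -> \bar R) (G : R).
Hypothesis G0 : 0 < G.
Hypothesis tau_st : stopping_time Ft tau.
Hypothesis N_mart : martingale P Ft (stopped tau M).
Hypothesis A_ad : adapted Ft A.
Hypothesis decomp : {ae P, forall w, forall t, 0 <= t ->
  S t w = S 0 w + M t w + A t w}.
Variables (n : nat) (h K a C2 c : R).
Hypotheses (h0 : 0 < h) (nh : n%:R * h = 1) (K0 : 0 < K) (a0 : 0 <= a).
Hypotheses (C20 : 0 <= C2) (c0 : 0 < c).
Let t (i : nat) : R := i%:R * h.
Let m1 := \int[P]_w `|stopped tau M 1 w|.

Hypothesis late : fine (P [set w | (tau w <= 1%:E)%E]) <= 16^-1.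
Hypothesis Kbig : 16 * m1 <= K.
Hypothesis Vsmall : fine (P [set w | K < grid_variation A h n w]) <= 16^-1.
Hypothesis steps : forall i, (2 <= i)%N -> exists Mi B xi r Cp Cm,
  step_decomposition L (t i) h a C2 Mi (fun w => G * (S (t i + h) w - S (t i) w))
    B xi r Cp Cm /\ 2 / 5 <= \int[P]_w (\1_Cp w + \1_Cm w).

Let F i := Ft (t i).
Let N i := stopped tau M (t i).

Let t_ge0 i : 0 <= t i. Proof. by rewrite mulr_ge0// ltW. Qed.
Let tS i : t i.+1 = t i + h. Proof. by rewrite /t -natr1 mulrDl mul1r. Qed.
Let t_le i j : (i <= j)%N -> t i <= t j.
Proof. by move=> ij; rewrite ler_wpM2r ?(ltW h0)// ler_nat. Qed.
Let tn : t n = 1. Proof. exact: nh. Qed.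

Let Fsigma i : sigma_algebra setT (F i).
Proof. exact: past_filtration_sigma_algebra. Qed.
Let Fmeas i : F i `<=` measurable.
Proof. exact: past_filtration_measurable. Qed.
Let Fmono i j : (i <= j)%N -> F i `<=` F j.
Proof. by move=> ij; apply: past_filtration_mono => //; exact: t_le. Qed.
Let Nadapt i B : measurable B -> F i (N i @^-1` B).
Proof. by move=> mB; exact: (martingale_adapted N_mart). Qed.
Let Nint i : integ (N i).
Proof. exact: (martingale_integrable N_mart). Qed.
Let Nmart i j D : (i <= j)%N -> F i D ->
  (\int[P]_(w in D) (N j w)%:E = \int[P]_(w in D) (N i w)%:E)%E.
Proof. by move=> ij FD; apply: (martingale_cond N_mart) => //; exact: t_le. Qed.

Lemma adapted_grid_variation i B : measurable B ->
  F i (grid_variation A h i @^-1` B).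
Proof.
move=> mB; pose U := g_sigma_algebraType (F i).
have E := sigma_algebra_id (Fsigma i).
have mA j : (j <= i)%N -> measurable_fun [set: U] (A (t j) : U -> R).
  move=> ji _ D mD; rewrite setTI; change (<<s F i >> (A (t j) @^-1` D)); rewrite E.
  by apply: (Fmono ji); exact: A_ad.
have mV : measurable_fun [set: U] (grid_variation A h i : U -> R).
  apply: (@measurable_sum _ U _ _ _ _ (fun j : 'I_i => fun w => `|A (j.+1%:R * h) w - A (j%:R * h) w|)) => j.
  apply: (measurableT_comp (@normr_measurable R setT)).
  by apply: measurable_funB; apply: mA => //; exact: ltnW.
have := mV measurableT B mB; rewrite setTI.
by change (<<s F i >> (grid_variation A h i @^-1` B) -> F i (grid_variation A h i @^-1` B)); rewrite E.
Qed.

(** Known at time [t i], decreasing in [i], and included in the event where the stopped martingale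
    still coincides with [M] at all grid points so far. *)
Definition alive (i : nat) : set T :=
  [set w | ((t i)%:E < tau w)%E] `&` below N K i.+1 `&`
  [set w | grid_variation A h i w <= K].

Lemma alive_filtration i : F i (alive i).
Proof.
apply: (filtrationI Fsigma); last first.
  rewrite (_ : [set w | _] = grid_variation A h i @^-1` `]-oo, K]).
    exact: adapted_grid_variation.
  by apply/seteqP; split => w; rewrite /= in_itv.
apply: (filtrationI Fsigma); last exact: below_filtration.
rewrite (_ : [set w | _] = ~` [set w | (tau w <= (t i)%:E)%E]).
  by apply: (filtrationC Fsigma); have [_] := tau_st; apply.
by apply/seteqP; split => w /=; rewrite ltNge => /negP.
Qed.

Lemma alive_mono i : alive i.+1 `<=` alive i.
Proof.
move=> w [[h1 h2] h3]; split; first split.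
- by apply: le_lt_trans h1; rewrite lee_fin t_le.
- by move: h2; rewrite belowS => -[].
- by apply: le_trans h3; rewrite /= /grid_variation big_ord_recr/= lerDl.
Qed.

Lemma alive_norm i w : (i <= n)%N -> alive i w -> `|N i w| <= K.
Proof. by move=> _ [[_ h2] _]; exact: h2. Qed.

Lemma alive_stopped i j w : (j <= i)%N -> alive i w -> N j w = M (t j) w.
Proof.
move=> ji [[h1 _] _]; rewrite /N /stopped min_r//.
by apply: ltW; apply: le_lt_trans h1; rewrite lee_fin t_le.
Qed.

(** The shift to [alive i.+1] discards the increment of [A] that breaks the bound, so its jumps need
    no control. If the path is alive at the last index, the sum is below the grid variation there;
    otherwise the last term vanishes. *)
Lemma alive_variation w (m : nat) :
  \sum_(i < m) \1_(alive i.+1) w * `|A (t i.+1) w - A (t i) w| <= K.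
Proof.
elim: m => [|m IH]; first by rewrite big_ord0 ltW.
have [hin|hout] := boolP (w \in alive m.+1).
  have : grid_variation A h m.+1 w <= K by move: hin; rewrite inE => -[].
  apply: le_trans; apply: ler_sum => i _.
  by rewrite ler_piMl// indic_le1.
by rewrite big_ord_recr/= [\1_(alive m.+1) w]indicE (negbTE hout) mul0r addr0.
Qed.

Let Emeas i : measurable (alive i). Proof. exact: Fmeas (alive_filtration i). Qed.

(** Three ways to die by time 1, each of probability at most 1/16: the localising time, the maximum
    of the martingale, the variation of [A]. *)
Lemma alive_probability : 13 / 16 <= fine (P (alive n)).
Proof.
have mb : measurable (below N K n.+1).
  exact: Fmeas (below_filtration Fsigma Fmono Nadapt K n).
have doob := doob_below n Fsigma Fmeas Fmono Nadapt Nint Nmart K0.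
have hm : (\int[P]_w `|N n w|) / K <= 16^-1.
  by rewrite ler_pdivrMr// /N tn -/m1; move: Kbig; lra.
pose D1 := [set w | (tau w <= 1%:E)%E].
pose D3 := [set w | K < grid_variation A h n w].
have mD1 : measurable D1.
  by apply: (Fmeas (i := n)); have [_] := tau_st; rewrite /F tn; apply.
have mD3 : measurable D3.
  apply: (Fmeas (i := n)).
  rewrite (_ : D3 = grid_variation A h n @^-1` `]K, +oo[).
    exact: adapted_grid_variation.
  by apply/seteqP; split => w; rewrite /D3 /= in_itv/= andbT.
have iI (B : set T) : measurable B -> integ (\1_B : T -> R).
  move=> mB; apply: (@bounded_integrable _ _ _ P _ 1); first exact: measurable_indic.
  exact: indic_norm_le.
have : \int[P]_w (\1_(below N K n.+1) w - (\1_D1 w + \1_D3 w)) <=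
    \int[P]_w (\1_(alive n) w).
  apply: le_Rintegral => //.
  - have := integrableB measurableT (iI _ mb) (integrable_funD (iI _ mD1) (iI _ mD3)).
    exact.
  - exact: iI.
  - move=> w _; have g0 := indic_ge0 (alive n) w (R := R).
    have g1 := indic_ge0 D1 w (R := R); have g3 := indic_ge0 D3 w (R := R).
    have [wb|wb] := boolP (w \in below N K n.+1); last first.
      by rewrite [\1_(below _ _ _) w]indicE (negbTE wb)/=; lra.
    rewrite [\1_(below _ _ _) w]indicE wb.
    have [w1|w1] := boolP (w \in D1); first by rewrite [\1_D1 w]indicE w1/=; lra.
    have [w3|w3] := boolP (w \in D3); first by rewrite [\1_D3 w]indicE w3/=; lra.
    suff -> : \1_(alive n) w = 1 :> R by rewrite /=; lra.
    rewrite indicE mem_set//; split; first split.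
    + by rewrite /= tn ltNge; apply/negP => hh; move/negP: w1; apply; rewrite inE.
    + by rewrite inE in wb.
    + by rewrite /= leNgt; apply/negP => hh; move/negP: w3; apply; rewrite inE.
rewrite RintegralB//; [|exact: iI|exact: (integrable_funD (iI _ mD1) (iI _ mD3))].
rewrite RintegralD//; [|exact: iI|exact: iI].
rewrite !Rintegral_indic//.
move: late Vsmall; rewrite -/D1 -/D3; lra.
Qed.

(** Fills the first two steps, for which the strip would start before time 0. *)
Lemma trivial_step (s : R) (X : T -> R) : 0 <= s ->
  step_decomposition L s h a C2 0 X (cst 0) (cst 0) (cst 0) set0 set0.
Proof.
move=> s0.
have Z0 : past_filtration P L s set0.
  by case: (past_filtration_sigma_algebra L s0).
have i0 : P.-integrable setT (EFin \o (cst 0 : T -> R)).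
  exact: finite_measure_integrable_cst.
split => //.
- by move=> w; rewrite !indic0 subrr !mul0r.
- by move=> w; rewrite !indic0 addr0 subrr mulr0 mul0r.
- by move=> w; rewrite !indic0 subrr mul0r.
- rewrite (_ : (fun w => _) = EFin \o cst 0)//.
  by apply/funext => w; rewrite /= expr0n.
- rewrite (_ : (fun w => _) = cst 0) ?Rintegral_probability_cst ?mulr_ge0// ?ltW//.
  by apply/funext => w; rewrite /= expr0n.
- move=> Z _ _; rewrite (_ : (fun w => _) = cst 0) ?Rintegral_probability_cst//.
  by apply/funext => w; rewrite /= mulr0.
- rewrite (_ : (fun w => _) = cst 0) ?Rintegral_probability_cst ?mulr_ge0// ?ltW//.
  by apply/funext => w; rewrite /= normr0.
Qed.

(** Both sides bound the sum of the expectations of [e i * B i], with [e i] the sign of [B i] on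
    [alive i.+1]: below by anti-concentration, above by solving the semimartingale decomposition for
    [B i] and bounding the four remaining transforms. *)
Lemma semimartingale_step_bound :
  a * (n%:R - 2) / 40 <=
  G * (K + m1) + G * K + (c + c^-1 * (n%:R * (C2 * h))) + n%:R * (2 * h).
Proof.
pose X i w := G * (S (t i.+1) w - S (t i) w).
have /choice[z hz] : forall i, exists z : R * (T -> R) * (T -> R) * (T -> R) * set T * set T,
   let: (Mi, B, xi, r, Cp, Cm) := z in
   step_decomposition L (t i) h a C2 Mi (X i) B xi r Cp Cm /\
   ((2 <= i)%N -> 2 / 5 <= \int[P]_w (\1_Cp w + \1_Cm w)).
  move=> i; have [i2|i2] := leqP 2 i.
    have [Mi [B [xi [r [Cp [Cm [h1 h2]]]]]]] := steps i2.
    by exists (Mi, B, xi, r, Cp, Cm); split => //; rewrite /X tS.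
  exists (0, cst 0, cst 0, cst 0, set0, set0); split; last by [].
  exact: trivial_step.
pose Mi i := (z i).1.1.1.1.1; pose B i := (z i).1.1.1.1.2; pose xi i := (z i).1.1.1.2.
pose r i := (z i).1.1.2; pose Cp i := (z i).1.2; pose Cm i := (z i).2.
have hs i : step_decomposition L (t i) h a C2 (Mi i) (X i) (B i) (xi i) (r i) (Cp i) (Cm i).
  have := hz i; rewrite /Mi /B /xi /r /Cp /Cm.
  by case: (z i) => [[[[[? ?] ?] ?] ?] ?] [].
have hp i : (2 <= i)%N -> 2 / 5 <= \int[P]_w (\1_(Cp i) w + \1_(Cm i) w).
  have := hz i; rewrite /Cp /Cm.
  by case: (z i) => [[[[[? ?] ?] ?] ?] ?] [].
clear hz; clearbody Mi B xi r Cp Cm; clear z.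
have FCp i : F i (Cp i) := step_pos (hs i).
have FCm i : F i (Cm i) := step_neg (hs i).
have mCp i := Fmeas (FCp i); have mCm i := Fmeas (FCm i).
pose H i w : R := \1_(Cp i) w - \1_(Cm i) w.
have mH i : measurable_fun setT (H i).
  by apply: measurable_funB; exact: measurable_indic.
have H1 i w : `|H i w| <= 1.
  have := indic_ge0 (Cp i) w (R := R); have := indic_ge0 (Cm i) w (R := R).
  have := indic_le1 (Cp i) w (R := R); have := indic_le1 (Cm i) w (R := R).
  by rewrite /H ler_norml; move=> *; apply/andP; split; lra.
pose e i w : R := \1_(alive i.+1) w * H i w.
have me i : measurable_fun setT (e i).
  by apply: measurable_funM; [exact: measurable_indic|exact: mH].
have e1 i w : `|e i w| <= 1.
  by rewrite normrM -[leRHS]mulr1; apply: ler_pM => //; exact: indic_norm_le.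
have ixi i : integ (xi i) := sqr_integrable (step_xi (hs i)) (step_xi2 (hs i)).
have ir i : integ (r i) := step_r (hs i).
have iI (D : set T) : measurable D -> integ (\1_D : T -> R).
  move=> mD; apply: (@bounded_integrable _ _ _ P _ 1); first exact: measurable_indic.
  exact: indic_norm_le.
have mA j : measurable_fun setT (A (t j)) by exact: (measurable_adapted (t_ge0 j) A_ad).
have HB0 i w : 0 <= H i w * B i w.
  apply: (le_trans _ (step_ge (hs i) w)).
  by rewrite mulr_ge0// addr_ge0// indic_ge0.
have ieB i : integ (fun w => e i w * B i w).
  apply: (@bounded_integrable _ _ _ P _ (Mi i)).
    by apply: measurable_funM => //; exact: step_mB (hs i).
  move=> w; rewrite /e -mulrA normrM (ger0_norm (HB0 i w)).
  apply: (le_trans _ (step_le (hs i) w)).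
  by rewrite ler_piMl// indic_norm_le.
have ieN i : integ (fun w => e i w * (N i.+1 w - N i w)).
  apply: (integ_boundedM (me i) (e1 i)).
  by have := integrableB measurableT (Nint i.+1) (Nint i).
have Abound i w : `|\1_(alive i.+1) w * (A (t i.+1) w - A (t i) w)| <= K.
  apply: (le_trans _ (alive_variation w i.+1)).
  rewrite big_ord_recr/= normrM ger0_norm ?indic_ge0// lerDr.
  by apply: sumr_ge0 => j _; rewrite mulr_ge0// indic_ge0.
have i1A i : integ (fun w => \1_(alive i.+1) w * (A (t i.+1) w - A (t i) w)).
  apply: (@bounded_integrable _ _ _ P _ K); last exact: Abound.
  by apply: measurable_funM; [exact: measurable_indic|exact: measurable_funB].
have ieA i : integ (fun w => e i w * (A (t i.+1) w - A (t i) w)).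
  rewrite (_ : (fun w => _) = (fun w => H i w * (\1_(alive i.+1) w * (A (t i.+1) w - A (t i) w)))).
    exact: (integ_boundedM (mH i) (H1 i) (i1A i)).
  by apply/funext => w; rewrite /e; ring.
have iexi i : integ (fun w => e i w * xi i w) := integ_boundedM (me i) (e1 i) (ixi i).
have ier i : integ (fun w => e i w * r i w) := integ_boundedM (me i) (e1 i) (ir i).
(* Off [alive i.+1] every product vanishes; on it [M] may be replaced by its stopped version at both
   ends of the step. *)
have each i : \int[P]_w (e i w * B i w) =
    G * \int[P]_w (e i w * (N i.+1 w - N i w))
    + G * \int[P]_w (e i w * (A (t i.+1) w - A (t i) w))
    - (\int[P]_w (e i w * xi i w) + \int[P]_w (e i w * r i w)).
  have j1 : integ (fun w => G * (e i w * (N i.+1 w - N i w))).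
    exact: (integrableZl measurableT _ (ieN i)).
  have j2 : integ (fun w => G * (e i w * (A (t i.+1) w - A (t i) w))).
    exact: (integrableZl measurableT _ (ieA i)).
  have j12 := integrable_funD j1 j2.
  have j34 := integrable_funD (iexi i) (ier i).
  have -> : \int[P]_w (e i w * B i w) = \int[P]_w
     ((G * (e i w * (N i.+1 w - N i w)) + G * (e i w * (A (t i.+1) w - A (t i) w)))
      - (e i w * xi i w + e i w * r i w)).
    rewrite /Rintegral; congr fine; apply: ae_eq_integral => //.
    - by case/integrableP : (ieB i).
    - by case/integrableP : (integrableB measurableT j12 j34).
    - move: decomp; apply: filterS => w hw _ /=; congr (_%:E).
      have [wa|wa] := boolP (w \in alive i.+1); last first.
        by rewrite /e [\1_(alive _) w]indicE (negbTE wa) !mul0r !mulr0 !addr0 subr0.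
      rewrite inE in wa.
      have Ni1 := alive_stopped (leqnn _) wa; have Ni := alive_stopped (leqnSn i) wa.
      have := step_eq (hs i) w; rewrite -/(H i w) /X (hw _ (t_ge0 i.+1)) (hw _ (t_ge0 i)).
      rewrite Ni1 Ni => hX.
      have -> : e i w * B i w = \1_(alive i.+1) w * (H i w * (B i w + xi i w + r i w))
          - (e i w * xi i w + e i w * r i w) by rewrite /e; ring.
      by rewrite -hX /e; ring.
  rewrite RintegralB// RintegralD// RintegralD//.
  have zN := RintegralZl G measurableT (ieN i).
  have zA := RintegralZl G measurableT (ieA i).
  by rewrite zN zA.
have lower i : (2 <= i)%N -> (i < n)%N -> a / 40 <= \int[P]_w (e i w * B i w).
  move=> i2 iltn.
  have iC : integ (fun w => \1_(Cp i) w + \1_(Cm i) w).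
    exact: (integrable_funD (iI _ (mCp i)) (iI _ (mCm i))).
  have i1 : integ (cst 1 : T -> R) by exact: finite_measure_integrable_cst.
  have iE : integ (fun w => 2 * (1 - \1_(alive n) w)).
    have := integrableZl measurableT 2 (integrableB measurableT i1 (iI _ (Emeas n))).
    exact.
  have iCE : integ (fun w => (\1_(Cp i) w + \1_(Cm i) w) - 2 * (1 - \1_(alive n) w)).
    by have := integrableB measurableT iC iE.
  have sub : alive n `<=` alive i.+1.
    move: iltn; elim: n => // m IH; rewrite ltnS leq_eqVlt => /predU1P[->//|im].
    by apply: subset_trans (@alive_mono m) _; exact: IH.
  (* Off [alive n] the subtracted 2 makes the integrand at most 0, while [e i * B i] is nonnegative
     everywhere. The mean is at least [a * (2 / 5 - 2 * (3 / 16)) = a / 40]. *)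
  apply: (@le_trans _ _ (\int[P]_w (a * ((\1_(Cp i) w + \1_(Cm i) w) - 2 * (1 - \1_(alive n) w))))).
    rewrite RintegralZl// RintegralB// RintegralZl//; last first.
      by have := integrableB measurableT i1 (iI _ (Emeas n)).
    rewrite RintegralB//; last exact: iI.
    rewrite Rintegral_probability_cst Rintegral_indic//.
    rewrite ler_wpM2l//; have := hp i i2; have := alive_probability; lra.
  apply: le_Rintegral => //.
    exact: (integrableZl measurableT _ iCE).
  move=> w _; have hB := step_ge (hs i) w; rewrite -/(H i w) in hB.
  have u1 := indic_le1 (Cp i) w (R := R); have u2 := indic_le1 (Cm i) w (R := R).
  have [wa|wa] := boolP (w \in alive n).
    have wi : w \in alive i.+1 by move: wa; rewrite !inE; exact: sub.
    rewrite [\1_(alive n) w]indicE wa /e [\1_(alive i.+1) w]indicE wi/=.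
    by rewrite subrr mulr0 subr0 mul1r.
  rewrite [\1_(alive n) w]indicE (negbTE wa)/= subr0 mulr1.
  apply: (@le_trans _ _ 0).
    by rewrite mulr_ge0_le0//; lra.
  by rewrite /e -mulrA mulr_ge0// indic_ge0.
have nonneg i : 0 <= \int[P]_w (e i w * B i w).
  by apply: Rintegral_ge0 => w _; rewrite /e -mulrA mulr_ge0// indic_ge0.
have low : a * (n%:R - 2) / 40 <= \sum_(i < n) \int[P]_w (e i w * B i w).
  rewrite -(big_mkord xpredT (fun i => \int[P]_w (e i w * B i w))).
  have [n2|n2] := leqP n 2.
    apply: (@le_trans _ _ 0).
      rewrite -mulrA mulr_ge0_le0// pmulr_lle0 ?invr_gt0// subr_le0.
      by rewrite ler_nat.
    by apply: sumr_ge0 => i _; exact: nonneg.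
  rewrite (@big_cat_nat _ _ _ 2)//=; last exact: ltnW.
  apply: ler_wpDl; first by apply: sumr_ge0 => i _; exact: nonneg.
  apply: (@le_trans _ _ (\sum_(2 <= i < n) (a / 40))).
    rewrite sumr_const_nat -[leRHS]mulr_natr natrB; last exact: ltnW.
    by rewrite le_eqVlt; apply/orP; left; apply/eqP; ring.
  apply: ler_sum_nat => i /andP[i2 iltn].
  exact: lower.
apply: (le_trans low).
rewrite (eq_bigr _ (fun (i : 'I_n) _ => each i)).
rewrite sumrB !big_split/= -!mulr_sumr.
have FE := alive_filtration.
have partN : \sum_(i < n) \int[P]_w (e i w * (N i.+1 w - N i w)) <= K + m1.
  apply: (le_trans (ler_norm _)).
  have := @martingale_transform_bound _ _ _ P F n Fsigma Fmeas Fmono N Nadapt Nint Nmart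
    alive K FE alive_mono alive_norm (ltW K0) Cp Cm FCp FCm.
  by rewrite /m1 -tn.
have partA : \sum_(i < n) \int[P]_w (e i w * (A (t i.+1) w - A (t i) w)) <= K.
  have iabs i : integ (fun w => \1_(alive i.+1) w * `|A (t i.+1) w - A (t i) w|).
    apply: (@bounded_integrable _ _ _ P _ K).
      apply: measurable_funM; first exact: measurable_indic.
      by apply: (measurableT_comp (@normr_measurable R setT)); exact: measurable_funB.
    by move=> w; rewrite normrM normr_id -normrM; exact: Abound.
  apply: (@le_trans _ _ (\sum_(i < n) \int[P]_w (\1_(alive i.+1) w * `|A (t i.+1) w - A (t i) w|))).
    apply: ler_sum => i _; apply: le_Rintegral => //.
    move=> w _; apply: (le_trans (ler_norm _)); rewrite /e !normrM.
    rewrite (ger0_norm (indic_ge0 _ _)) -mulrA ler_wpM2l ?indic_ge0//.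
    by rewrite ler_piMl.
  rewrite -(Rintegral_sum (X := fun i w => \1_(alive i.+1) w * `|A (t i.+1) w - A (t i) w|))//.
  have iK : integ (cst K : T -> R) by exact: finite_measure_integrable_cst.
  rewrite -[leRHS](Rintegral_probability_cst P K).
  apply: le_Rintegral => //.
    by apply: (integ_sum (X := fun i w => \1_(alive i.+1) w * `|A (t i.+1) w - A (t i) w|)) => i _.
  by move=> w _; exact: alive_variation.
have partxi : `|\sum_(i < n) \int[P]_w (e i w * xi i w)| <= c + c^-1 * (n%:R * (C2 * h)).
  apply: (noise_transform_bound Fmeas FE alive_mono c0 mH H1) => i _.
  - exact: ixi.
  - exact: step_xi2 (hs i).
  (* Here the indicator is that of [alive i], known at the start of the step, so the noise averages
     to 0; passing to [alive i.+1] is the exit term. *)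
  - apply: (step_xi_mean (hs i)) => [D mD|w]; last first.
      by rewrite normrM -[leRHS]mulr1; apply: ler_pM => //; exact: indic_norm_le.
    pose U := g_sigma_algebraType (F i).
    have E := sigma_algebra_id (Fsigma i).
    have mI (Q : set T) : F i Q -> measurable_fun [set: U] (\1_Q : U -> R).
      by move=> FQ; apply: (@measurable_indic _ U R setT Q); change (<<s F i >> Q); rewrite E.
    have mZ : measurable_fun [set: U] ((fun w => \1_(alive i) w * H i w) : U -> R).
      by apply: measurable_funM; [exact: mI|apply: measurable_funB; exact: mI].
    have := mZ measurableT D mD; rewrite setTI.
    by change (<<s F i >> ((fun w => \1_(alive i) w * H i w) @^-1` D) ->
      F i ((fun w => \1_(alive i) w * H i w) @^-1` D)); rewrite E.
  - exact: step_xi2_le (hs i).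
have partr : `|\sum_(i < n) \int[P]_w (e i w * r i w)| <= n%:R * (2 * h).
  apply: (le_trans (ler_norm_sum _ _ _)).
  apply: (@le_trans _ _ (\sum_(i < n) (2 * h))); last first.
    by rewrite sumr_const card_ord -[leLHS]mulr_natl.
  apply: ler_sum => i _; apply: (le_trans _ (step_r_le (hs i))).
  apply: (le_trans (le_normr_Rintegral measurableT (ier i))).
  apply: le_Rintegral => //.
  - exact: (integrable_norm (ier i)).
  - exact: (integrable_norm (ir i)).
  - by move=> w _; rewrite normrM ler_piMl.
have GN := ler_wpM2l (ltW G0) partN; have GA := ler_wpM2l (ltW G0) partA.
move: partxi partr; rewrite !ler_norml => /andP[p1 _] /andP[p2 _].
lra.
Qed.

End MainBound.

Lemma powR_small (R : realType) (gamma e : R) : 0 < gamma -> 0 < e ->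
  exists2 delta : R, 0 < delta & forall x, 0 < x -> x < delta -> x `^ gamma < e.
Proof.
move=> g0 e0; exists (e `^ gamma^-1); first exact: powR_gt0.
move=> x x0 xd.
have -> : e = (e `^ gamma^-1) `^ gamma.
  by rewrite -powRrM mulVf ?gt_eqF// powRr1// ltW.
by apply: gt0_ltr_powR; rewrite ?nnegrE ?powR_ge0 ?(ltW x0).
Qed.

Lemma moving_average_not_semimartingale (R : realType) (disp : measure_display)
    (T : measurableType disp) (P : probability T R) (alpha d : R)
    (k : R -> R -> R) (nu : {measure set R -> \bar R})
    (L : R -> {RV P >-> R}) (S : R -> {RV P >-> R}) (cL v0 : R) :
  1 < alpha -> - 2^-1 < d -> d + alpha^-1 < 1 -> 0 < Gamma (1 + d) ->
  kernel_increment_bounds d k -> driving_levy nu L ->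
  0 < cL -> 0 < v0 ->
  (forall v, v0 <= v -> cL * v `^ alpha <= cos_exponent nu v) ->
  levy_moving_average L d k S ->
  ~ semimartingale P (past_filtration P L) S.
Proof.
move=> al1 d1 dal G0 [c [C [h0 [c0 C0 h00 hk]]]] hL cL0 v00 hLam hS.
move=> [M [A [_ [_ _ [tau [tau_st tau_ae N_mart]]] FV decomp]]].
have al0 : 0 < alpha by lra.
have ial : alpha^-1 < 1 by rewrite invf_lt1.
have e16 : 0 < 16^-1 :> R by rewrite invr_gt0.
have [k0 late] := stopping_time_late tau_st tau_ae e16.
have [K0 hK0] := variation_tight FV e16.
pose m1 := \int[P]_w `|stopped (tau k0) M 1 w|.
have m10 : 0 <= m1 by apply: Rintegral_ge0.
pose K := Num.max K0 (16 * m1 + 1).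
have KK0 : K0 <= K by rewrite le_max lexx.
have Km : 16 * m1 + 1 <= K by rewrite le_max lexx orbT.
have Kpos : 0 < K by lra.
pose G := Gamma (1 + d).
pose J := jump_scale alpha c cL.
have J0 : 0 < J.
  by rewrite divr_gt0// mulr_gt0// powR_gt0// divr_gt0.
pose D := noise_const nu d C.
have D0 : 0 <= D.
  rewrite mulr_ge0 ?second_moment_bound_ge0// addr_ge0// mulr_ge0// divr_ge0 ?sqr_ge0//.
  lra.
pose Q := G * (K + m1) + G * K + 3 + D.
have GK : 0 <= G * (K + m1) + G * K.
  by rewrite addr_ge0// mulr_ge0 ?(ltW G0) ?addr_ge0 ?(ltW Kpos).
have Q0 : 0 < Q by rewrite /Q; lra.
have eps0 : 0 < J / (4 * 40 * Q) by rewrite divr_gt0// mulr_gt0.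
have g1 : 0 < 1 - d - alpha^-1 by lra.
have g2 : 0 < 1 - alpha^-1 by lra.
have [dl1 dl10 hdl1] := powR_small g1 eps0.
have [dl2 dl20 hdl2] := powR_small g2 eps0.
have b0 : 0 < cL * v0 `^ alpha by rewrite mulr_gt0// powR_gt0.
pose dl := Num.min (Num.min h0 4^-1) (Num.min (8 / (cL * v0 `^ alpha)) (Num.min dl1 dl2)).
have dl0 : 0 < dl.
  have i4 : 0 < 4^-1 :> R by rewrite invr_gt0.
  have q0 : 0 < 8 / (cL * v0 `^ alpha) by rewrite divr_gt0.
  by rewrite !lt_min h00 i4 q0 dl10 dl20.
pose n := (Num.truncn dl^-1).+1.
pose h : R := n%:R^-1.
have n0 : 0 < (n%:R : R) by rewrite ltr0n.
have hh : 0 < h by rewrite invr_gt0.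
have nh : n%:R * h = 1 by rewrite divff// gt_eqF.
have hdl : h < dl.
  by rewrite /h invf_plt ?posrE//; exact: truncnS_gt.
move: hdl; rewrite !lt_min => /andP[/andP[hh0 h4] /andP[h8 /andP[hd1 hd2]]].
have hv : cL * v0 `^ alpha * h <= 8.
  by move: h8; rewrite ltr_pdivlMr// mulrC => /ltW.
have hd0 : 0 < h `^ d by exact: powR_gt0.
have steps i : (2 <= i)%N -> exists Mi B xi r Cp Cm,
  step_decomposition L (i%:R * h) h (J * h `^ (d + alpha^-1)) (D * h `^ (2 * d)) Mi
    (fun w => G * (S (i%:R * h + h) w - S (i%:R * h) w)) B xi r Cp Cm /\
    2 / 5 <= \int[P]_w (\1_Cp w + \1_Cm w).
  move=> i2.
  apply: (step_decomposition_exists hL hS G0 d1 al0 c0 C0 cL0 v00 hk hLam hh hh0 hv).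
  by rewrite ler_wpM2r ?(ltW hh)// ler_nat.
have a0 : 0 <= J * h `^ (d + alpha^-1) by rewrite mulr_ge0 ?powR_ge0// ltW.
have C20 : 0 <= D * h `^ (2 * d) by rewrite mulr_ge0 ?powR_ge0.
have Kbig : 16 * m1 <= K by lra.
have Vsmall := hK0 n K isT KK0.
(* The free constant of the noise bound is taken to be [h]^ d[, which balances]c[against]D * h
   [^ (2 * d) / c]. *)
have := semimartingale_step_bound G0 (tau_st k0) (N_mart k0) (proj1 FV) decomp
  hh nh Kpos a0 C20 hd0 late Kbig Vsmall steps.
rewrite -/m1.
have -> : n%:R * (2 * h) = 2 by rewrite mulrCA nh mulr1.
have -> : n%:R * (D * h `^ (2 * d) * h) = D * h `^ (2 * d).
  by rewrite mulrCA nh mulr1.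
have -> : h `^ (2 * d) = h `^ d * h `^ d.
  by rewrite -powRD ?(gt_eqF hh) ?implybT//; congr (_ `^ _); ring.
have -> : (h `^ d)^-1 * (D * (h `^ d * h `^ d)) = D * h `^ d.
  by field; rewrite gt_eqF.
set p := h `^ (d + alpha^-1) in a0 *.
have p0 : 0 < p by exact: powR_gt0.
move=> main.
have E1 : h `^ (1 - d - alpha^-1) * p = h.
  rewrite -powRD ?(gt_eqF hh) ?implybT//.
  have -> : 1 - d - alpha^-1 + (d + alpha^-1) = 1 by ring.
  by rewrite powRr1 ?(ltW hh).
have E2 : h `^ (1 - alpha^-1) * p = h * h `^ d.
  have -> : h * h `^ d = h `^ (1 + d).
    by rewrite powRD ?powRr1 ?(ltW hh)// (gt_eqF hh) implybT.
  rewrite -powRD ?(gt_eqF hh) ?implybT//; congr (_ `^ _); ring.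
have s1 := hdl1 h hh hd1; have s2 := hdl2 h hh hd2.
have u1 : h < J / (4 * 40 * Q) * p by rewrite -[X in X < _]E1 ltr_pM2r.
have u2 : h * h `^ d < J / (4 * 40 * Q) * p by rewrite -[X in X < _]E2 ltr_pM2r.
have main2 : J * p * (n%:R - 2) / 40 <= Q * (1 + h `^ d).
  apply: (le_trans main); rewrite /Q.
  have aux (x y z : R) : 0 <= x -> 0 <= z -> 0 < y ->
      x + (y + z * y) + 2 <= (x + 3 + z) * (1 + y).
    by move=> x0 z0 y0; have := mulr_ge0 x0 (ltW y0); nra.
  exact: aux.
have main3 : J * p * (1 - 2 * h) / 40 <= Q * (h + h * h `^ d).
  have -> : J * p * (1 - 2 * h) / 40 = h * (J * p * (n%:R - 2) / 40).
    rewrite (_ : h * (J * p * (n%:R - 2) / 40) = J * p * (n%:R * h - 2 * h) / 40).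
      by rewrite nh.
    by ring.
  have -> : Q * (h + h * h `^ d) = h * (Q * (1 + h `^ d)) by ring.
  by rewrite ler_pM2l.
have u3 : Q * (h + h * h `^ d) < J * p / (2 * 40).
  have -> : J * p / (2 * 40) = Q * (J / (4 * 40 * Q) * p + J / (4 * 40 * Q) * p).
    by field; rewrite gt_eqF.
  by rewrite ltr_pM2l// ltrD.
have u4 : J * p / (2 * 40) <= J * p * (1 - 2 * h) / 40.
  have : 0 <= J * p by rewrite mulr_ge0 ?(ltW J0)// ltW.
  nra.
lra.
Qed.

Theorem proposition2p14 (R : realType) (disp : measure_display)
    (T : measurableType disp) (P : probability T R)
    (lambda alpha d : R)
    (hlambda : 0 < lambda)
    (halpha : 1 < alpha /\ alpha < 2)
    (hd : - 2^-1 < d /\ d < 2^-1) (hd0 : d != 0)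
    (hdalpha : 0 < d + alpha^-1 /\ d + alpha^-1 < 1)
    (nu : {measure set R -> \bar R}) (h : R -> R)
    (hmeas : measurable_fun setT h) (hge0 : forall x, 0 <= h x)
    (hnu : forall A : set R, measurable A ->
       nu A = (\int[lebesgue_measure]_(x in A) (h x)%:E)%E)
    (hequiv : h ~_(0^') (fun x : R => `|x| `^ (- 1 - alpha)))
    (L : R -> {RV P >-> R}) (hL : driving_levy nu L)
    (S : R -> {RV P >-> R})
    (hS : TFLP1 L d lambda S \/ TFLP2 L d lambda S) :
  ~ semimartingale P (past_filtration P L) S.
Proof.
have [al1 _] := halpha; have [d1 d2] := hd; have [_ dal] := hdalpha.
have al0 : 0 < alpha by exact: lt_trans al1.
have [cL [v0 [cL0 v00 hLam]]] :=
  cos_exponent_ge (driving_measure hL) al0 hmeas hge0 hnu hequiv.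
have G0 := Gamma_gt0 d1 d2.
case: hS => hS.
- apply: (moving_average_not_semimartingale al1 d1 dal G0 _ hL cL0 v00 hLam hS).
  exact: kernel1_increment_bounds.
- apply: (moving_average_not_semimartingale al1 d1 dal G0 _ hL cL0 v00 hLam hS).
  exact: kernel2_increment_bounds.
Qed.
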